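(* Let $f_0\in C^\infty([0,\infty))$ be a monotone solution of \[ f''(y)+\left(\frac{2}{y}-\frac{y}{2}\right)f'(y)-\frac{1}{y^2}\sin(2f(y))=0\ \ (y>0),\qquad f(0)=0,\qquad \lim_{y\to\infty}f(y)\ \text{finite}, \] satisfying $\lVert f_0-\widetilde f_0\rVert\le 5\cdot10^{-4}$ (notation in the context). Let $\mathcal A_0$ be the unique self-adjoint extension on $L^2_\rho(0,\infty)$, $\rho(y)=y^2e^{-y^2/4}$, of the operator \[ \mathcal A_0 w=-\frac{1}{\rho}\partial_y(\rho\,\partial_y w)+\frac{2\cos(2f_0(y))}{y^2}w \] defined on $C_0^\infty(0,\infty)$. Then the only eigenvalue of $\mathcal A_0$ in the interval $(-\infty,0]$ is $-1$.
   Context: Here $\widetilde f_0(y)=2\arctan\big(\sum_{n=0}^{14}(f_0)_nT_{2n+1}(y/\sqrt{2+y^2})\big)$ with $T_m$ the Chebyshev polynomials of the first kind and coefficients $(f_0)_0,\dots,(f_0)_{14}$ equal to $\frac{268245}{72878},\frac{-3174}{105551},\frac{1897}{97022},\frac{14}{72731},\frac{79}{119383},\frac{4}{66337},\frac{5}{109368},\frac{1}{109045},\frac{1}{204079},\frac{1}{675805},\frac{1}{1400761},\frac{1}{3586839},\frac{1}{7289041},\frac{1}{16940631},\frac{1}{59286294}$; the norm is $\lVert f\rVert=\lVert p_1f\rVert_{L^\infty(0,\infty)}+\lVert p_3f'\rVert_{L^\infty(0,\infty)}$ with $p_1(y)=\frac{\sqrt{2+y^2}}{\sqrt2\,y}$,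 $p_3(y)=\frac{(2+y^2)^{3/2}}{2\sqrt2}$. The operator $\mathcal A_0$ on $C_0^\infty(0,\infty)$ is essentially self-adjoint in $L^2_\rho(0,\infty)$, so the extension is unique. *)

(* Defs.v *)
From HB Require Import structures.
From mathcomp Require Import all_boot all_order all_algebra.
From mathcomp Require Import all_classical all_reals all_analysis.
Set Implicit Arguments. Unset Strict Implicit. Unset Printing Implicit Defensive.
Import Order.TTheory GRing.Theory Num.Theory.
Import numFieldNormedType.Exports.
Local Open Scope classical_set_scope.
Local Open Scope ring_scope.

Section Defs.
Variable R : realType.

Fixpoint cheb_pair (n : nat) (x : R) : R * R :=
  match n with
  | 0%N => (1, x)
  | n'.+1 => let p := cheb_pair n' x in (p.2, 2 * x * p.2 - p.1)
  end.
Definition chebT (n : nat) (x : R) : R := (cheb_pair n x).1.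

Definition f0_coef : seq R :=
  [:: 268245%:R / 72878%:R; - (3174%:R / 105551%:R); 1897%:R / 97022%:R;
      14%:R / 72731%:R; 79%:R / 119383%:R; 4%:R / 66337%:R; 5%:R / 109368%:R;
      1 / 109045%:R; 1 / 204079%:R; 1 / 675805%:R; 1 / 1400761%:R;
      1 / 3586839%:R; 1 / 7289041%:R; 1 / 16940631%:R; 1 / 59286294%:R].

Definition f0_tilde (y : R) : R :=
  2 * atan (\sum_(n < 15) nth 0 f0_coef n * chebT (2 * n + 1) (y / Num.sqrt (2 + y ^+ 2))).

Definition p1 (y : R) : R := Num.sqrt (2 + y ^+ 2) / (Num.sqrt 2 * y).
Definition p3 (y : R) : R := (Num.sqrt (2 + y ^+ 2)) ^+ 3 / (2 * Num.sqrt 2).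

(* ||f|| = ||p1 f||_{L^oo(0,oo)} + ||p3 f'||_{L^oo(0,oo)} <= eps, for continuous f *)
Definition norm_le (f : R -> R) (eps : R) : Prop :=
  exists M1 M2 : R, M1 + M2 <= eps /\
    (forall y, 0 < y -> `|p1 y * f y| <= M1) /\
    (forall y, 0 < y -> `|p3 y * derive1 f y| <= M2).

Definition smooth_closed_halfline (f : R -> R) : Prop :=
  (forall (n : nat) (y : R), 0 < y -> derivable (iter n (@derive1 R R) f) y 1) /\
  (f x @[x --> 0^'+] --> f 0) /\
  (forall n : nat, exists l : R, (iter n (@derive1 R R) f) x @[x --> 0^'+] --> l).

Definition monotone_halfline (f : R -> R) : Prop :=
  (forall x y, 0 <= x -> x <= y -> f x <= f y) \/
  (forall x y, 0 <= x -> x <= y -> f y <= f x).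

Definition profile_ode (f : R -> R) : Prop :=
  forall y, 0 < y ->
    derive1 (derive1 f) y + (2 / y - y / 2) * derive1 f y - (1 / y ^+ 2) * sin (2 * f y) = 0.

Definition rho (y : R) : R := y ^+ 2 * expR (- (y ^+ 2 / 4)).

Definition halfline : set R := `]0, +oo[%classic.

Definition test_fun (phi : R -> R) : Prop :=
  (forall (n : nat) (y : R), 0 < y -> derivable (iter n (@derive1 R R) phi) y 1) /\
  exists a b : R, 0 < a /\ a <= b /\ (forall y, (y < a \/ b < y) -> phi y = 0).

Definition A0 (f0 : R -> R) (w : R -> R) : R -> R :=
  fun y => - (1 / rho y) * derive1 (fun z => rho z * derive1 w z) y
           + 2 * cos (2 * f0 y) / y ^+ 2 * w y.

Definition L2rho (u : R -> R) : Prop :=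
  measurable_fun halfline u /\
  (\int[@lebesgue_measure R]_(x in halfline) ((u x) ^+ 2 * rho x)%:E < +oo)%E.

Definition ip (u v : R -> R) : R :=
  fine (\int[@lebesgue_measure R]_(x in halfline) (u x * v x * rho x)%:E).

(* A (possibly multivalued a priori) operator on L^2_rho given by its graph *)

Definition adjoint_graph (T : (R -> R) -> (R -> R) -> Prop) (u v : R -> R) : Prop :=
  L2rho u /\ L2rho v /\ forall x y, T x y -> ip y u = ip x v.

Definition self_adjoint (T : (R -> R) -> (R -> R) -> Prop) : Prop :=
  (forall u v, T u v -> L2rho u /\ L2rho v) /\
  (forall u v, T u v <-> adjoint_graph T u v).

Definition extends_A0 (f0 : R -> R) (T : (R -> R) -> (R -> R) -> Prop) : Prop :=
  forall phi, test_fun phi -> T phi (A0 f0 phi).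

Definition is_eigenvalue (T : (R -> R) -> (R -> R) -> Prop) (lam : R) : Prop :=
  exists u, T u (fun y => lam * u y) /\ 0 < ip u u.

End Defs.

(* Main.v *)
(** Differentiating the profile equation along dilations shows that
    u(y) = y f0'(y) solves A u = - u; it is positive because f0 is monotone and
    not constant, and cutting it off puts it in the domain of the closure, so
    -1 is an eigenvalue.

    Conversely let A v = lam v with lam <= 0 and lam <> -1.  Testing against
    eta u, where (rho u^2 eta')' is an arbitrary bump of mean zero, and the
    du Bois-Reymond lemma show that v agrees almost everywhere with a classical
    solution V.  Since V is orthogonal to u > 0, it changes sign, and thus
    vanishes at some c > 0 lying strictly between two points where it does not.
    If h satisfies y^2 (g' + g^2 + (2/y - y/2) g) < 2 cos (2 f0) with g = h/y,
    then rho V (V' - g V) is nondecreasing.  Affine pieces h, found numerically,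
    cover (0, 51/100] starting from a limit-point argument at 0, and
    [51/100, oo) starting from a limit-point argument at infinity; depending on
    the position of c, one of the two families forces V = 0 on the whole of
    (0, c] or of [c, oo).  The potential is bounded through cos f0 and the first
    three Chebyshev terms of the approximate profile. *)

(* The domain of the extension is accessible only through the adjoint identity, so no boundary
   behaviour of v is known in advance. The tests eta u therefore have to carry it: eta is a constant
   near 0, in general not zero, and this is what removes the second integration constant of the weak
   equation. Such tests are not compactly supported, which is why truncations must be controlled in
   the graph norm, with bounds uniform in the cut-off parameter.

   In the comparison, g is the logarithmic derivative of a positive strict supersolution of A w = 0,
   and the argument is the domain monotonicity of Dirichlet problems: a zero c makes V a Dirichlet
   solution on both sides, and 51/100 is a point where both one-sided problems are still positive.
   The function 2 cos (2 f0) equals 2 at the origin and drops to -2 where f0 = pi/2, between 6/25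
   and 9/20; h has to fall steeply there, whence the pieces. Since 0 <= f0 <= pi, cos f0 is monotone
   in y, and one evaluation of the approximate profile at a rational point bounds the potential on a
   whole half-line. *)
Require Import Defs.
From HB Require Import structures.
From mathcomp Require Import all_boot all_order all_algebra.
From mathcomp Require Import all_classical all_reals all_analysis.
From mathcomp Require Import measurable_realfun ring lra.
Import Order.TTheory GRing.Theory Num.Theory.
Import numFieldNormedType.Exports.
Local Open Scope classical_set_scope.
Local Open Scope ring_scope.
Set Implicit Arguments.
Unset Strict Implicit.

(** * Derivatives and smoothness on the half-line *)

Section Calculus.
Variable R : realType.
Implicit Types (f g : R -> R) (x y : R).

Lemma isdD f g x a b : is_derive x 1 f a -> is_derive x 1 g b ->
  is_derive x 1 (fun y => f y + g y) (a + b).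
Proof. by move=> ? ?; exact: is_deriveD. Qed.

Lemma isdN f x a : is_derive x 1 f a -> is_derive x 1 (fun y => - f y) (- a).
Proof. by move=> ?; exact: is_deriveN. Qed.

Lemma isdB f g x a b : is_derive x 1 f a -> is_derive x 1 g b ->
  is_derive x 1 (fun y => f y - g y) (a - b).
Proof. by move=> ? ?; exact: is_deriveB. Qed.

Lemma isdM f g x a b : is_derive x 1 f a -> is_derive x 1 g b ->
  is_derive x 1 (fun y => f y * g y) (a * g x + f x * b).
Proof.
move=> fa gb; apply: (is_derive_eq (is_deriveM fa gb)).
by rewrite /GRing.scale /=; ring.
Qed.

Lemma isdV f x a : f x != 0 -> is_derive x 1 f a ->
  is_derive x 1 (fun y => (f y)^-1) (- a / f x ^+ 2).
Proof.
move=> f0 [df <-]; apply: DeriveDef; first exact: derivableV.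
by rewrite deriveV// /GRing.scale /= mulNr mulrC mulNr.
Qed.

Lemma isd_comp f g x a b : is_derive x 1 g b -> is_derive (g x) 1 f a ->
  is_derive x 1 (fun y => f (g y)) (a * b).
Proof.
move=> [dg gb] [df fa].
have df1 : differentiable f (g x) by apply/derivable1_diffP.
have dg1 : differentiable g x := (derivable1_diffP g x).1 dg.
apply: DeriveDef; first by apply/derivable1_diffP; exact: differentiable_comp.
have := derive1_comp dg df; rewrite !derive1E /comp => ->.
by rewrite fa gb.
Qed.

Lemma isd_cst c x : is_derive x 1 (fun=> c : R) 0.
Proof. exact: is_derive_cst. Qed.

Lemma isd_id x : is_derive x 1 (fun y : R => y) 1.
Proof. exact: is_derive_id. Qed.

Lemma isd_exp f x a : is_derive x 1 f a ->
  is_derive x 1 (fun y => expR (f y)) (expR (f x) * a).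
Proof. by move=> fa; apply: (@isd_comp expR f). Qed.

Lemma isdX f x a n : is_derive x 1 f a ->
  is_derive x 1 (fun y => f y ^+ n) (n%:R * f x ^+ n.-1 * a).
Proof.
move=> fa; apply: (@isd_comp (fun y => y ^+ n) f) => //.
apply: DeriveDef; first exact: exprn_derivable.
by rewrite exp_derive /GRing.scale /= mulr1 mulr_natl.
Qed.

Lemma isd_near f g x a : (\near x, f x = g x) -> is_derive x 1 f a -> is_derive x 1 g a.
Proof.
by move=> fg fa; exact: near_eq_is_derive fg fa.
Qed.

Lemma isd_pos f g x a : (forall y, 0 < y -> f y = g y) -> 0 < x ->
  is_derive x 1 f a -> is_derive x 1 g a.
Proof.
move=> fg x0; apply: isd_near.
by near=> y; apply: fg; near: y; exact: lt_nbhsr.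
Unshelve. all: by end_near.
Qed.

Lemma isd_cont f x a : is_derive x 1 f a -> {for x, continuous f}.
Proof.
move=> [df _]; apply: differentiable_continuous; exact/derivable1_diffP.
Qed.

Lemma isdE f x a : is_derive x 1 f a -> (derive1 f) x = a.
Proof. by rewrite derive1E => -[]. Qed.

Lemma isdP f x : derivable f x 1 -> is_derive x 1 f ((derive1 f) x).
Proof. by move=> df; rewrite derive1E; exact: derivableP. Qed.

(** Iterated derivatives do not distribute over products, so [smooth_pos] is awkward to propagate.
    [Ck] peels one derivative at a time, and closure under sums, products, inverses and the
    exponential goes by induction on the order; [smooth_posP] translates between the two. *)
Fixpoint Ck n f := if n is n'.+1 then
  (forall y, 0 < y -> derivable f y 1) /\ Ck n' (derive1 f) else True.

Definition smooth_pos f := forall (n : nat) y, 0 < y ->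
  derivable (iter n (@derive1 R R) f) y 1.

Lemma smooth_posS f : smooth_pos f <->
  (forall y, 0 < y -> derivable f y 1) /\ smooth_pos (derive1 f).
Proof.
split=> [sf|[df sf] [|n] y y0]; last 2 first.
- exact: df.
- by rewrite iterSr; exact: sf.
split=> [y y0|n y y0]; first exact: (sf 0%N).
by rewrite -iterSr; exact: sf.
Qed.

Lemma smooth_posP f : smooth_pos f <-> forall n, Ck n f.
Proof.
split=> [sf n|].
  elim: n f sf => [//|n IH] f /smooth_posS[df sf]; split=> //.
  exact: IH.
move=> cf n; elim: n f cf => [|n IH] f cf y y0.
  by have [df _] := cf 1%N; exact: df.
by rewrite iterSr; apply: IH => // k; have [_] := cf k.+1.
Qed.

Lemma derive1_pos_ext f g x : (forall y, 0 < y -> f y = g y) -> 0 < x ->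
  (derive1 f) x = (derive1 g) x.
Proof.
move=> fg x0; rewrite !derive1E; apply: near_eq_derive.
near=> y; apply: fg; near: y; exact: lt_nbhsr.
Unshelve. all: by end_near.
Qed.

Lemma Ck_ext n f g : (forall y, 0 < y -> f y = g y) -> Ck n f -> Ck n g.
Proof.
elim: n f g => [//|n IH] f g fg [df cf]; split.
  move=> y y0; have := isdP (df y y0) => /(isd_pos fg y0).
  by case.
by apply: IH cf => y y0; exact: derive1_pos_ext.
Qed.

Lemma CkS n f : Ck n.+1 f -> Ck n f.
Proof.
by elim: n f => [//|n IH] f [df cf]; split=> //; exact: IH.
Qed.

Lemma CkI n f g : (forall y, 0 < y -> is_derive y 1 f (g y)) -> Ck n g -> Ck n.+1 f.
Proof.
move=> fg cg; split=> [y y0|]; first by have [] := fg y y0.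
by apply: Ck_ext cg => y y0; rewrite (isdE (fg y y0)).
Qed.

Lemma Ck_isd n f y : Ck n.+1 f -> 0 < y -> is_derive y 1 f ((derive1 f) y).
Proof. by move=> [df _] y0; exact/isdP/df. Qed.

Lemma Ck_cst n c : Ck n (fun=> c).
Proof. by elim: n c => [//|n IH] c; exact: (CkI (fun y _ => isd_cst c y) (IH 0)). Qed.

Lemma Ck_id n : Ck n (fun y => y).
Proof. by case: n => [//|n]; exact: (CkI (fun y _ => isd_id y) (Ck_cst n 1)). Qed.

Lemma CkD n f g : Ck n f -> Ck n g -> Ck n (fun y => f y + g y).
Proof.
elim: n f g => [//|n IH] f g cf cg.
apply: (@CkI _ _ (fun y => (derive1 f) y + (derive1 g) y)) => [y y0|].
  exact: isdD (Ck_isd cf y0) (Ck_isd cg y0).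
by apply: IH; [case: cf|case: cg].
Qed.

Lemma CkM n f g : Ck n f -> Ck n g -> Ck n (fun y => f y * g y).
Proof.
elim: n f g => [//|n IH] f g cf cg.
have d y : 0 < y -> is_derive y 1 (fun y => f y * g y) ((derive1 f) y * g y + f y * (derive1 g) y).
  by move=> y0; exact: isdM (Ck_isd cf y0) (Ck_isd cg y0).
apply: (CkI d).
by apply: CkD; apply: IH; (try exact: CkS); [case: cf|case: cg].
Qed.

Lemma CkN n f : Ck n f -> Ck n (fun y => - f y).
Proof.
move=> cf; apply: (@Ck_ext _ (fun y => -1 * f y)) => [y _|]; first by rewrite mulN1r.
by apply: CkM => //; exact: Ck_cst.
Qed.

Lemma CkB n f g : Ck n f -> Ck n g -> Ck n (fun y => f y - g y).
Proof. by move=> cf cg; apply: CkD => //; exact: CkN. Qed.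

Lemma CkX n f k : Ck n f -> Ck n (fun y => f y ^+ k).
Proof.
move=> cf; elim: k => [|k IH]; first exact: Ck_cst.
by apply: (@Ck_ext _ (fun y => f y * f y ^+ k)) => [y _|]; [rewrite exprS|exact: CkM].
Qed.

Lemma CkV n f : (forall y, 0 < y -> f y != 0) -> Ck n f -> Ck n (fun y => (f y)^-1).
Proof.
move=> f0; elim: n => [//|n IH] cf.
have d y : 0 < y -> is_derive y 1 (fun y => (f y)^-1) (- (derive1 f) y * ((f y)^-1 * (f y)^-1)).
  by move=> y0; apply: (is_derive_eq (isdV (f0 y y0) (Ck_isd cf y0))); rewrite expr2 invfM.
apply: (CkI d).
apply: CkM; first by apply: CkN; case: cf.
by apply: CkM; apply: IH; exact: CkS.
Qed.

Lemma Ck_exp n f : Ck n f -> Ck n (fun y => expR (f y)).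
Proof.
elim: n => [//|n IH] cf.
apply: (@CkI _ _ (fun y => expR (f y) * (derive1 f) y)) => [y y0|].
  exact: isd_exp (Ck_isd cf y0).
by apply: CkM; [apply: IH; exact: CkS|case: cf].
Qed.

Lemma smooth_pos_isd f y : smooth_pos f -> 0 < y -> is_derive y 1 f ((derive1 f) y).
Proof. by move=> sf y0; apply/isdP/(sf 0%N). Qed.

Lemma smooth_pos_der f : smooth_pos f -> smooth_pos (derive1 f).
Proof. by move=> /smooth_posS[]. Qed.

Lemma smooth_posI f g : (forall y, 0 < y -> is_derive y 1 f (g y)) ->
  smooth_pos g -> smooth_pos f.
Proof.
move=> fg /smooth_posP sg; apply/smooth_posP => -[//|n].
exact: CkI fg (sg n).
Qed.

Lemma smooth_posM f g : smooth_pos f -> smooth_pos g -> smooth_pos (fun y => f y * g y).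
Proof. by move=> /smooth_posP sf /smooth_posP sg; apply/smooth_posP => n; exact: CkM. Qed.

Lemma smooth_posD f g : smooth_pos f -> smooth_pos g -> smooth_pos (fun y => f y + g y).
Proof. by move=> /smooth_posP sf /smooth_posP sg; apply/smooth_posP => n; exact: CkD. Qed.

Lemma smooth_posZ c f : smooth_pos f -> smooth_pos (fun y => c * f y).
Proof. by move=> /smooth_posP sf; apply/smooth_posP => n; apply: CkM => //; exact: Ck_cst. Qed.

Lemma smooth_posV f : (forall y, 0 < y -> f y != 0) ->
  smooth_pos f -> smooth_pos (fun y => (f y)^-1).
Proof. by move=> f0 /smooth_posP sf; apply/smooth_posP => n; exact: CkV. Qed.

Lemma smooth_pos_rho : smooth_pos (@rho R).
Proof.
apply/smooth_posP => n; apply: CkM; first exact/CkX/Ck_id.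
by apply/Ck_exp/CkN/CkM; [exact/CkX/Ck_id|exact: Ck_cst].
Qed.

End Calculus.

(** * Cut-off functions *)

Section Bump.
Variable R : realType.
Implicit Types (s x y N : R) (k n : nat).

Lemma isd0_sq (f : R -> R) C : f 0 = 0 -> (forall x, `|f x| <= C * x ^+ 2) ->
  is_derive (0 : R) 1 f 0.
Proof.
move=> f0 fC.
have C0 : 0 <= C.
  by have := fC 1; rewrite expr1n mulr1; apply: le_trans; exact: normr_ge0.
suff H : h^-1 *: ((f \o shift 0) (h *: 1) - f 0) @[h --> 0^'] --> (0 : R).
  by apply: DeriveDef; [apply/cvg_ex; exists 0|exact/cvg_lim].
apply/cvgr0Pnorm_le => /= e e0.
near=> h.
have h0 : h != 0 by near: h; exact: nbhs_dnbhs_neq.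
rewrite /shift /= addr0 f0 subr0 /GRing.scale /= mulr1 normrM normfV.
rewrite ler_pdivrMl ?normr_gt0//; apply: le_trans (fC h) _.
rewrite -real_normK ?num_real// expr2 mulrCA ler_wpM2l//.
have : `|h| <= e / (C + 1).
  near: h; apply: dnbhs0_le; apply: divr_gt0 => //; lra.
rewrite ler_pdivlMr; last lra.
by move=> H; apply: le_trans H; rewrite mulrC ler_wpM2l//; lra.
Unshelve. all: by end_near. Qed.

(** The flat functions s^(-k) exp(-1/s), extended by 0. The family is closed under differentiation
    and each member has an explicit bound, which gives smoothness and quantitative estimates
    together. *)
Definition psi k s : R := if 0 < s then s ^- k * expR (- s^-1) else 0.

Lemma psi_ge0 k s : 0 <= psi k s.
Proof.
rewrite /psi; case: ifP => // s0.
by rewrite mulr_ge0 ?expR_ge0// invr_ge0 exprn_ge0// ltW.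
Qed.

Lemma psi_nonpos k s : s <= 0 -> psi k s = 0.
Proof. by move=> s0; rewrite /psi ltNge s0. Qed.

Lemma psi_pos k s : 0 < s -> psi k s = s ^- k * expR (- s^-1).
Proof. by move=> s0; rewrite /psi s0. Qed.

Lemma psi_mul k s : s * psi k.+1 s = psi k s.
Proof.
have [s0|s0] := ltP 0 s; last by rewrite !psi_nonpos// mulr0.
by rewrite !psi_pos// exprS invfM mulrA mulrA mulfV ?mul1r// gt_eqF.
Qed.

(** With v = 1/s this is v^k <= k! exp v, one term of the exponential series. *)
Lemma psi_le k s : psi k s <= k`!%:R.
Proof.
have [s0|s0] := ltP 0 s; last by rewrite psi_nonpos.
rewrite psi_pos// expRN -exprVn ler_pdivrMr ?expR_gt0//.
have v0 : 0 <= s^-1 by rewrite invr_ge0 ltW.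
case: k => [|k].
  by rewrite expr0 fact0 mul1r -expR0 ler_expR.
have := expR_ge1Dxn k v0; rewrite -ler_pdivrMl ?ltr0n ?fact_gt0//.
by move=> H; apply: le_trans H; rewrite mulrC lerDr.
Qed.

Lemma psi_le_inv k s : 0 < s -> psi k s <= s ^- k.
Proof.
move=> s0; rewrite psi_pos// ler_piMr ?invr_ge0 ?exprn_ge0 ?ltW//.
by rewrite -expR0 ltr_expR oppr_lt0 invr_gt0.
Qed.

(** The delicate point is s = 0: there [psi k] equals s^2 [psi k.+2], and the second factor is
    bounded by (k+2)!, so the derivative is 0. *)
Lemma psi_isd k s : is_derive s 1 (psi k) (psi k.+2 s - k%:R * psi k.+1 s).
Proof.
have [s0|s0|<-] := ltgtP 0 s.
- apply: (@isd_pos _ (fun s => s ^- k * expR (- s^-1))) => // [y y0|].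
    by rewrite psi_pos.
  apply: is_derive_eq.
    apply: isdM; last first.
      apply: isd_exp; apply: isdN; apply: isdV (isd_id s); exact: lt0r_neq0.
    apply: isdV; first by rewrite expf_neq0 ?lt0r_neq0.
    exact: isdX (isd_id s).
  rewrite !psi_pos//; case: k => [|k] /=; first by rewrite !expr0; field; rewrite lt0r_neq0.
  rewrite !exprS; field.
  by rewrite expf_neq0 gt_eqF.
- rewrite !psi_nonpos ?ltW// mulr0 subr0.
  apply: isd_near (isd_cst 0 s).
  near=> y; rewrite psi_nonpos// ltW//; near: y; exact: lt_nbhsl.
- rewrite !psi_nonpos// mulr0 subr0.
  apply: (@isd0_sq _ (k.+2)`!%:R); first by rewrite psi_nonpos.
  move=> x; rewrite ger0_norm ?psi_ge0// -psi_mul -psi_mul mulrA -expr2 mulrC.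
  by rewrite ler_wpM2r ?sqr_ge0 ?psi_le.
Unshelve. all: by end_near. Qed.

Lemma psi_aff_isd k (a b : R) y :
  is_derive y 1 (fun y => psi k (a * y + b)) ((psi k.+2 (a * y + b) - k%:R * psi k.+1 (a * y +
    b)) * a).
Proof.
apply: (@isd_comp _ (psi k)); last exact: psi_isd.
apply: (is_derive_eq (isdD (isdM (isd_cst a y) (isd_id y)) (isd_cst b y))).
by rewrite mul0r add0r mulr1 addr0.
Qed.

Lemma Ck_psi n k (a b : R) : Ck n (fun y => psi k (a * y + b)).
Proof.
elim: n k => [//|n IH] k; apply: CkI.
  by move=> y _; exact: psi_aff_isd.
by apply: CkM; [apply: CkB => //; apply: CkM => //|]; exact: Ck_cst.
Qed.

(** A smooth cut-off vanishing outside (1/N, N). It has no plateau and merely tends to 1 pointwise,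
    which suffices for dominated convergence. [chi1] and [chi2] are its derivatives, written without
    explicit powers of N. *)
Definition chi N y : R := psi 0 (N * y - 1) * psi 0 (N - y).

Definition chi1 N y : R :=
  let s := N * y - 1 in let t := N - y in
  (psi 1 s + psi 2 s) / y * psi 0 t - psi 0 s * psi 2 t.

Definition chi2 N y : R :=
  let s := N * y - 1 in let t := N - y in
  (psi 2 s + 2 * psi 3 s + psi 4 s - 2 * (psi 1 s + 2 * psi 2 s + psi 3 s)) / y ^+ 2 * psi 0 t
  - 2 * ((psi 1 s + psi 2 s) / y * psi 2 t) + psi 0 s * (psi 4 t - 2 * psi 3 t).

Lemma psi_isdl k N y :
  is_derive y 1 (fun y => psi k (N * y - 1)) ((psi k.+2 (N * y - 1) - k%:R * psi k.+1 (N * y -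
    1)) * N).
Proof. exact: psi_aff_isd. Qed.

Lemma psi_isdr k N y :
  is_derive y 1 (fun y => psi k (N - y)) (- (psi k.+2 (N - y) - k%:R * psi k.+1 (N - y))).
Proof.
have := psi_aff_isd k (-1) N y.
rewrite (_ : (fun y => _) = (fun y => psi k (N - y))); last first.
  by apply/funext => z; rewrite mulN1r addrC.
by move=> H; apply: (is_derive_eq H); rewrite mulN1r [- y + N]addrC mulrN1.
Qed.

(** With s = N y - 1 one has N = (s + 1) / y, and s psi_{k+1}(s) = psi_k(s). Each factor N coming
    from the chain rule is thus traded for 1/y, and the bounds on [chi1] and [chi2] become uniform
    in N. *)
Lemma psi_scale1 k N y : 0 < y ->
  N * psi k.+1 (N * y - 1) = (psi k (N * y - 1) + psi k.+1 (N * y - 1)) / y.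
Proof.
move=> y0; rewrite -(psi_mul k (N * y - 1)); set p := psi _ _; field; exact: lt0r_neq0.
Qed.

Lemma chi_isd N y : 0 < y -> is_derive y 1 (chi N) (chi1 N y).
Proof.
move=> y0; apply: (is_derive_eq (isdM (psi_isdl 0 N y) (psi_isdr 0 N y))).
by rewrite /chi1 !mul0r !subr0 -psi_scale1//; ring.
Qed.

Lemma chi1_isd N y : 0 < y -> is_derive y 1 (chi1 N) (chi2 N y).
Proof.
move=> y0.
apply: (@isd_pos _ (fun y => N * psi 2 (N * y - 1) * psi 0 (N - y) - psi 0 (N * y - 1) * psi 2
  (N - y))) => //.
  by move=> z z0; rewrite /chi1 -psi_scale1.
apply: (is_derive_eq (isdB (isdM (isdM (isd_cst N y) (psi_isdl 2 N y)) (psi_isdr 0 N y))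
  (isdM (psi_isdl 0 N y) (psi_isdr 2 N y)))).
rewrite /chi2; set s := N * y - 1; set t := N - y.
rewrite -(psi_mul 1 s) -(psi_mul 2 s) -(psi_mul 3 s) !mul0r ?subr0 ?add0r.
by rewrite /s; field; exact: lt0r_neq0.
Qed.



Lemma chi_ge0 N y : 0 <= chi N y.
Proof. by rewrite mulr_ge0 ?psi_ge0. Qed.

Lemma chi_le1 N y : chi N y <= 1.
Proof. by rewrite -[leRHS]mulr1 ler_pM ?psi_ge0// (psi_le 0). Qed.

Lemma psi_bounds s : [/\ 0 <= psi 0 s <= 1, 0 <= psi 1 s <= 1, 0 <= psi 2 s <= 2,
  0 <= psi 3 s <= 6 & 0 <= psi 4 s <= 24].
Proof.
split; rewrite psi_ge0 /=; [exact: (psi_le 0)|exact: (psi_le 1)|exact: (psi_le 2)|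
  exact: (psi_le 3)|exact: (psi_le 4)].
Qed.

Lemma chi1_le N y : 0 < y -> `|chi1 N y| <= 3 * (y^-1 + 1).
Proof.
move=> y0; rewrite /chi1; set s := N * y - 1; set t := N - y.
have [/andP[a0 b0] /andP[a1 b1] /andP[a2 b2] _ _] := psi_bounds s.
have [/andP[c0 d0] _ /andP[c2 d2] _ _] := psi_bounds t.
have v0 : 0 < y^-1 by rewrite invr_gt0.
apply: le_trans (ler_normB _ _) _; rewrite !normrM.
rewrite (ger0_norm c0) (ger0_norm c2) (ger0_norm a0) (gtr0_norm v0) ger0_norm ?addr_ge0//.
have h1 : (psi 1 s + psi 2 s) * y^-1 * psi 0 t <= 3 * y^-1 * 1.
  apply: ler_pM => //; first by rewrite mulr_ge0 ?addr_ge0 ?(ltW v0).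
  by rewrite ler_wpM2r ?(ltW v0)//; lra.
have h2 : psi 0 s * psi 2 t <= 1 * 2 by rewrite ler_pM.
lra.
Qed.

Lemma chi2_le N y : 0 < y -> `|chi2 N y| <= 100 * (y^-1 ^+ 2 + 1).
Proof.
move=> y0; rewrite /chi2; set s := N * y - 1; set t := N - y.
have [/andP[a0 b0] /andP[a1 b1] /andP[a2 b2] /andP[a3 b3] /andP[a4 b4]] := psi_bounds s.
have [/andP[c0 d0] _ /andP[c2 d2] /andP[c3 d3] /andP[c4 d4]] := psi_bounds t.
have v0 : 0 < y^-1 by rewrite invr_gt0.
have w0 : 0 <= y^-1 ^+ 2 by rewrite sqr_ge0.
apply: le_trans (ler_normD _ _) _; apply: le_trans (lerD (ler_normB _ _) (lexx _)) _.
rewrite !normrM -exprVn (ger0_norm w0) (ger0_norm c0) (ger0_norm c2) (ger0_norm a0) (gtr0_norm v0).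
rewrite [`|2|]ger0_norm// [`|psi 1 s + psi 2 s|]ger0_norm ?addr_ge0//.
set A := `|_ - _|; set B := `|_ - _|.
have hA : A <= 60 by rewrite ler_norml; apply/andP; split; lra.
have hB : B <= 36 by rewrite ler_norml; apply/andP; split; lra.
have h1 : A * y^-1 ^+ 2 * psi 0 t <= 60 * y^-1 ^+ 2 * 1.
  by apply: ler_pM => //; [rewrite mulr_ge0 ?normr_ge0|rewrite ler_wpM2r].
have h2 : (psi 1 s + psi 2 s) * y^-1 * psi 2 t <= 3 * y^-1 * 2.
  apply: ler_pM => //; first by rewrite mulr_ge0 ?addr_ge0 ?(ltW v0).
  by rewrite ler_wpM2r ?(ltW v0)//; lra.
have h3 : psi 0 s * B <= 1 * 36 by rewrite ler_pM ?normr_ge0.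
have h4 : 2 * y^-1 <= y^-1 ^+ 2 + 1.
  have := sqr_ge0 (y^-1 - 1); rewrite sqrrB1; lra.
lra.
Qed.

Lemma Ck_chi n N : Ck n (chi N).
Proof.
apply: CkM; first exact: Ck_psi.
by apply: (@Ck_ext _ _ (fun y => psi 0 (-1 * y + N))) (Ck_psi _ _ _ _) => y _; rewrite mulN1r addrC.
Qed.

Lemma chi_support N y : 0 < N -> y < N^-1 \/ N < y -> chi N y = 0.
Proof.
move=> N0; rewrite /chi => -[yN|yN].
  rewrite psi_nonpos ?mul0r// subr_le0 mulrC -ler_pdivlMr// div1r; exact: ltW.
by rewrite [psi _ (N - y)]psi_nonpos ?mulr0// subr_le0 ltW.
Qed.

Lemma psi_cvg0 k (u : nat -> R) : u n @[n --> \oo] --> +oo ->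
  psi k.+1 (u n) @[n --> \oo] --> (0 : R).
Proof.
move=> uoo; have u0 : \forall n \near \oo, 0 < u n by exact: (cvgry_gt uoo 0).
apply: (@squeeze_cvgr _ _ _ _ (fun=> 0) (fun n => (u n)^-1)); last 2 first.
- exact: cvg_cst.
- exact: (gtr0_cvgV0 u0).2.
near=> n; rewrite psi_ge0 /=.
have u1 : 1 <= u n by near: n; exact: (cvgry_ge uoo 1).
have un0 : 0 < u n by rewrite (lt_le_trans ltr01).
apply: le_trans (psi_le_inv _ un0) _.
by rewrite lef_pV2 ?posrE ?exprn_gt0// exprS ler_peMr ?(ltW un0)// exprn_ege1.
Unshelve. all: by end_near. Qed.

Lemma psi_cvg1 (u : nat -> R) : u n @[n --> \oo] --> +oo ->
  psi 0 (u n) @[n --> \oo] --> (1 : R).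
Proof.
move=> uoo; have u0 : \forall n \near \oo, 0 < u n by exact: (cvgry_gt uoo 0).
apply: (@squeeze_cvgr _ _ _ _ (fun n => 1 - (u n)^-1) (fun=> 1)); last 2 first.
- rewrite -[X in _ --> X]subr0; apply: cvgB; first exact: cvg_cst.
  exact: (gtr0_cvgV0 u0).2.
- exact: cvg_cst.
near=> n; rewrite (psi_le 0) andbT.
have un0 : 0 < u n by near: n; exact: u0.
by rewrite psi_pos// expr0 invr1 mul1r expR_ge1Dx.
Unshelve. all: by end_near. Qed.

Lemma cutl_cvg y : 0 < y -> n.+1%:R * y - 1 @[n --> \oo] --> +oo.
Proof.
move=> y0; apply/cvgryPge => A.
near=> n; rewrite lerBrDr -ler_pdivrMr//.
have : (A + 1) / y <= n%:R by near: n; exact: nbhs_infty_ger.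
by move=> H; apply: le_trans H _; rewrite ler_nat.
Unshelve. all: by end_near. Qed.

Lemma cutr_cvg y : n.+1%:R - y @[n --> \oo] --> +oo.
Proof.
apply/cvgryPge => A.
near=> n; rewrite lerBrDr.
have : A + y <= n%:R by near: n; exact: nbhs_infty_ger.
by move=> H; apply: le_trans H _; rewrite ler_nat.
Unshelve. all: by end_near. Qed.

Lemma chi_cvg y : 0 < y -> chi n.+1%:R y @[n --> \oo] --> (1 : R).
Proof.
move=> y0; rewrite -[X in _ --> X]mulr1.
by apply: cvgM; apply: psi_cvg1; [exact: cutl_cvg|exact: cutr_cvg].
Qed.

Lemma chi1_cvg y : 0 < y -> chi1 n.+1%:R y @[n --> \oo] --> (0 : R).
Proof.
move=> y0; have cl := cutl_cvg y0; have cr := cutr_cvg y.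
rewrite /chi1 [X in _ --> X](_ : 0 = (0 + 0) / y * 1 - 1 * 0); last by ring.
by apply: cvgB; apply: cvgM; try (apply: cvgMl; apply: cvgD);
  try exact: psi_cvg0; exact: psi_cvg1.
Qed.

Lemma chi2_cvg y : 0 < y -> chi2 n.+1%:R y @[n --> \oo] --> (0 : R).
Proof.
move=> y0; have cl := cutl_cvg y0; have cr := cutr_cvg y.
rewrite /chi2 [X in _ --> X](_ : 0 = (0 + 2 * 0 + 0 - 2 * (0 + 2 * 0 + 0)) / y ^+ 2 * 1
  - 2 * ((0 + 0) / y * 0) + 1 * (0 - 2 * 0)); last by ring.
have p1 := psi_cvg0 0 cl; have p2 := psi_cvg0 1 cl; have p3 := psi_cvg0 2 cl.
have p4 := psi_cvg0 3 cl; have q2 := psi_cvg0 1 cr; have q3 := psi_cvg0 2 cr.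
have q4 := psi_cvg0 3 cr; have p0 := psi_cvg1 cl; have q0 := psi_cvg1 cr.
have c2 : (2 : R) @[n --> \oo] --> (2 : R) by exact: cvg_cst.
have cy k : (y ^- k : R) @[n --> \oo] --> (y ^- k : R) by exact: cvg_cst.
apply: cvgD; first apply: cvgB.
- apply: (cvgM (cvgM (cvgB (cvgD (cvgD p2 (cvgM c2 p3)) p4) (cvgM c2 (cvgD (cvgD p1 (cvgM c2 p2))
  p3))) (cy 2%N)) q0).
- exact: (cvgM c2 (cvgM (cvgM (cvgD p1 p2) (cy 1%N)) q2)).
- exact: (cvgM p0 (cvgB q4 (cvgM c2 q3))).
Qed.

End Bump.

(** * The weighted space and the graph closure *)

Section L2.
Variable R : realType.
Implicit Types (f g h u v w x F : R -> R) (y : R).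
Notation mu := (@lebesgue_measure R).
Notation D := (@halfline R).
Notation Dint f := (mu.-integrable D (fun y => (f y)%:E)).

Lemma measurable_D : measurable (D : set (measurableTypeR R)).
Proof. exact: measurable_itv. Qed.

Lemma D_pos y : D y <-> 0 < y.
Proof. by rewrite /halfline /= in_itv /= andbT. Qed.

Lemma smooth_pos_measurable w : smooth_pos w -> measurable_fun D w.
Proof.
move=> sw; apply: open_continuous_measurable_fun; first exact: interval_open.
move=> y; rewrite inE => /D_pos y0.
exact: isd_cont (smooth_pos_isd sw y0).
Qed.

Lemma rho_gt0 (y : R) : 0 < y -> 0 < rho y.
Proof. by move=> y0; rewrite mulr_gt0 ?expR_gt0 ?exprn_gt0. Qed.

Lemma rho_ge0 (y : R) : 0 <= rho y.
Proof. by rewrite mulr_ge0 ?expR_ge0 ?sqr_ge0. Qed.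

Lemma measurable_rho : measurable_fun D (@rho R).
Proof. exact: smooth_pos_measurable (@smooth_pos_rho R). Qed.

Lemma Dint_le f g : measurable_fun D f -> (forall y, 0 < y -> `|f y| <= g y) ->
  Dint g -> Dint f.
Proof.
move=> mf fg; apply: le_integrable; first exact: measurable_D.
  exact/measurable_EFinP.
move=> y /D_pos y0 /=; rewrite lee_fin; apply: le_trans (fg y y0) _.
exact: ler_norm.
Qed.

Lemma L2rhoP u : L2rho u <-> measurable_fun D u /\ Dint (fun y => u y ^+ 2 * rho y).
Proof.
have nn y : (0 <= (u y ^+ 2 * rho y)%:E)%E by rewrite lee_fin mulr_ge0 ?sqr_ge0 ?rho_ge0.
split=> -[mu_ H]; split=> //.
  apply/integrableP; split.
    apply/measurable_EFinP; apply: measurable_funM; last exact: measurable_rho.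
    exact: measurable_funX.
  by under eq_integral do rewrite gee0_abs//.
by move/integrableP : H => [_]; under eq_integral do rewrite gee0_abs//.
Qed.

Lemma L2_measurable u : L2rho u -> measurable_fun D u.
Proof. by case. Qed.

Lemma DintD f g : Dint f -> Dint g -> Dint (fun y => f y + g y).
Proof. by move=> If Ig; have := integrableD measurable_D If Ig; apply: eq_integrable;
  first exact: measurable_D. Qed.

Lemma DintB f g : Dint f -> Dint g -> Dint (fun y => f y - g y).
Proof. by move=> If Ig; have := integrableB measurable_D If Ig; apply: eq_integrable;
  first exact: measurable_D. Qed.

Lemma DintZ c f : Dint f -> Dint (fun y => c * f y).
Proof. by move=> If; have := integrableZl measurable_D c If; apply: eq_integrable;
  first exact: measurable_D. Qed.

Lemma Dint_measurable f : Dint f -> measurable_fun D f.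
Proof. by move=> /integrableP[/measurable_EFinP]. Qed.

Lemma Dint_ext f g : (forall y, 0 < y -> f y = g y) -> Dint f -> Dint g.
Proof.
move=> fg; apply: eq_integrable; first exact: measurable_D.
by move=> y; rewrite inE => /D_pos y0; rewrite fg.
Qed.

Lemma L2_prod u v : L2rho u -> L2rho v -> Dint (fun y => u y * v y * rho y).
Proof.
move=> /L2rhoP[mu_ Iu] /L2rhoP[mv Iv].
apply: (@Dint_le _ (fun y => u y ^+ 2 * rho y + v y ^+ 2 * rho y)).
- by apply: measurable_funM; [exact: measurable_funM|exact: measurable_rho].
- move=> y y0; rewrite normrM (ger0_norm (rho_ge0 y)) normrM -mulrDl ler_wpM2r ?rho_ge0//.
  rewrite -(real_normK (num_real (u y))) -(real_normK (num_real (v y))).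
  have := sqr_ge0 (`|u y| - `|v y|); rewrite sqrrB.
  have := mulr_ge0 (normr_ge0 (u y)) (normr_ge0 (v y)); lra.
- exact: DintD.
Qed.

Lemma L2_dom u F : measurable_fun D u -> (forall y, 0 < y -> `|u y| <= F y) ->
  L2rho F -> L2rho u.
Proof.
move=> mu_ uF /L2rhoP[mF IF]; apply/L2rhoP; split=> //; apply: Dint_le IF.
  by apply: measurable_funM; [exact: measurable_funX|exact: measurable_rho].
move=> y y0; rewrite normrM (ger0_norm (rho_ge0 y)) normrX ler_wpM2r ?rho_ge0//.
by rewrite lerXn2r ?nnegrE//; [exact: le_trans (uF y y0)|exact: uF].
Qed.

Lemma L2_scale c u : L2rho u -> L2rho (fun y => c * u y).
Proof.
move=> /L2rhoP[mu_ Iu]; apply/L2rhoP; split; first exact: measurable_funM.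
apply: Dint_ext (DintZ (c ^+ 2) Iu) => y y0; ring.
Qed.

Lemma Dint_exp : Dint (fun y => expR (- y)).
Proof.
have := @integrable_exponential_pdf R 1 ltr01.
move=> /(integrableS measurableT measurable_D (@subsetT _ _)).
apply: eq_integrable; first exact: measurable_D.
move=> y; rewrite inE => /D_pos y0 /=; congr EFin.
rewrite /exponential_pdf patchE ifT; first by rewrite mul1r mulN1r.
by rewrite inE /= in_itv /= andbT ltW.
Qed.

(** Majorant for [A0] of a truncation. Near 0 a function of size y multiplied by chi'', of size
    1/y^2, leaves 1/y, whose square the factor y^2 of [rho] makes integrable; at infinity the
    Gaussian absorbs any power. *)
Definition dom (y : R) : R := (1 + y ^+ 2) ^+ 2 / y.

Lemma measurable_dom : measurable_fun D dom.
Proof.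
apply: smooth_pos_measurable; apply: smooth_posM.
  apply/smooth_posP => n; apply/CkX/CkD; [exact: Ck_cst|exact/CkX/Ck_id].
by apply: smooth_posV => [y y0|]; [rewrite gt_eqF|apply/smooth_posP => n; exact: Ck_id].
Qed.

Lemma L2_domF : L2rho dom.
Proof.
apply/L2rhoP; split; first exact: measurable_dom.
apply: (Dint_le _ _ (DintZ (24 * 4096 * expR 3) Dint_exp)).
  by apply: measurable_funM; [apply: measurable_funX; exact: measurable_dom|exact: measurable_rho].
move=> y y0.
have -> : dom y ^+ 2 * rho y = (1 + y ^+ 2) ^+ 4 * expR (- (y ^+ 2 / 4)).
  by rewrite /dom /rho; field; rewrite gt_eqF.
rewrite ger0_norm; last by rewrite mulr_ge0 ?expR_ge0// exprn_ge0// addr_ge0// sqr_ge0.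
(* From t^4 / 4! <= exp t, the polynomial costs 24 * 8^4 exp t, about half of the Gaussian decay.
   The remaining exp(-y^2/8) is compared with exp(-y) by the square (y - 4)^2. *)
set t := (1 + y ^+ 2) / 8.
have t0 : 0 <= t by rewrite divr_ge0 ?addr_ge0// sqr_ge0.
have h : (1 + y ^+ 2) ^+ 4 <= 24 * 4096 * expR t.
  have := expR_ge1Dxn 3 t0.
  have -> : t ^+ 4 / 4`!%:R = (1 + y ^+ 2) ^+ 4 / (24 * 4096).
    by rewrite /t (_ : 4`! = 24)//; field.
  lra.
apply: le_trans (ler_wpM2r (expR_ge0 _) h) _.
rewrite -[leLHS]mulrA -[leRHS]mulrA; apply: ler_wpM2l; first by rewrite mulr_ge0 ?ler0n.
rewrite -!expRD ler_expR /t.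
have := sqr_ge0 (y - 4); lra.
Qed.

Lemma Dint_cvg (f : nat -> R -> R) (g h : R -> R) :
  (forall n, measurable_fun D (f n)) ->
  (forall n y, 0 < y -> `|f n y| <= h y) -> Dint h ->
  (forall y, 0 < y -> f n y @[n --> \oo] --> g y) ->
  Dint g /\ \int[mu]_(y in D) f n y @[n --> \oo] --> \int[mu]_(y in D) g y.
Proof.
move=> mf fh Ih fg.
have mg : measurable_fun D g.
  by apply: (measurable_fun_cvg mf) => y /D_pos; exact: fg.
have [] := @dominated_convergence _ _ _ mu D measurable_D (fun n y => (f n y)%:E)
   (fun y => (g y)%:E) (fun y => (h y)%:E).
- by move=> n; have /measurable_EFinP H := mf n; exact: H.
- by have /measurable_EFinP H := mg; exact: H.
- by apply: aeW => y /D_pos y0; apply: cvg_EFin; [exact: nearW|exact: fg].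
- exact: Ih.
- by apply: aeW => y n /D_pos y0; rewrite lee_fin fh.
move=> Ig _ H; split=> //.
have fin : (\int[mu]_(y in D) (g y)%:E)%E \is a fin_num.
  by have := integrable_fin_num measurable_D Ig.
apply: fine_cvg; rewrite fineK//.
Qed.

End L2.

(** * Functions of controlled growth belong to the graph of the extension *)

Section Closure.
Variable R : realType.
Variable f0 : R -> R.
Hypothesis sf0 : smooth_pos f0.
Implicit Types (f w x phi : R -> R) (y z : R).
Notation mu := (@lebesgue_measure R).
Notation D := (@halfline R).
Notation Dint f := (mu.-integrable D (fun y => (f y)%:E)).

Definition pot y : R := 2 * cos (2 * f0 y) / y ^+ 2.

Lemma rho_isd y : 0 < y -> is_derive y 1 (@rho R) ((2 / y - y / 2) * rho y).
Proof.
move=> y0.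
apply: (is_derive_eq (isdM (isdX 2 (isd_id y))
  (isd_exp (isdN (isdM (isdX 2 (isd_id y)) (isd_cst 4^-1 y)))))).
by rewrite /rho /=; field; rewrite gt_eqF.
Qed.

Lemma A0E phi phi1 (b : R) y : 0 < y -> (forall z, 0 < z -> is_derive z 1 phi (phi1 z)) ->
  is_derive y 1 phi1 b ->
  A0 f0 phi y = - (b + (2 / y - y / 2) * phi1 y) + pot y * phi y.
Proof.
move=> y0 dphi dphi1; rewrite /A0 /pot.
have H : is_derive y 1 (fun z => rho z * derive1 phi z) ((2 / y - y / 2) * rho y * phi1 y + rho y
  * b).
  apply: (@isd_pos _ (fun z => rho z * phi1 z)) => //.
    by move=> z z0; rewrite (isdE (dphi z z0)).
  exact: isdM (rho_isd y0) dphi1.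
rewrite (isdE H); have r0 : rho y != 0 by rewrite gt_eqF ?rho_gt0.
by field; rewrite r0 gt_eqF.
Qed.

Lemma A0E_smooth phi y : smooth_pos phi -> 0 < y ->
  A0 f0 phi y = - (derive1 (derive1 phi) y + (2 / y - y / 2) * derive1 phi y) + pot y * phi y.
Proof.
move=> sp y0.
have d1 z (z0 : 0 < z) := smooth_pos_isd sp z0.
by rewrite (A0E y0 d1 (smooth_pos_isd (smooth_pos_der sp) y0)).
Qed.

Lemma continuous_pot y : 0 < y -> {for y, continuous pot}.
Proof.
move=> y0; have yn : y ^+ 2 != 0 by rewrite expf_neq0 ?gt_eqF.
have d1 := isdM (isd_cst 2 y) (smooth_pos_isd sf0 y0).
have d2 := isd_comp d1 (is_derive_cos _).
have H := isdM (isdM (isd_cst 2 y) d2) (@isdV _ (fun y => y ^+ 2) y _ yn (isdX 2 (isd_id y))).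
exact: (isd_cont H).
Qed.

Lemma measurable_posC f : (forall y, 0 < y -> {for y, continuous f}) -> measurable_fun D f.
Proof.
move=> cf; apply: open_continuous_measurable_fun; first exact: interval_open.
by move=> y; rewrite inE => /D_pos y0; exact: cf.
Qed.

Lemma smooth_pos_drift : smooth_pos (fun y : R => 2 / y - y / 2).
Proof.
apply/smooth_posP => n; apply: CkB; apply: CkM; try exact: Ck_cst; try exact: Ck_id.
by apply: CkV => [y y0|]; [rewrite gt_eqF|exact: Ck_id].
Qed.

Lemma measurable_A0 phi : smooth_pos phi -> measurable_fun D (A0 f0 phi).
Proof.
move=> sp; have s1 := smooth_pos_der sp; have s2 := smooth_pos_der s1.
apply: (@eq_measurable_fun _ _ _ _ _ (fun y => - (derive1 (derive1 phi) y + (2 / y - y / 2) *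
  derive1 phi y) + pot y * phi y)).
  by move=> y; rewrite inE => /D_pos y0; rewrite A0E_smooth.
apply: measurable_posC => y y0.
apply: continuousD; last first.
  by apply: continuousM; [exact: continuous_pot|exact: isd_cont (smooth_pos_isd sp y0)].
apply: continuousN; apply: continuousD; first exact: isd_cont (smooth_pos_isd s2 y0).
apply: continuousM; last exact: isd_cont (smooth_pos_isd s1 y0).
exact: isd_cont (smooth_pos_isd smooth_pos_drift y0).
Qed.

Lemma smooth_pos_chi N w : smooth_pos w -> smooth_pos (fun y => chi N y * w y).
Proof. by move=> sw; apply: (smooth_posM _ sw); apply/smooth_posP => n; exact: Ck_chi. Qed.

Lemma test_fun_chi n w : smooth_pos w -> test_fun (fun y => chi n.+1%:R y * w y).
Proof.
move=> sw; split; first exact: smooth_pos_chi.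
exists n.+1%:R^-1, n.+1%:R; split; first by rewrite invr_gt0 ltr0n.
split.
  apply: (@le_trans _ _ 1); last by rewrite ler1n.
  by rewrite -[leRHS]invr1 lef_pV2 ?posrE ?ltr0n// ler1n.
by move=> y H; rewrite chi_support ?mul0r// ltr0n.
Qed.

Lemma A0_chi N w y : smooth_pos w -> 0 < y ->
  A0 f0 (fun y => chi N y * w y) y = chi N y * A0 f0 w y - 2 * (chi1 N y * derive1 w y)
    - (chi2 N y + (2 / y - y / 2) * chi1 N y) * w y.
Proof.
move=> sw y0; have s1 := smooth_pos_der sw.
have d1 z : 0 < z -> is_derive z 1 (fun y => chi N y * w y) (chi1 N z * w z + chi N z * derive1 w
  z).
  by move=> z0; exact: isdM (chi_isd N z0) (smooth_pos_isd sw z0).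
have d2 := isdD (isdM (chi1_isd N y0) (smooth_pos_isd sw y0)) (isdM (chi_isd N y0)
  (smooth_pos_isd s1 y0)).
by rewrite (A0E y0 d1 d2) A0E_smooth//; ring.
Qed.

(* Growth conditions under which the truncations [chi n * w] converge to [w] in
   the graph norm. *)
Definition tame (K : R) w := forall y, 0 < y -> [/\ `|w y| <= K * y,
  `|derive1 w y| <= K * (1 + y ^+ 2) & `|A0 f0 w y| <= K * dom y].

(** In the product rule chi' meets w', while chi'' and the drift times chi' meet w. The linear
    vanishing of w at 0 in [tame] lowers the 1/y^2 singularity of the latter terms to 1/y. The three
    contributions cost 1, 12 and 112 times K [dom y]. *)
Lemma A0_chi_le N w K y : smooth_pos w -> tame K w -> 0 < y ->
  `|A0 f0 (fun y => chi N y * w y) y| <= 200 * K * dom y.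
Proof.
move=> sw tw y0; rewrite A0_chi//; have [b0 b1 b2] := tw y y0.
have K0 : 0 <= K by rewrite -(pmulr_lge0 _ y0) (le_trans _ b0).
have v0 : 0 < y^-1 by rewrite invr_gt0.
set t := y ^+ 2; have t0 : 0 <= t by rewrite sqr_ge0.
have yt : y <= (1 + t) / 2 by have := sqr_ge0 (y - 1); rewrite sqrrB1 /t; lra.
have d0 : 0 <= dom y by rewrite mulr_ge0 ?sqr_ge0 ?ltW.
have vy : y^-1 * y = 1 by rewrite mulVf ?gt_eqF.
have A1 : `|chi N y * A0 f0 w y| <= K * dom y.
  rewrite normrM ger0_norm ?chi_ge0//; apply: le_trans b2.
  by rewrite ler_piMl// chi_le1.
have A2 : `|2 * (chi1 N y * derive1 w y)| <= 12 * (K * dom y).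
  rewrite normrM (_ : `|2| = 2 :> R) ?normr_nat// normrM.
  have := ler_pM (normr_ge0 _) (normr_ge0 _) (chi1_le N y0) b1.
  have -> : dom y = (1 + t) ^+ 2 * y^-1 by [].
  have : y^-1 + 1 <= 2 * (1 + t) * y^-1.
    have -> : y^-1 + 1 = (1 + y) * y^-1 by field; rewrite gt_eqF.
    by rewrite ler_wpM2r ?(ltW v0)//; lra.
  move=> H; have H2 : 3 * (y^-1 + 1) * (K * (1 + t)) <= 3 * (2 * (1 + t) * y^-1) * (K * (1 + t)).
    by rewrite ler_wpM2r ?mulr_ge0 ?addr_ge0// ler_wpM2l.
  move=> H3; have := le_trans H3 H2; rewrite (_ : 3 * (2 * (1 + t) * y^-1) * (K * (1 + t))
    = 6 * (K * ((1 + t) ^+ 2 * y^-1))); [lra|ring].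
have A3 : `|(chi2 N y + (2 / y - y / 2) * chi1 N y) * w y| <= 112 * (K * dom y).
  rewrite normrM.
  have c1 : `|chi2 N y| * y <= 100 * dom y.
    apply: (@le_trans _ _ (100 * (y^-1 ^+ 2 + 1) * y)).
      by rewrite ler_wpM2r ?chi2_le// ltW.
    rewrite -mulrA ler_wpM2l//.
    have -> : (y^-1 ^+ 2 + 1) * y = (1 + t) * y^-1 by rewrite /t; field; rewrite gt_eqF.
    rewrite /dom -/t ler_wpM2r ?(ltW v0)//; nra.
  have c2 : `|2 / y - y / 2| * `|chi1 N y| * y <= 12 * dom y.
    have e1 : `|2 / y - y / 2| <= (2 + t) * y^-1.
      have -> : 2 / y - y / 2 = (2 - t / 2) * y^-1 by rewrite /t; field; rewrite gt_eqF.
      rewrite normrM (gtr0_norm v0) ler_wpM2r ?(ltW v0)// ler_norml; apply/andP; split; lra.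
    have e2 : `|chi1 N y| * y <= 3 * (1 + y).
      apply: le_trans (ler_wpM2r (ltW y0) (chi1_le N y0)) _.
      have -> : 3 * (y^-1 + 1) * y = 3 * (1 + y) by field; rewrite gt_eqF.
      exact: lexx.
    rewrite -mulrA; apply: le_trans (ler_pM _ _ e1 e2) _ => //.
      by rewrite mulr_ge0// ltW.
    rewrite /dom mulrAC mulrA ler_wpM2r ?(ltW v0)//.
    have : (2 + t) * (3 * (1 + y)) <= (2 * (1 + t)) * (3 * (2 * (1 + t))).
      apply: ler_pM; lra.
    by rewrite -/t; lra.
  have c3 : (`|chi2 N y| + `|2 / y - y / 2| * `|chi1 N y|) * y <= 112 * dom y.
    by rewrite mulrDl; lra.
  have c4 : `|chi2 N y + (2 / y - y / 2) * chi1 N y| <= `|chi2 N y| + `|2 / y - y / 2| * `|chi1 N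
    y|.
    by apply: le_trans (ler_normD _ _) _; rewrite normrM.
  apply: le_trans (ler_pM _ _ c4 b0) _ => //.
  by rewrite mulrCA [X in _ <= X]mulrCA ler_wpM2l.
apply: le_trans (ler_normB _ _) _.
apply: le_trans (lerD (ler_normB _ _) (lexx _)) _.
have := mulr_ge0 K0 d0; rewrite -mulrA; lra.
Qed.

Lemma Dint_norm f : Dint f -> Dint (fun y => `|f y|).
Proof.
by move=> If; have := integrable_norm If; apply: eq_integrable; first exact: measurable_D.
Qed.

Lemma ip_cvg (a : nat -> R -> R) w (F z : R -> R) : (forall n, measurable_fun D (a n)) ->
  (forall n y, 0 < y -> `|a n y| <= F y) -> L2rho F ->
  (forall y, 0 < y -> a n y @[n --> \oo] --> w y) -> L2rho z ->
  ip (a n) z @[n --> \oo] --> ip w z.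
Proof.
move=> ma aF LF aw Lz.
have mz := L2_measurable Lz.
apply: (@Dint_cvg _ (fun n y => a n y * z y * rho y) (fun y => w y * z y * rho y) (fun y => `|F y
  * z y * rho y|) _ _ _ _).2.
- move=> n; apply: measurable_funM; last exact: measurable_rho.
  by apply: measurable_funM; [exact: ma|exact: mz].
- move=> n y y0; rewrite normrM [leRHS]normrM ler_wpM2r// !normrM ler_wpM2r//.
  by apply: le_trans (aF n y y0) _; exact: ler_norm.
- exact: Dint_norm (L2_prod LF Lz).
- move=> y y0; apply: cvgM (cvg_cst _); apply: cvgM (cvg_cst _); exact: aw.
Qed.

Lemma ipC (u v : R -> R) : ip u v = ip v u.
Proof. by rewrite /ip; congr fine; apply: eq_integral => y _; rewrite (mulrC (u y)). Qed.

(** A self-adjoint graph is its own adjoint, so membership of w amounts to an identity against every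
    pair (x, z) of the graph. The identity holds for the truncations of w, which are test functions,
    and dominated convergence carries it to w. *)
Lemma graph_closure T w K : self_adjoint T -> extends_A0 f0 T ->
  smooth_pos w -> tame K w -> T w (A0 f0 w).
Proof.
move=> [TL2 Tadj] Text sw tw; apply/Tadj.
have K0 : 0 <= K.
  have [b0 _ _] := tw 1 ltr01; rewrite mulr1 in b0; exact: le_trans b0.
have wK y : 0 < y -> `|w y| <= K * dom y.
  move=> y0; have [b0 _ _] := tw y y0; apply: le_trans b0 _; rewrite ler_wpM2l//.
  by rewrite ler_pdivlMr// -expr2; have := sqr_ge0 y; set t := y ^+ 2; nra.
have LF := L2_scale K (L2_domF R).
have Lw : L2rho w by exact: (L2_dom (smooth_pos_measurable sw) wK LF).
have LA : L2rho (A0 f0 w).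
  by apply: (L2_dom (measurable_A0 sw) _ LF) => y y0; have [] := tw y y0.
split=> //; split=> // x z Txz.
have [Lx Lz] := TL2 _ _ Txz.
have /Tadj[_ [_ H]] := Txz.
pose phi n := (fun y => chi n.+1%:R y * w y).
have sphi n : smooth_pos (phi n) by exact: smooth_pos_chi.
have Hn n : ip (A0 f0 (phi n)) x = ip (phi n) z by apply: H; apply: Text; exact: test_fun_chi.
have c1 : ip (phi n) z @[n --> \oo] --> ip w z.
  apply: (ip_cvg (fun n => smooth_pos_measurable (sphi n)) _ LF _ Lz) => [n y y0|y y0].
    rewrite normrM ger0_norm ?chi_ge0//; apply: le_trans (wK y y0).
    by rewrite ler_piMl ?chi_le1.
  by rewrite -[X in _ --> X]mul1r; apply: cvgM (cvg_cst _); exact: chi_cvg.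
have c2 : ip (A0 f0 (phi n)) x @[n --> \oo] --> ip (A0 f0 w) x.
  apply: (ip_cvg (fun n => measurable_A0 (sphi n)) _ (L2_scale (200 * K) (L2_domF R)) _ Lx) => [n
    y y0|y y0].
    exact: A0_chi_le.
  rewrite (_ : (fun n => _) = (fun n => chi n.+1%:R y * A0 f0 w y - 2 * (chi1 n.+1%:R y * derive1
    w y)
    - (chi2 n.+1%:R y + (2 / y - y / 2) * chi1 n.+1%:R y) * w y)); last first.
    by apply/funext => n; rewrite /phi A0_chi.
  rewrite -[X in _ --> X](_ : 1 * A0 f0 w y - 2 * (0 * derive1 w y) - (0 + (2 / y - y / 2) * 0) *
    w y = _); last by ring.
  have k1 := chi1_cvg y0; have k2 := chi2_cvg y0; have k0 := chi_cvg y0.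
  have kc (c : R) : c @[n --> \oo] --> c by exact: cvg_cst.
  exact: (cvgB (cvgB (cvgM k0 (kc _)) (cvgM (kc 2) (cvgM k1 (kc _)))) (cvgM (cvgD k2 (cvgM (kc _)
    k1)) (kc _))).
rewrite ipC (ipC x).
rewrite (_ : (fun n => _) = (fun n => ip (phi n) z)) in c2; last exact/funext.
exact: cvg_unique c1 c2.
Qed.

End Closure.

(** * Mean value inequalities and uniqueness by Gronwall's argument *)

Section MeanValue.
Variable R : realType.
Implicit Types (f g : R -> R) (a b x y z : R).

Lemma isd_within f (df : R -> R) a b : (forall z, a <= z <= b -> is_derive z 1 f (df z)) ->
  {within `[a, b], continuous f}.
Proof.
move=> fdf; apply: derivable_within_continuous => z; rewrite in_itv /= => zab.
by have [] := fdf z zab.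
Qed.

Lemma MVTc f df a b : a < b -> (forall z, a <= z <= b -> is_derive z 1 f (df z)) ->
  exists c, a < c < b /\ f b - f a = df c * (b - a).
Proof.
move=> ab fdf.
have [|c] := @MVT R f df a b ab _ (isd_within fdf).
  by move=> z; rewrite in_itv /= => /andP[/ltW az /ltW zb]; apply: fdf; rewrite az.
by rewrite in_itv /= => cab e; exists c.
Qed.

Lemma isd_nondecr f df a b : a <= b -> (forall z, a <= z <= b -> is_derive z 1 f (df z)) ->
  (forall z, a < z < b -> 0 <= df z) -> f a <= f b.
Proof.
rewrite le_eqVlt => /predU1P[->//|ab fdf df0].
have [c [cab e]] := MVTc ab fdf.
by rewrite -subr_ge0 e mulr_ge0 ?df0// subr_ge0 ltW.
Qed.

Lemma continuous_bounded f a b : a <= b -> (forall z, a <= z <= b -> {for z, continuous f}) ->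
  exists2 M, 0 <= M & forall z, a <= z <= b -> `|f z| <= M.
Proof.
move=> ab cf.
have cn : {within `[a, b], continuous (fun z => `|f z|)}.
  apply: continuous_in_subspaceT => z; rewrite inE /= in_itv /= => zab.
  by apply: (@continuous_comp _ _ _ f (fun t => `|t|)); [exact: cf|exact: norm_continuous].
have [c _ H] := EVT_max ab cn; exists `|f c| => // z zab.
Qed.

Lemma norm_sin_le x : `|sin x| <= `|x|.
Proof.
wlog x0 : x / 0 <= x.
  move=> H; have [/H//|/ltW x0] := leP 0 x.
  by have := H (- x); rewrite sinN !normrN; apply; rewrite oppr_ge0.
have [->|xn0] := eqVneq x 0; first by rewrite sin0.
have xp : 0 < x by rewrite lt0r xn0.
have [c [_]] := @MVTc sin cos 0 x xp (fun z _ => is_derive_sin z).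
rewrite sin0 !subr0 => ->; rewrite normrM ler_piMl//.
exact: cos_max.
Qed.

Lemma cos_lip x y : `|cos x - cos y| <= `|x - y|.
Proof.
wlog xy : x y / x < y.
  move=> H; have [/H//|/H h|->] := ltgtP x y; last by rewrite !subrr.
  by rewrite distrC [leRHS]distrC.
have [c [_]] := @MVTc cos (fun z => - sin z) x y xy (fun z _ => is_derive_cos z).
by rewrite distrC [leRHS]distrC => ->; rewrite normrM ler_piMl// normrN sin_max.
Qed.

Lemma nondecr_der_ge0 f a d : 0 < a -> (forall x y, 0 <= x -> x <= y -> f x <= f y) ->
  is_derive a 1 f d -> 0 <= d.
Proof.
move=> a0 fm [df <-]; apply: limr_ge => //.
near=> h.
have h0 : h != 0 by near: h; exact: nbhs_dnbhs_neq.
have ha : `|h| <= a by near: h; apply: dnbhs0_le.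
rewrite /shift /= /GRing.scale /= mulr1.
move: ha; rewrite ler_norml => /andP[ha _].
have [hp|hn] := leP 0 h.
  by rewrite mulr_ge0 ?invr_ge0// subr_ge0 fm ?(ltW a0)// lerDr.
rewrite -mulrNN mulr_ge0// ?oppr_ge0 ?invr_le0 ?(ltW hn)//.
by rewrite subr_le0 fm//; lra.
Unshelve. all: by end_near. Qed.

(** E exp(k z) is nondecreasing and E exp(-k z) nonincreasing, so a zero of E at c spreads to the
    left by the first and to the right by the second. *)
Lemma gronwall_zero (E E1 : R -> R) k a b c : a <= c <= b -> 0 <= k ->
  (forall z, a <= z <= b -> 0 <= E z) ->
  (forall z, a <= z <= b -> is_derive z 1 E (E1 z)) ->
  (forall z, a <= z <= b -> `|E1 z| <= k * E z) -> E c = 0 ->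
  forall z, a <= z <= b -> E z = 0.
Proof.
move=> /andP[ac cb] k0 E0 dE EE Ec z /andP[az zb].
have dexp (s t : R) : is_derive t 1 (fun t : R => expR (s * t)) (expR (s * t) * (0 * t + s * 1)).
  exact: isd_exp (isdM (isd_cst s t) (isd_id t)).
apply/eqP; rewrite eq_le E0 ?az ?zb// andbT.
have [zc|cz] := leP z c.
  have : E z * expR (k * z) <= E c * expR (k * c).
    apply: (@isd_nondecr (fun t => E t * expR (k * t)) _ z c zc).
      move=> t /andP[zt tc]; apply: isdM (dE t _) (dexp k t).
      by rewrite (le_trans az) ?(le_trans tc).
    move=> t /andP[/ltW zt /ltW tc] /=.
    have tab : a <= t <= b by rewrite (le_trans az) ?(le_trans tc).
    have -> : E1 t * expR (k * t) + E t * (expR (k * t) * (0 * t + k * 1))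
      = expR (k * t) * (E1 t + k * E t) by ring.
    by have := EE t tab; rewrite ler_norml => /andP[H _]; rewrite mulr_ge0 ?expR_ge0//; lra.
  by rewrite Ec mul0r pmulr_lle0// expR_gt0.
have : - E c * expR (- k * c) <= - E z * expR (- k * z).
  apply: (@isd_nondecr (fun t => - E t * expR (- k * t)) _ c z (ltW cz)).
    move=> t /andP[ct tz]; apply: isdM (isdN (dE t _)) (dexp (- k) t).
    by rewrite (le_trans ac) ?(le_trans tz).
  move=> t /andP[/ltW ct /ltW tz] /=.
  have tab : a <= t <= b by rewrite (le_trans ac) ?(le_trans tz).
  have -> : - E1 t * expR (- k * t) + - E t * (expR (- k * t) * (0 * t + - k * 1))
    = expR (- k * t) * (k * E t - E1 t) by ring.
  by have := EE t tab; rewrite ler_norml => /andP[_ H]; rewrite mulr_ge0 ?expR_ge0//; lra.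
by rewrite Ec oppr0 mul0r pmulr_lge0 ?expR_gt0// oppr_ge0.
Qed.

End MeanValue.

(** * The ground state *)

Section Profile.
Variable R : realType.
Variable f0 : R -> R.
Implicit Types (x y z : R).
Hypothesis hs : smooth_closed_halfline f0.
Hypothesis hm : forall x y, 0 <= x -> x <= y -> f0 x <= f0 y.
Hypothesis ode : profile_ode f0.
Hypothesis f00 : f0 0 = 0.
Hypothesis hL : exists L : R, f0 x @[x --> +oo] --> L.
Hypothesis hnz : exists2 y, 0 < y & f0 y != 0.

Notation f1 := (derive1 f0).
Let sn y : R := sin (2 * f0 y).
Let cs y : R := cos (2 * f0 y).

Lemma profile_smooth : smooth_pos f0.
Proof. by case: hs. Qed.

Lemma f0_isd y : 0 < y -> is_derive y 1 f0 (f1 y).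
Proof. exact: smooth_pos_isd profile_smooth. Qed.

Definition f2 y : R := (y / 2 - 2 / y) * f1 y + sn y / y ^+ 2.

Lemma f1_isd y : 0 < y -> is_derive y 1 f1 (f2 y).
Proof.
move=> y0; apply: (is_derive_eq (smooth_pos_isd (smooth_pos_der profile_smooth) y0)).
have := ode y0; rewrite /f2 /sn.
set a := derive1 f1 y; set b := f1 y; set s := sin _ => H.
have yn : y != 0 by rewrite gt_eqF.
rewrite -[LHS](subr0) -H; field.
exact: yn.
Qed.

Lemma f0_ge0 y : 0 <= y -> 0 <= f0 y.
Proof. by move=> y0; rewrite -f00; exact: hm. Qed.

Lemma f1_ge0 y : 0 < y -> 0 <= f1 y.
Proof. by move=> y0; exact: (nondecr_der_ge0 y0 hm (f0_isd y0)). Qed.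

Lemma f0_le_lim : exists2 L, 0 <= L & forall y, 0 <= y -> f0 y <= L.
Proof.
have [L HL] := hL.
have H y : 0 <= y -> f0 y <= L.
  move=> y0; rewrite -(cvg_lim _ HL)//; apply: limr_ge; first by apply/cvg_ex; exists L.
  near=> z; apply: hm => //; near: z; exact: nbhs_pinfty_ge.
by exists L => //; rewrite -f00; exact: H.
Unshelve. all: by end_near. Qed.

(** For y >= 3 the term (y/2 - 2/y) f0' of the equation is nonnegative, hence f0'' >= -1. A large
    slope at y would then persist over [y, y + 1] and make f0 rise by more than its limit allows. *)
Lemma f1_le_infty : exists2 M, 0 <= M & forall y, 3 <= y -> f1 y <= M.
Proof.
have [L L0 HL] := f0_le_lim; exists (L + 1); first by rewrite addr_ge0.
move=> y y3; have y0 : 0 < y by lra.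
have y1 : y < y + 1 by lra.
have [c [/andP[yc cy] ec]] := @MVTc R f0 f1 y (y + 1) y1 (fun z zy => f0_isd (lt_le_trans y0
  (proj1 (andP zy)))).
have [d [/andP[yd dc] ed]] := @MVTc R f1 f2 y c yc (fun z zy => f1_isd (lt_le_trans y0 (proj1
  (andP zy)))).
have d0 : 0 < d by lra.
have fc := HL (y + 1) ltac:(lra); have fy := f0_ge0 (ltW y0).
have f2d : -1 <= f2 d.
  rewrite /f2; apply: (@le_trans _ _ (sn d / d ^+ 2)); last first.
    rewrite lerDr mulr_ge0 ?f1_ge0// subr_ge0 ler_pdivrMr//.
    by nra.
  rewrite ler_pdivlMr ?exprn_gt0//; have := sin_geN1 (2 * f0 d); rewrite /sn.
  by set s := sin _; nra.
have : f1 y <= f1 c + 1 by nra.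
have : f1 c = f0 (y + 1) - f0 y by rewrite ec; ring.
lra.
Qed.

(** The limit of f0' at 0 from the right controls a neighbourhood of the origin, continuity the
    compact middle range, and the previous lemma the rest. *)
Lemma f1_bound : exists2 K, 0 < K & forall y, 0 < y -> f1 y <= K.
Proof.
have [M M0 HM] := f1_le_infty.
have [_ [_ /(_ 1%N)[l]]] := hs => /= Hl.
have Hl' : f1 x @[x --> (0 : R)^'+] --> l := Hl.
have : \forall x \near (0 : R)^'+, f1 x <= l + 1.
  have ll1 : l < l + 1 by rewrite ltrDl.
  exact: (cvgr_le _ Hl' _ ll1).
move=> [d /= d0 Hd].
have d2 : 0 < d / 2 by rewrite divr_gt0.
have [N N0 HN] : exists2 N, 0 <= N & forall z, Num.min (d / 2) 3 <= z <= 3 -> `|f1 z| <= N.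
  apply: continuous_bounded; first by rewrite ge_min lexx orbT.
  move=> z /andP[z1 _]; apply: isd_cont (f1_isd _).
  by apply: lt_le_trans z1; rewrite lt_min d2 ltr0n.
exists (M + N + `|l| + 1); first by have := normr_ge0 l; lra.
move=> y y0; have ll := ler_norm l; have l0 := normr_ge0 l.
have [y3|y3] := leP 3 y; first by have := HM y y3; lra.
have [yd|yd] := leP (d / 2) y.
  have := HN y; rewrite ge_min yd (ltW y3) /= => /(_ isT).
  by have := ler_norm (f1 y); lra.
have : f1 y <= l + 1.
  by apply: Hd => //=; rewrite /ball_ /= sub0r normrN gtr0_norm//; lra.
lra.
Qed.

Lemma f0_le_lin K : (forall y, 0 < y -> f1 y <= K) -> forall y, 0 < y -> f0 y <= K * y.
Proof.
move=> HK y y0.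
have [_ [c0 _]] := hs.
have cw : {within `[0, y], continuous f0}.
  apply/continuous_within_itvP => //; split.
  - move=> z; rewrite in_itv /= => /andP[z0 _]; exact: isd_cont (f0_isd z0).
  - exact: c0.
  - by apply: cvg_at_left_filter; exact: isd_cont (f0_isd y0).
have [z|c] := @MVT R f0 f1 0 y y0 _ cw.
  by rewrite in_itv /= => /andP[z0 _]; exact: f0_isd.
rewrite in_itv /= => /andP[c0' _]; rewrite f00 !subr0 => ->.
by rewrite ler_pM2r// HK.
Qed.

(* [uu] is the dilation generator applied to the profile; [uu1] and [uu2] are its
   derivatives with [f0''] eliminated through the equation. *)
Definition uu y : R := y * f1 y.
Definition uu1 y : R := (y ^+ 2 / 2 - 1) * f1 y + sn y / y.
Definition uu2 y : R := y * f1 y + (y ^+ 2 / 2 - 1) * f2 y + 2 * cs y * f1 y / y - sn y / y ^+ 2.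

Lemma uu_smooth : smooth_pos uu.
Proof.
apply: smooth_posM; first by apply/smooth_posP => n; exact: Ck_id.
exact: smooth_pos_der profile_smooth.
Qed.

Lemma uu_isd y : 0 < y -> is_derive y 1 uu (uu1 y).
Proof.
move=> y0; apply: (is_derive_eq (isdM (isd_id y) (f1_isd y0))).
by rewrite /uu1 /f2; field; rewrite gt_eqF.
Qed.

Lemma sn_isd y : 0 < y -> is_derive y 1 sn (cs y * (2 * f1 y)).
Proof.
move=> y0; apply: (is_derive_eq (isd_comp (isdM (isd_cst 2 y) (f0_isd y0)) (is_derive_sin _))).
by rewrite mul0r add0r.
Qed.

Lemma uu1_isd y : 0 < y -> is_derive y 1 uu1 (uu2 y).
Proof.
move=> y0; have yn : y != 0 by rewrite gt_eqF.
have d1 := isdB (isdM (isdX 2 (isd_id y)) (isd_cst (2^-1) y)) (isd_cst 1 y).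
apply: (is_derive_eq (isdD (isdM d1 (f1_isd y0)) (isdM (sn_isd y0) (@isdV _ (fun y => y) y _ yn
  (isd_id y))))).
by rewrite /uu2 /=; field.
Qed.

Lemma A0_uu y : 0 < y -> A0 f0 uu y = - uu y.
Proof.
move=> y0; rewrite (A0E f0 y0 uu_isd (uu1_isd y0)) /uu2 /uu1 /uu /f2 /pot -/(cs y).
by field; rewrite gt_eqF.
Qed.

Lemma uu1_bound K : 0 < K -> (forall y, 0 < y -> f1 y <= K) ->
  forall y, 0 < y -> `|uu1 y| <= 3 * K * (1 + y ^+ 2).
Proof.
move=> K0 HK y y0; rewrite /uu1.
have h1 : `|sn y / y| <= 2 * K.
  rewrite normrM normfV (gtr0_norm y0) ler_pdivrMr//.
  apply: le_trans (norm_sin_le _) _; rewrite normrM (ger0_norm (f0_ge0 (ltW y0))) ger0_norm//.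
  by have := f0_le_lin HK y0; lra.
have f1p := f1_ge0 y0; have f1K := HK y y0.
have h2 : `|(y ^+ 2 / 2 - 1) * f1 y| <= (y ^+ 2 / 2 + 1) * K.
  rewrite normrM (ger0_norm f1p); apply: ler_pM => //.
  by have := sqr_ge0 y; rewrite ler_norml => H; apply/andP; split; lra.
apply: le_trans (ler_normD _ _) _.
have := sqr_ge0 y; set t := y ^+ 2 in h2 *; nra.
Qed.

Lemma uu_tame : exists K, tame f0 K uu.
Proof.
have [K K0 HK] := f1_bound; exists (3 * K) => y y0.
have f1p := f1_ge0 y0; have f1K := HK y y0.
have hu : `|uu y| <= K * y.
  have uu0 : 0 <= uu y by rewrite mulr_ge0// ltW.
  by rewrite ger0_norm// /uu mulrC ler_wpM2r// ltW.
split.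
- by apply: le_trans hu _; rewrite -mulrA ler_peMl ?mulr_ge0 ?ltW//; lra.
- by rewrite (isdE (uu_isd y0)); exact: uu1_bound.
- rewrite A0_uu// normrN; apply: le_trans hu _.
  rewrite -mulrA [leRHS]mulrCA ler_pM2l//.
  by rewrite /dom mulrA ler_pdivlMr//; have := sqr_ge0 y; set t := y ^+ 2; rewrite -expr2 -/t; nra.
Qed.

(** At a zero the nonnegative function [uu] has a minimum, so its derivative vanishes there as well.
    Uniqueness for the linear second-order equation then gives [uu] = 0 everywhere, and f0 would be
    identically 0. *)
Lemma f1_gt0 y : 0 < y -> 0 < f1 y.
Proof.
move=> y0; rewrite lt_neqAle f1_ge0// andbT eq_sym; apply/eqP => f1y.
have uu0 z : 0 < z -> 0 <= uu z by move=> z0; rewrite mulr_ge0 ?f1_ge0 ?ltW.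
have uuy : uu y = 0 by rewrite /uu f1y mulr0.
have uu1y : uu1 y = 0.
  have H : is_derive y 1 uu 0.
    apply: (@derive1_at_min R uu (y / 2) (2 * y)); first lra.
    - move=> t; rewrite in_itv /= => /andP[t0 _].
      have tp : 0 < t by lra.
      by have [] := uu_isd tp.
    - by rewrite in_itv /=; apply/andP; split; lra.
    - by move=> t; rewrite in_itv /= uuy => /andP[t0 _]; apply: uu0; lra.
  by rewrite -(isdE (uu_isd y0)) (isdE H).
have key a b : 0 < a -> a <= y <= b -> forall z, a <= z <= b -> uu z = 0.
  move=> a0 ayb z zab.
  have ab : a <= b by have /andP[] := ayb; exact: le_trans.
  have pos t : a <= t <= b -> 0 < t by move=> /andP[h _]; exact: lt_le_trans h.
  have [M1 M10 HM1] : exists2 M, 0 <= M & forall z, a <= z <= b -> `|2 / z - z / 2| <= M.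
    apply: continuous_bounded => // t tab.
    exact: isd_cont (smooth_pos_isd (@smooth_pos_drift R) (pos t tab)).
  have [M2 M20 HM2] : exists2 M, 0 <= M & forall z, a <= z <= b -> `|pot f0 z| <= M.
    by apply: continuous_bounded => // t tab; apply: continuous_pot;
      [exact: profile_smooth|exact: pos].
  pose E (t : R) := uu t ^+ 2 + uu1 t ^+ 2.
  pose E1 (t : R) := 2 * uu t * uu1 t + 2 * uu1 t * uu2 t.
  have E0 : E z = 0.
    (* E' = 2 u u' + 2 (pot + 1) u u' - 2 (2/t - t/2) u'^2. The inequality 2 |u u'| <= E bounds the
       first two terms by (1 + M2 + 1) E, and the last one is at most 2 M1 E. *)
    apply: (@gronwall_zero R E E1 (2 + M2 + 2 * M1) a b y) => //.
    - lra.
    - by move=> t _; rewrite addr_ge0 ?sqr_ge0.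
    - move=> t tab; apply: (is_derive_eq (isdD (isdX 2 (uu_isd (pos t tab))) (isdX 2 (uu1_isd
      (pos t tab))))).
      by rewrite /E1 /=; ring.
    - move=> t tab; rewrite /E1 /E; have t0 := pos t tab.
      have e2 : uu2 t = (pot f0 t + 1) * uu t - (2 / t - t / 2) * uu1 t.
        have := A0_uu t0; rewrite (A0E f0 t0 uu_isd (uu1_isd t0)); lra.
      rewrite e2; have := HM1 t tab; have := HM2 t tab; rewrite !ler_norml.
      set p := pot f0 t; set q := 2 / t - t / 2; set A := uu t; set B := uu1 t.
      move=> /andP[p1 p2] /andP[q1 q2].
      have hB := sqr_ge0 B; have hA := sqr_ge0 A.
      have h1 := sqr_ge0 (A - B); have h2 := sqr_ge0 (A + B).
      apply/andP; split; nra.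
    - by rewrite /E uuy uu1y expr0n addr0.
  have := sqr_ge0 (uu z); have := sqr_ge0 (uu1 z).
  move=> h1 h2; apply/eqP; rewrite -sqrf_eq0 eq_le h2 andbT.
  by rewrite -E0 /E lerDl.
have f1z z : 0 < z -> f1 z <= 0.
  move=> z0; have := key (Num.min y z) (Num.max y z).
  rewrite lt_min y0 z0 ge_min lexx le_max lexx => /(_ isT isT z).
  rewrite ge_min le_max lexx !orbT => /(_ isT) /eqP.
  by rewrite mulf_eq0 gt_eqF//= => /eqP ->.
have [z z0] := hnz; apply/negP; rewrite negbK eq_le f0_ge0 ?(ltW z0)// andbT.
by have := f0_le_lin f1z z0; rewrite mul0r.
Qed.

Lemma uu_gt0 y : 0 < y -> 0 < uu y.
Proof. by move=> y0; rewrite mulr_gt0// f1_gt0. Qed.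

End Profile.

(** * Integrals on the half-line and the eigenvalue -1 *)

Section Eigen.
Variable R : realType.
Implicit Types (x y z a b : R) (f g G u v : R -> R).
Notation mu := (@lebesgue_measure R).
Notation D := (@halfline R).
Notation Dint f := (mu.-integrable D (fun y => (f y)%:E)).

Lemma isd_LR G g a b : a < b -> (forall z, a <= z <= b -> is_derive z 1 G (g z)) ->
  derivable_oo_LRcontinuous G a b.
Proof.
move=> ab dG.
have ca : {for a, continuous G} by apply: isd_cont (dG a _); rewrite lexx ltW.
have cb : {for b, continuous G} by apply: isd_cont (dG b _); rewrite lexx ltW.
split; [|exact: cvg_at_right_filter|exact: cvg_at_left_filter].
move=> z; rewrite in_itv /= => /andP[/ltW az /ltW zb].
by have [] := dG z; rewrite ?az.
Qed.

Lemma Rint_FTC G g a b : a < b -> (forall z, a <= z <= b -> is_derive z 1 G (g z)) ->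
  (forall z, a <= z <= b -> {for z, continuous g}) ->
  \int[mu]_(y in `[a, b]) g y = G b - G a.
Proof.
move=> ab dG cg; rewrite /Rintegral (@continuous_FTC2 R g G a b)//.
- by apply: continuous_in_subspaceT => z; rewrite inE /= in_itv /= => zab; exact: cg.
- exact: isd_LR dG.
- move=> z; rewrite in_itv /= => /andP[/ltW az /ltW zb].
  by apply: isdE (dG z _); rewrite az.
Qed.

Lemma itv_cont_integrable g a b : (forall z, a <= z <= b -> {for z, continuous g}) ->
  mu.-integrable `[a, b] (fun y => (g y)%:E).
Proof.
move=> cg; apply: continuous_compact_integrable; first exact: segment_compact.
by apply: continuous_in_subspaceT => z; rewrite inE /= in_itv /= => zab; exact: cg.
Qed.

Lemma subset_itv_D a b : 0 < a -> `[a, b] `<=` D.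
Proof.
move=> a0 y /=; rewrite in_itv /= => /andP[ay _]; apply/D_pos.
exact: lt_le_trans ay.
Qed.

(** A minorant with an explicit primitive bounds the whole integral from below. Letting b grow or a
    shrink in this estimate will contradict square integrability at infinity and at 0. *)
Lemma int_ge_primitive f G g a b : Dint f -> (forall y, 0 < y -> 0 <= f y) ->
  0 < a -> a < b -> (forall z, a <= z <= b -> is_derive z 1 G (g z)) ->
  (forall z, a <= z <= b -> {for z, continuous g}) ->
  (forall z, a <= z <= b -> g z <= f z) ->
  G b - G a <= \int[mu]_(y in D) f y.
Proof.
move=> If f0 a0 ab dG cg gf.
have sD := @subset_itv_D a b a0.
have mab : measurable (`[a, b]%classic : set (measurableTypeR R)) by exact: measurable_itv.
have Iab := integrableS (@measurable_D R) mab sD If.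
rewrite -(Rint_FTC ab dG cg).
apply: (@le_trans _ _ (\int[mu]_(y in `[a, b]) f y)).
  apply: le_Rintegral => //; first exact: itv_cont_integrable.
have Fab := integrable_fin_num mab Iab; have FD := integrable_fin_num (@measurable_D R) If.
rewrite /Rintegral -lee_fin !fineK//.
apply: ge0_subset_integral => //; first exact: measurable_D.
  exact: measurable_int If.
by move=> y /D_pos y0; rewrite lee_fin f0.
Qed.

Lemma int_gt0 f c : Dint f -> (forall y, 0 < y -> 0 <= f y) -> 0 < c -> 0 < f c ->
  {for c, continuous f} -> 0 < \int[mu]_(y in D) f y.
Proof.
move=> If f0 c0 fc cf.
have : \forall y \near c, f c / 2 <= f y.
  by apply: (cvgr_ge _ cf); lra.
move=> [d /= d0 Hd].
pose a := c; pose b := c + d / 2.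
have ab : a < b by rewrite /a /b; lra.
apply: (@lt_le_trans _ _ (f c / 2 * b - f c / 2 * a)).
  by rewrite -mulrBr mulr_gt0//; lra.
apply: (@int_ge_primitive f (fun y => f c / 2 * y) (fun=> f c / 2)) => //.
- move=> z _; apply: (is_derive_eq (isdM (isd_cst (f c / 2) z) (isd_id z))).
  by rewrite mul0r add0r mulr1.
- by move=> z _; exact: cst_continuous.
- move=> z /andP[z1 z2]; apply: Hd; rewrite /ball_ /= ler0_norm; rewrite /a /b in z1 z2; lra.
Qed.

Lemma L2_ext u v : (forall y, 0 < y -> u y = v y) -> L2rho u -> L2rho v.
Proof.
move=> uv /L2rhoP[mu_ Iu]; apply/L2rhoP; split.
  by apply: eq_measurable_fun mu_ => y; rewrite inE => /D_pos; exact: uv.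
by apply: Dint_ext Iu => y y0; rewrite uv.
Qed.

Lemma ip_ext u v w : (forall y, 0 < y -> u y = v y) -> ip u w = ip v w.
Proof.
move=> uv; rewrite /ip; congr fine; apply: eq_integral => y.
by rewrite inE => /D_pos y0; rewrite uv.
Qed.

(** Graph elements are functions on the whole line, whereas inner products see positive arguments;
    being its own adjoint, the graph cannot distinguish v from v'. *)
Lemma graph_ext T u v v' : self_adjoint T -> (forall y, 0 < y -> v y = v' y) ->
  T u v -> T u v'.
Proof.
move=> [_ Tadj] vv /Tadj[Lu [Lv H]]; apply/Tadj; split=> //; split; first exact: L2_ext Lv.
by move=> x y Txy; rewrite (H x y Txy) ipC (ip_ext _ vv) ipC.
Qed.

Variable f0 : R -> R.
Hypothesis hs : smooth_closed_halfline f0.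
Hypothesis hm : forall x y, 0 <= x -> x <= y -> f0 x <= f0 y.
Hypothesis ode : profile_ode f0.
Hypothesis f00 : f0 0 = 0.
Hypothesis hL : exists L : R, f0 x @[x --> +oo] --> L.
Hypothesis hnz : exists2 y, 0 < y & f0 y != 0.

Lemma uu_graph T : self_adjoint T -> extends_A0 f0 T -> T (uu f0) (fun y => -1 * uu f0 y).
Proof.
move=> sT eT; have [K tK] := uu_tame hs hm ode f00 hL.
apply: graph_ext sT _ (graph_closure (profile_smooth hs) sT eT (uu_smooth hs) tK).
by move=> y y0; rewrite A0_uu// mulN1r.
Qed.

Lemma eigen_m1 T : self_adjoint T -> extends_A0 f0 T -> is_eigenvalue T (-1).
Proof.
move=> sT eT; exists (uu f0); split; first exact: uu_graph.
have [TL2 _] := sT; have [Lu _] := TL2 _ _ (uu_graph sT eT).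
have u0 := uu_gt0 hs hm ode f00 hnz.
apply: (@int_gt0 _ 1 (L2_prod Lu Lu)) => //.
- by move=> y y0; rewrite mulr_ge0 ?rho_ge0// mulr_ge0// ltW// u0.
- by rewrite mulr_gt0 ?rho_gt0// mulr_gt0// u0.
- have cu := isd_cont (uu_isd hs ode (@ltr01 R)).
  by apply: continuousM; [exact: continuousM|exact: isd_cont (rho_isd (@ltr01 R))].
Qed.

End Eigen.

(** * Weak solutions are classical *)

Section Primitive.
Variable R : realType.
Implicit Types (x y z a b s : R) (f g k : R -> R).
Notation mu := (@lebesgue_measure R).
Notation D := (@halfline R).
Notation Dint f := (mu.-integrable D (fun y => (f y)%:E)).

Definition PR g y : R := \int[mu]_(t in `]0, y]) g t.

Lemma Dint_itv (i : interval R) g : [set` i] `<=` D -> Dint g ->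
  mu.-integrable [set` i] (fun y => (g y)%:E).
Proof.
move=> iD Ig.
have mi : measurable ([set` i] : set (measurableTypeR R)) by exact: measurable_itv.
exact: integrableS (@measurable_D R) mi iD Ig.
Qed.

Lemma sub_oc_D y : `]0, y] `<=` D.
Proof. by move=> z /=; rewrite in_itv /= => /andP[z0 _]; apply/D_pos. Qed.

Lemma PR_isd g y : Dint g -> 0 < y -> {for y, continuous g} -> is_derive y 1 (PR g) (g y).
Proof.
move=> Ig y0 cg.
have [] := @continuous_FTC1 R g (BRight 0) y (y + 1) _ (Dint_itv (@sub_oc_D _) Ig) _ cg.
- by rewrite ltrDl.
- exact: y0.
by move=> dP e; apply: (is_derive_eq (isdP dP)).
Qed.

Lemma PR_tail g y : Dint g -> 0 <= y ->
  \int[mu]_(t in D) g t - PR g y = \int[mu]_(t in `]y, +oo[) g t.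
Proof. by move=> Ig y0; rewrite /PR /halfline (@Rintegral_itvB _ g (BRight 0) +oo%O). Qed.

Lemma PR_sub g a y : Dint g -> 0 <= a -> a <= y ->
  PR g y - PR g a = \int[mu]_(t in `]a, y]) g t.
Proof.
move=> Ig a0 ay; rewrite /PR (@Rintegral_itvB _ g (BRight 0) (BRight y) a)//.
exact: Dint_itv (@sub_oc_D y) Ig.
Qed.

(** Meant for integrands built from an eigenfunction, which is a priori only measurable, so that
    differentiability of the primitive is not yet available. *)
Lemma PR_continuous g y : Dint g -> 0 < y -> {for y, continuous (PR g)}.
Proof.
move=> Ig y0; pose a := y / 2; pose b := 2 * y.
have a0 : 0 < a by rewrite divr_gt0.
have ab : a < b by rewrite /a /b; lra.
have Iab := Dint_itv (@subset_itv_D R a b a0) Ig.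
have := parameterized_integral_continuous (ltW ab) Iab.
move=> /(continuous_within_itvP _ ab)[H _ _].
have yab : y \in `]a, b[ by rewrite in_itv /= /a /b; apply/andP; split; lra.
have cy := H y yab.
have E : \forall z \near y, PR g a + \int[mu]_(t in `[a, z]) g t = PR g z.
  have : \forall z \near y, a < z by apply: lt_nbhsr; rewrite /a; lra.
  apply: filterS => z /ltW az.
  rewrite -(@Rintegral_itv_obnd_cbnd _ a (BRight z)).
    by rewrite -PR_sub// ?(ltW a0)// addrC subrK.
  apply: Dint_itv Ig => t /=; rewrite in_itv /= => /andP[t0 _]; apply/D_pos.
  exact: lt_trans t0.
have Ey := nbhs_singleton E.
rewrite /prop_for /continuous_at -Ey.
apply: cvg_trans; first exact: near_eq_cvg E.
by apply: cvgD; [exact: cvg_cst|exact: cy].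
Qed.

Lemma PR_eq0 g y : (forall z, 0 < z -> z <= y -> g z = 0) -> PR g y = 0.
Proof.
move=> g0; rewrite /PR; under eq_Rintegral => z.
  by rewrite inE /= in_itv /= => /andP[z0 zy]; rewrite g0//; over.
by rewrite Rintegral_cst//= ?mul0r.
Qed.

Lemma PR_full g b : Dint g -> 0 <= b -> (forall z, b < z -> g z = 0) ->
  PR g b = \int[mu]_(t in D) g t.
Proof.
move=> Ig b0 g0; apply/eqP; rewrite eq_sym -subr_eq0 PR_tail//.
have -> : \int[mu]_(t in `]b, +oo[) g t = \int[mu]_(t in `]b, +oo[) (0 : R).
  by apply: eq_Rintegral => z; rewrite inE /= in_itv /= andbT => /g0.
by rewrite Rintegral_cst//= ?mul0r.
Qed.

Lemma EFin_Rint (A : set (measurableTypeR R)) f : measurable A ->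
  mu.-integrable A (fun y => (f y)%:E) ->
  (\int[mu]_(y in A) (f y)%:E)%E = (\int[mu]_(y in A) f y)%:E.
Proof. by move=> mA If; rewrite /Rintegral fineK//; exact: (integrable_fin_num mA If). Qed.

Lemma Dint_restrict g : Dint g -> mu.-integrable setT (fun y => ((g \_ D) y)%:E).
Proof.
move=> Ig; have := (@integrable_restrict _ _ _ mu _ (@measurable_D R) _ (@measurableT _
  (measurableTypeR R)) (fun y => (g y)%:E)).1.
by rewrite setTI => /(_ Ig); rewrite restrict_EFin.
Qed.

Lemma restrict_D_pos g y : 0 < y -> (g \_ D) y = g y.
Proof. by move=> y0; rewrite patchE ifT// inE; apply/D_pos. Qed.

Lemma restrict_D_neg g y : y <= 0 -> (g \_ D) y = 0.
Proof. by move=> y0; rewrite patchE ifF//; apply/negbTE; rewrite notin_setE => /D_pos;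
  rewrite ltNge y0. Qed.

(** Integration by parts when neither factor need be continuous: both sides are the integral of g(x)
    k(s) over the triangle 0 < x < s. *)
Lemma Dfubini g k : Dint g -> Dint k ->
  \int[mu]_(x in D) (g x * (\int[mu]_(s in D) k s - PR k x)) = \int[mu]_(s in D) (k s * PR g s).
Proof.
move=> Ig Ik.
pose gt := g \_ D; pose kt := k \_ D.
have mD := @measurable_D R.
have Igt := Dint_restrict Ig; have Ikt := Dint_restrict Ik.
have mgt : measurable_fun setT gt by have /integrableP[/measurable_EFinP] := Igt.
have mkt : measurable_fun setT kt by have /integrableP[/measurable_EFinP] := Ikt.
pose G (p : measurableTypeR R * measurableTypeR R) : R := gt p.1 * kt p.2.
pose F (p : measurableTypeR R * measurableTypeR R) : R := if p.1 < p.2 then gt p.1 * kt p.2 else 0.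
have mG : measurable_fun setT G.
  apply: measurable_funM; first exact: measurableT_comp mgt measurable_fst.
  exact: measurableT_comp mkt measurable_snd.
have mF : measurable_fun setT F.
  apply: measurable_fun_ifT => //.
  by apply: measurable_fun_ltr; [exact: measurable_fst|exact: measurable_snd].
have IG : ((mu \x mu)%E).-integrable setT (fun p => (G p)%:E).
  apply/integrable12ltyP; first exact/measurable_EFinP.
  have K0 : (0 <= \int[mu]_s `|(kt s)%:E|)%E by exact: integral_ge0.
  have Koo : (\int[mu]_s `|(kt s)%:E| < +oo)%E by have /integrableP[] := Ikt.
  have goo : (\int[mu]_s `|(gt s)%:E| < +oo)%E by have /integrableP[] := Igt.
  have g0 : (0 <= \int[mu]_s `|(gt s)%:E|)%E by exact: integral_ge0.
  under eq_integral => x _.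
    under eq_integral => s _ do rewrite /G /= normrM EFinM.
    rewrite ge0_integralZl_EFin//; last by apply/measurable_EFinP; exact: measurableT_comp.
    over.
  rewrite /=.
  have -> : (\int[mu]_s `|kt s|%:E)%E = (fine (\int[mu]_s `|(kt s)%:E|))%:E.
    by rewrite fineK// ge0_fin_numE.
  rewrite ge0_integralZr//; last 2 first.
  - by apply/measurable_EFinP; exact: measurableT_comp.
  - by rewrite lee_fin fine_ge0.
  by apply: lte_mul_pinfty => //; rewrite ?ge0_fin_numE ?ltry.
have IF : ((mu \x mu)%E).-integrable setT (fun p => (F p)%:E).
  apply: le_integrable IG => //; first exact/measurable_EFinP.
  by move=> p _; rewrite /F /G lee_fin; case: ifP => // _; rewrite normr0.
have HF := Fubini IF.
pose h1 x : R := g x * (\int[mu]_(s in D) k s - PR k x).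
pose h2 s : R := k s * PR g s.
have L x : (\int[mu]_s (F (x, s))%:E)%E = ((h1 \_ D) x)%:E.
  have [x0|x0] := ltP 0 x; last first.
    rewrite (@restrict_D_neg h1 x x0) integral0_eq// => s _.
    by rewrite /F /= /gt (@restrict_D_neg g x x0) mul0r if_same.
  rewrite (@restrict_D_pos h1 x x0) /h1 (PR_tail Ik (ltW x0)).
  have sD : [set` `]x, +oo[] `<=` D.
    by move=> t /=; rewrite in_itv /= andbT => xt; apply/D_pos; exact: lt_trans xt.
  have It := Dint_itv sD Ik.
  have mi : measurable ([set` `]x, +oo[] : set (measurableTypeR R)) by exact: measurable_itv.
  rewrite EFinM -(EFin_Rint mi It) -(integralZl mi It).
  rewrite [RHS]integral_mkcond; apply: eq_integral => s _.
  rewrite patchE /F /= mem_setE in_itv /= andbT; case: ifP => // xs.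
  have s0 := lt_trans x0 xs.
  by rewrite /gt /kt (@restrict_D_pos g x x0) (@restrict_D_pos k s s0) EFinM.
have Rr s : (\int[mu]_x (F (x, s))%:E)%E = ((h2 \_ D) s)%:E.
  have [s0|s0] := ltP 0 s; last first.
    rewrite (@restrict_D_neg h2 s s0) integral0_eq// => x _.
    by rewrite /F /= /kt (@restrict_D_neg k s s0) mulr0 if_same.
  rewrite (@restrict_D_pos h2 s s0) /h2.
  have sD : [set` `]0, s[] `<=` D.
    by move=> t /=; rewrite in_itv /= => /andP[xt _]; apply/D_pos.
  have It := Dint_itv sD Ig.
  have mi : measurable ([set` `]0, s[] : set (measurableTypeR R)) by exact: measurable_itv.
  rewrite /PR -Rintegral_itv_bndo_bndc//.
  rewrite EFinM -(EFin_Rint mi It) -(integralZl mi It).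
  rewrite [RHS]integral_mkcond; apply: eq_integral => x _.
  rewrite patchE /F /= mem_setE in_itv /=.
  have [x0|x0] := ltP 0 x; last by rewrite /gt (@restrict_D_neg g x x0) mul0r if_same.
  case: ifP => //= xs.
  by rewrite /gt /kt (@restrict_D_pos g x x0) (@restrict_D_pos k s s0) EFinM muleC.
rewrite Rintegral_mkcond [RHS]Rintegral_mkcond /Rintegral; congr fine.
under eq_integral do rewrite -L.
by under [RHS]eq_integral do rewrite -Rr.
Qed.

End Primitive.

(** * The du Bois-Reymond lemma on the half-line *)

Section DuBoisReymond.
Variable R : realType.
Implicit Types (x y z a b s t c : R) (f g k : R -> R).
Notation mu := (@lebesgue_measure R).
Notation D := (@halfline R).
Notation Dint f := (mu.-integrable D (fun y => (f y)%:E)).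

(** Smooth approximation of the indicator of (a, b) as N grows, with values in [0, 1]. *)
Definition plateau (N : R) a b y : R := psi 0 (N * (y - a)) * psi 0 (N * (b - y)).

Lemma plateau_smooth N a b : smooth_pos (plateau N a b).
Proof.
apply/smooth_posP => n; apply: CkM.
  by apply: (@Ck_ext _ _ (fun y => psi 0 (N * y + - (N * a)))) (Ck_psi _ _ _ _) => y _;
    rewrite mulrBr.
apply: (@Ck_ext _ _ (fun y => psi 0 (- N * y + N * b))) (Ck_psi _ _ _ _) => y _.
by rewrite mulrBr addrC mulNr.
Qed.

Lemma plateau_ge0 N a b y : 0 <= plateau N a b y.
Proof. by rewrite mulr_ge0 ?psi_ge0. Qed.

Lemma plateau_le1 N a b y : plateau N a b y <= 1.
Proof. by rewrite -[leRHS]mulr1 ler_pM ?psi_ge0// (psi_le 0). Qed.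

Lemma plateau_out N a b y : 0 <= N -> y <= a \/ b <= y -> plateau N a b y = 0.
Proof.
move=> N0; rewrite /plateau => -[ya|yb].
  by rewrite psi_nonpos ?mul0r// mulr_ge0_le0// subr_le0.
by rewrite [psi _ (N * (b - y))]psi_nonpos ?mulr0// mulr_ge0_le0// subr_le0.
Qed.

Lemma scale_cvg (d : R) : 0 < d -> n.+1%:R * d @[n --> \oo] --> +oo.
Proof.
move=> d0; apply/cvgryPge => A.
near=> n; rewrite -ler_pdivrMr//.
have : A / d <= n%:R by near: n; exact: nbhs_infty_ger.
by move=> H; apply: le_trans H _; rewrite ler_nat.
Unshelve. all: by end_near. Qed.

Lemma plateau_cvg a b y : plateau n.+1%:R a b y @[n --> \oo] --> ((a < y < b)%R%:R : R).
Proof.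
case: (boolP (a < y < b)) => [/andP[ay yb]|H].
  rewrite -[X in _ --> X]mulr1.
  by apply: cvgM; apply: psi_cvg1; apply: scale_cvg; rewrite subr_gt0.
rewrite (_ : (fun n => _) = (fun=> 0)); first exact: cvg_cst.
apply/funext => n; apply: plateau_out; first exact: ler0n.
by move: H; rewrite negb_and -!leNgt => /orP[]; [left|right].
Qed.

Lemma Dint_compact k a b M : measurable_fun D k -> (forall y, 0 < y -> `|k y| <= M) ->
  (forall y, y < a \/ b < y -> k y = 0) -> Dint k.
Proof.
move=> mk kM k0; apply: (Dint_le mk _ (DintZ (M * expR b) (Dint_exp R))) => y y0.
have M0 : 0 <= M by apply: le_trans (kM y y0).
have [yb|yb] := leP y b; last by rewrite k0 ?normr0 ?mulr_ge0 ?expR_ge0//; right.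
rewrite -mulrA -expRD; apply: le_trans (kM y y0) _.
rewrite ler_peMr// -expR0 ler_expR subr_ge0//.
Qed.

Variable F : R -> R.
Hypothesis IF : forall a b, 0 < a -> a < b -> mu.-integrable `[a, b] (fun y => (F y)%:E).
Hypothesis weak : forall k a b, 0 < a -> a < b -> smooth_pos k ->
  (forall y, y <= a \/ b <= y -> k y = 0) -> \int[mu]_(y in D) k y = 0 ->
  \int[mu]_(y in D) (k y * F y) = 0.

(** F is integrable only on compact intervals away from 0. Replacing it by its restriction to [a, b]
    changes nothing in products with a k supported there, and gives an integrable majorant. *)
Lemma Dint_cut c a b : 0 < a -> a < b -> Dint ((fun y => F y - c) \_ `[a, b]).
Proof.
move=> a0 ab.
have mab : measurable (`[a, b]%classic : set (measurableTypeR R)) by exact: measurable_itv.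
have IFc : mu.-integrable `[a, b] (fun y => (F y - c)%:E).
  have Ic : mu.-integrable `[a, b] (fun y => (c)%:E).
    by apply: itv_cont_integrable => z _; exact: cst_continuous.
  by have := integrableB mab (IF a0 ab) Ic; apply: eq_integrable.
have := (@integrable_restrict _ _ _ mu _ mab _ (@measurable_D R) (fun y => (F y - c)%:E)).1.
rewrite setIidr; last exact: subset_itv_D.
by move=> /(_ IFc); rewrite restrict_EFin.
Qed.

Lemma cutE c a b k y : (forall y, y <= a \/ b <= y -> k y = 0) ->
  k y * (F y - c) = k y * ((fun y => F y - c) \_ `[a, b]) y.
Proof.
move=> k0; rewrite patchE; case: ifPn => //.
rewrite notin_setE /= in_itv /= => /negP; rewrite negb_and -!ltNge => /orP[] /ltW H.
  by rewrite k0 ?mul0r//; left.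
by rewrite k0 ?mul0r//; right.
Qed.

Lemma Dint_test c a b k M : 0 < a -> a < b -> measurable_fun D k -> (forall y, 0 < y ->
  `|k y| <= M) ->
  (forall y, y <= a \/ b <= y -> k y = 0) -> Dint (fun y => k y * (F y - c)).
Proof.
move=> a0 ab mk kM k0.
have Ic := Dint_cut c a0 ab.
apply: (@Dint_ext _ (fun y => k y * ((fun y => F y - c) \_ `[a, b]) y)).
  by move=> y _; rewrite -cutE.
apply: (Dint_le _ _ (DintZ M (Dint_norm Ic))).
  by apply: measurable_funM => //; exact: Dint_measurable Ic.
by move=> y y0; rewrite normrM ler_wpM2r// kM.
Qed.

(** The constant c is the mean of F weighted by one fixed bump. Subtracting a multiple of that bump
    from any plateau yields a test function of mean zero, to which the hypothesis applies. *)
Lemma weak_mean : exists c, forall a b n, 0 < a -> a < b ->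
  \int[mu]_(y in D) (plateau n.+1%:R a b y * (F y - c)) = 0.
Proof.
pose kap := plateau 1 1 2.
have mpl N a b : measurable_fun D (plateau N a b) by apply: smooth_pos_measurable;
  exact: plateau_smooth.
have bpl N a b y : 0 < y -> `|plateau N a b y| <= 1.
  by move=> _; rewrite ger0_norm ?plateau_ge0 ?plateau_le1.
have Ipl N a b : 0 <= N -> Dint (plateau N a b).
  move=> N0; apply: (@Dint_compact _ a b _ (mpl N a b) (bpl N a b)) => y H;
    apply: plateau_out => //.
  by case: H => [/ltW h|/ltW h]; [left|right].
have Ik : Dint kap by exact: Ipl.
have I0 : 0 < \int[mu]_(y in D) kap y.
  have h32 : 0 < 3 / 2 :> R by lra.
  apply: (@int_gt0 _ _ (3 / 2) Ik _ h32).
  - by move=> y _; exact: plateau_ge0.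
  - have p0 (s : R) : 0 < s -> 0 < psi 0 s by move=> s0;
    rewrite psi_pos// expr0 invr1 mul1r expR_gt0.
    by rewrite /kap /plateau; apply: mulr_gt0; apply: p0; lra.
  - exact: (isd_cont (smooth_pos_isd (@plateau_smooth 1 1 2) h32)).
have IkF N a b : 0 <= N -> 0 < a -> a < b -> Dint (fun y => plateau N a b y * F y).
  move=> N0 a0 ab; have := Dint_test 0 a0 ab (mpl N a b) (bpl N a b) (fun y => @plateau_out N a b
    y N0).
  by apply: Dint_ext => y _; rewrite subr0.
exists ((\int[mu]_(y in D) (kap y * F y)) / \int[mu]_(y in D) kap y) => a b n a0 ab.
set c := _ / _; set k := plateau _ a b.
have Ikk : Dint k by exact: Ipl.
have IkkF : Dint (fun y => k y * F y) by exact: IkF.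
have IkapF : Dint (fun y => kap y * F y) by apply: IkF => //; lra.
have mD := @measurable_D R.
pose t := (\int[mu]_(y in D) k y) / \int[mu]_(y in D) kap y.
pose h y := k y - t * kap y.
have e1 : \int[mu]_(y in D) h y = 0.
  rewrite /h RintegralB//; last exact: DintZ.
  by rewrite RintegralZl// /t divfK ?subrr// gt_eqF.
have e2 : \int[mu]_(y in D) (h y * F y) = 0.
  (* An interval containing the supports of both the plateau and the reference bump on [1, 2]. *)
  pose a' := Num.min a 1; pose b' := Num.max b 2.
  have a'0 : 0 < a' by rewrite lt_min a0 ltr01.
  have ab' : a' < b' by rewrite lt_max (@le_lt_trans _ _ a)// ge_min lexx.
  apply: (weak a'0 ab') e1.
    apply: smooth_posD; first exact: plateau_smooth.
    apply: (@smooth_posI _ _ (fun y => - t * derive1 kap y)).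
      move=> y y0; apply: (is_derive_eq (isdN (isdM (isd_cst t y) (smooth_pos_isd
        (@plateau_smooth _ _ _) y0)))).
      by rewrite mul0r add0r mulNr.
    by apply: smooth_posZ; apply: smooth_pos_der; exact: plateau_smooth.
  move=> y; rewrite /a' /b' le_min ge_max => H.
  rewrite /h /k /kap !plateau_out ?mulr0 ?subr0//; case: H => /andP[? ?]; by [left|right].
have e3 : \int[mu]_(y in D) (h y * F y) = \int[mu]_(y in D) (k y * F y) - t * \int[mu]_(y in D)
  (kap y * F y).
  rewrite -RintegralZl// -RintegralB//; last exact: DintZ.
  by apply: eq_Rintegral => y _; rewrite /h mulrBl mulrA.
have e4 : \int[mu]_(y in D) (k y * (F y - c)) = \int[mu]_(y in D) (k y * F y) - c * \int[mu]_(y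
  in D) k y.
  rewrite -RintegralZl// -RintegralB//; last exact: DintZ.
  by apply: eq_Rintegral => y _; rewrite mulrBr (mulrC c).
have comm (A I K : R) : A / I * K = K / I * A by ring.
by rewrite e4 -[RHS]e2 e3; congr (_ - _); rewrite /c /t comm.
Qed.

Lemma weak_itv : exists c, forall a b, 0 < a -> a < b -> \int[mu]_(y in `]a, b[) (F y - c) = 0.
Proof.
have [c Hc] := weak_mean; exists c => a b a0 ab.
have Ic := Dint_cut c a0 ab.
have mpl n : measurable_fun D (plateau n.+1%:R a b) by apply: smooth_pos_measurable;
  exact: plateau_smooth.
have pl0 n y : y <= a \/ b <= y -> plateau n.+1%:R a b y = 0 by apply: plateau_out.
have [] := @Dint_cvg R (fun n y => plateau n.+1%:R a b y * (F y - c))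
  (fun y => (a < y < b)%R%:R * (F y - c)) (fun y => `|((fun y => F y - c) \_ `[a,
    b]) y|) _ _ (Dint_norm Ic) _.
- move=> n; apply: Dint_measurable (@Dint_test c a b _ 1 a0 ab (mpl n) _ (pl0 n)).
  by move=> y _; rewrite ger0_norm ?plateau_ge0 ?plateau_le1.
- move=> n y y0; rewrite (cutE c y (pl0 n)) normrM ler_piMl// ger0_norm ?plateau_ge0 ?plateau_le1//.
- by move=> y y0; apply: cvgM (cvg_cst _); exact: plateau_cvg.
have E : (fun n => \int[mu]_(y in D) (plateau n.+1%:R a b y * (F y - c))) = (fun=> 0).
  by apply/funext => n; rewrite Hc.
rewrite E => _ /(cvg_unique _ (cvg_cst (0 : R))) => -> //.
rewrite Rintegral_mkcond [RHS]Rintegral_mkcond; apply: eq_Rintegral => y _.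
rewrite !patchE mem_setE in_itv /=; case: (boolP (a < y < b)) => [yab|_].
  rewrite ifT ?mul1r// inE; apply/D_pos; have /andP[ay _] := yab; exact: lt_trans ay.
by rewrite mul0r if_same.
Qed.

(** F - c integrates to 0 over every compact subinterval, so its primitive is locally constant, and
    Lebesgue's differentiation theorem identifies F - c with the derivative of that primitive almost
    everywhere. *)
Lemma weak_ae : exists c, {ae mu, forall y, D y -> F y = c}.
Proof.
have [c Hc] := weak_itv; exists c.
have mD := @measurable_D R.
(* The shift by 2 keeps 1/(n+2) < 1 < n+2 already at n = 0; these countably many intervals exhaust
   the half-line. *)
have H n : {ae mu, forall y, n.+2%:R^-1 < y < n.+2%:R -> F y = c}.
  pose a : R := n.+2%:R^-1; pose b : R := n.+2%:R.
  have a0 : 0 < a by rewrite invr_gt0 ltr0n.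
  have ab : a < b by rewrite (@lt_trans _ _ 1)// ?invf_lt1 ?ltr0n// ltr1n.
  pose G := (fun y => F y - c) \_ `[a, b].
  have mab : measurable (`[a, b]%classic : set (measurableTypeR R)) by exact: measurable_itv.
  have Iab : mu.-integrable `[a, b] (fun y => (F y - c)%:E).
    have := Dint_itv (@subset_itv_D R a b a0) (Dint_cut c a0 ab).
    by apply: eq_integrable => // y; rewrite inE /= => yab; rewrite patchE ifT// inE.
  have IG : mu.-integrable setT (fun y => (G y)%:E).
    have := (@integrable_restrict _ _ _ mu _ mab _ (@measurableT _ (measurableTypeR R)) (fun y =>
      (F y - c)%:E)).1.
    by rewrite setTI => /(_ Iab); rewrite restrict_EFin.
  have IGi (i : interval R) : mu.-integrable [set` i] (fun y => (G y)%:E).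
    by apply: integrableS IG => //; exact: measurable_itv.
  have lG : locally_integrable [set: R] G by apply: integrable_locally.
  have := FTC1Ny (fun y => IGi `]-oo, y]) lG.
  apply: filterS; first exact: (ae_filter_ringOfSetsType mu).
  move=> x Hx /andP[ax xb].
  have [dP eP] := Hx.
  have GE : G x = F x - c.
    by rewrite /G patchE ifT// inE /= in_itv /= !ltW.
  apply/eqP; rewrite -subr_eq0 -GE -eP; apply/eqP.
  set P := (fun x => _) in dP *.
  have Pc z : a < z -> z < b -> P z = P a.
    move=> az zb; apply/eqP; rewrite -subr_eq0 /P.
    have baz : (BRight a <= BRight z)%O by rewrite bnd_simp ltW.
    rewrite (@Rintegral_itvB _ G -oo%O (BRight z) a (IGi _) isT baz).
    rewrite -Rintegral_itv_bndo_bndc; last exact: IGi.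
    rewrite -[X in _ == X](Hc a z a0 az); apply/eqP; apply: eq_Rintegral => t.
    rewrite inE /= in_itv /= => /andP[at_ tz]; rewrite /G patchE ifT// inE /= in_itv /=.
    by rewrite !ltW// (lt_trans tz).
  apply: isdE; apply: isd_near (isd_cst (P a) x).
  have na : \forall z \near x, a < z by apply: lt_nbhsr.
  have nb : \forall z \near x, z < b by apply: lt_nbhsl.
  by apply: filterS2 na nb => z az zb; rewrite Pc.
have := ae_foralln H; apply: filterS.
move=> y Hy /D_pos y0.
have [n Hn] : exists n, Num.max y y^-1 < n.+2%:R.
  have := archi_boundP (_ : 0 <= Num.max y y^-1); rewrite le_max (ltW y0) => /(_ isT) h.
  exists (Num.bound (Num.max y y^-1)); apply: lt_trans h _.
  by rewrite ltr_nat.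
apply: (Hy n); move: Hn; rewrite gt_max => /andP[-> h]; rewrite andbT.
by rewrite invf_plt// posrE ltr0n.
Qed.

End DuBoisReymond.

(** * Compactly supported integrands and antiderivatives *)

Section Support.
Variable R : realType.
Implicit Types (x y z a b s t c : R) (f g h k : R -> R).
Notation mu := (@lebesgue_measure R).
Notation D := (@halfline R).
Notation Dint f := (mu.-integrable D (fun y => (f y)%:E)).

Lemma support_bounded f a b : 0 < a -> a < b -> (forall y, 0 < y -> {for y, continuous f}) ->
  (forall y, 0 < y -> y <= a \/ b <= y -> f y = 0) -> exists2 M, 0 <= M & forall y, 0 < y ->
    `|f y| <= M.
Proof.
move=> a0 ab cf f0.
have [M M0 HM] : exists2 M, 0 <= M & forall y, a <= y <= b -> `|f y| <= M.
  by apply: continuous_bounded; [exact: ltW|move=> z /andP[az _]; apply: cf; exact: lt_le_trans az].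
exists M => // y y0; have [ya|ya] := leP y a; first by rewrite f0 ?normr0//; left.
have [yb|yb] := leP b y; first by rewrite f0 ?normr0//; right.
by apply: HM; rewrite !ltW.
Qed.

Lemma Dint_support f a b : 0 < a -> a < b -> (forall y, 0 < y -> {for y, continuous f}) ->
  (forall y, 0 < y -> y <= a \/ b <= y -> f y = 0) -> Dint f.
Proof.
move=> a0 ab cf f0; have [M M0 HM] := support_bounded a0 ab cf f0.
apply: (Dint_le (measurable_posC cf) _ (DintZ (M * expR b) (Dint_exp R))) => y y0.
have [yb|yb] := leP b y.
  by rewrite f0 ?normr0 ?mulr_ge0 ?expR_ge0//; right.
rewrite -mulrA -expRD; apply: le_trans (HM y y0) _.
by rewrite ler_peMr// -expR0 ler_expR subr_ge0 ltW.
Qed.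

Lemma Rint_support f a b : 0 < a -> (forall y, 0 < y -> y <= a \/ b <= y -> f y = 0) ->
  \int[mu]_(y in D) f y = \int[mu]_(y in `[a, b]) f y.
Proof.
move=> a0 f0; rewrite Rintegral_mkcond [RHS]Rintegral_mkcond; apply: eq_Rintegral => y _.
rewrite !patchE !mem_setE !in_itv /= andbT.
have [y0|y0] := ltP 0 y; last by rewrite leNgt (le_lt_trans y0 a0).
have [ay|ya] := leP a y; last by rewrite f0//; left; exact: ltW.
by have [yb|by_] := leP y b => //=; rewrite f0//; right; exact: ltW.
Qed.

(** Since h may fail to be integrable at 0, the base point is 1. The difference is the signed
    integral from 1 to y; one of the two intervals is always empty. *)
Lemma primitive_exists h : (forall y, 0 < y -> {for y, continuous h}) ->
  exists P : R -> R, forall y, 0 < y -> is_derive y 1 P (h y).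
Proof.
move=> ch; exists (fun y => \int[mu]_(t in `]1, y]) h t - \int[mu]_(t in `]y, 1]) h t) => y y0.
pose a := Num.min y 1 / 2; pose b := Num.max y 1 + 1.
have m0 : 0 < Num.min y 1 by rewrite lt_min y0 ltr01.
have a0 : 0 < a by rewrite divr_gt0.
have my : Num.min y 1 <= y by rewrite ge_min lexx.
have m1 : Num.min y 1 <= 1 by rewrite ge_min lexx orbT.
have My : y <= Num.max y 1 by rewrite le_max lexx.
have M1 : 1 <= Num.max y 1 by rewrite le_max lexx orbT.
have ay : a < y by rewrite /a; lra.
have a1 : a < 1 by rewrite /a; lra.
have yb : y < b by rewrite /b; lra.
have b1 : 1 < b by rewrite /b; lra.
have mab : measurable (`[a, b]%classic : set (measurableTypeR R)) by exact: measurable_itv.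
pose hh := h \_ `[a, b].
have hhE z : a < z -> z < b -> hh z = h z.
  by move=> az zb; rewrite /hh patchE ifT// inE /= in_itv /= !ltW.
have Ih : mu.-integrable `[a, b] (fun y => (h y)%:E).
  by apply: itv_cont_integrable => z /andP[az _]; apply: ch; exact: lt_le_trans az.
have Ihh : Dint hh.
  have := (@integrable_restrict _ _ _ mu _ mab _ (@measurable_D R) (fun y => (h y)%:E)).1.
  rewrite setIidr; last exact: subset_itv_D.
  by move=> /(_ Ih); rewrite restrict_EFin.
have na : \forall z \near y, a < z by apply: lt_nbhsr.
have nb : \forall z \near y, z < b by apply: lt_nbhsl.
have chh : {for y, continuous hh}.
  have e : \forall z \near y, h z = hh z by apply: filterS2 na nb => z az zb; rewrite hhE.
  rewrite /prop_for /continuous_at hhE//; apply: cvg_trans (ch y y0); exact: near_eq_cvg.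
have sub z w : a < z -> z <= w -> w < b -> \int[mu]_(t in `]z, w]) h t = PR hh w - PR hh z.
  move=> az zw wb; rewrite PR_sub//; last by rewrite ltW// (lt_trans a0).
  apply: eq_Rintegral => t; rewrite inE /= in_itv /= => /andP[zt tw].
  by rewrite hhE// ?(lt_trans az)// (le_lt_trans tw).
have em z w : w <= z -> \int[mu]_(t in `]z, w]) h t = 0.
  by move=> wz; rewrite set_itv_ge ?Rintegral_set0// bnd_simp -leNgt.
have near_E : \forall z \near y, PR hh z - PR hh 1 =
    \int[mu]_(t in `]1, z]) h t - \int[mu]_(t in `]z, 1]) h t.
  apply: filterS2 na nb => z az zb; have [z1|/ltW z1] := leP z 1.
    by rewrite (em 1 z)// sub// sub0r opprB.
  by rewrite (em z 1)// sub// subr0.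
apply: isd_near near_E _.
apply: (is_derive_eq (isdB (PR_isd Ihh y0 chh) (isd_cst (PR hh 1) y))).
by rewrite subr0 hhE.
Qed.

End Support.

(** * From an eigenfunction to a classical solution *)

Section Regularity.
Variable R : realType.
Implicit Types (x y z a b s t c : R) (f g h k : R -> R).
Notation mu := (@lebesgue_measure R).
Notation D := (@halfline R).
Notation Dint f := (mu.-integrable D (fun y => (f y)%:E)).
Variable f0 : R -> R.
Hypothesis hs : smooth_closed_halfline f0.
Hypothesis hm : forall x y, 0 <= x -> x <= y -> f0 x <= f0 y.
Hypothesis ode : profile_ode f0.
Hypothesis f00 : f0 0 = 0.
Hypothesis hL : exists L : R, f0 x @[x --> +oo] --> L.
Hypothesis hnz : exists2 y, 0 < y & f0 y != 0.
Variable T : (R -> R) -> (R -> R) -> Prop.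
Hypothesis sT : self_adjoint T.
Hypothesis eT : extends_A0 f0 T.
Variables (lam : R) (v : R -> R).
Hypothesis Tv : T v (fun y => lam * v y).

Notation u := (uu f0).
Notation u1 := (uu1 f0).
Notation u2 := (uu2 f0).
(** Substituting v = u Z turns the eigenvalue equation into (m Z')' = -(lam + 1) m Z. Integrated
    once from 0 it reads m Z' = -(lam + 1) N, where N is the primitive of g = rho u v. The weak form
    of this equation is what gets proved. *)
Let m y : R := rho y * u y ^+ 2.
Let g y : R := u y * v y * rho y.
Let N := PR g.
Let q y : R := 2 / y - y / 2.

Let upos y : 0 < y -> 0 < u y.
Proof. exact: (uu_gt0 hs hm ode f00 hnz). Qed.
Let une y : 0 < y -> u y != 0.
Proof. by move=> y0; rewrite gt_eqF// upos. Qed.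
Let rne y : 0 < y -> rho y != 0.
Proof. by move=> y0; rewrite gt_eqF// rho_gt0. Qed.
Let mne y : 0 < y -> m y != 0.
Proof. by move=> y0; rewrite mulf_neq0 ?expf_neq0 ?rne ?une. Qed.
Let du y : 0 < y -> is_derive y 1 u (u1 y).
Proof. exact: uu_isd. Qed.
Let du1 y : 0 < y -> is_derive y 1 u1 (u2 y).
Proof. exact: uu1_isd. Qed.
Let u2E y : 0 < y -> u2 y = (pot f0 y + 1) * u y - q y * u1 y.
Proof.
by move=> y0; have := A0_uu hs ode y0; rewrite (A0E f0 y0 du (du1 y0)) /q; lra.
Qed.
Let Lv : L2rho v.
Proof. by have [TL2 _] := sT; have [] := TL2 _ _ Tv. Qed.
Let Lu : L2rho u.
Proof. by have [TL2 _] := sT; have [] := TL2 _ _ (uu_graph hs hm ode f00 hL sT eT). Qed.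
Let Ig : Dint g. Proof. exact: L2_prod. Qed.
Let sm : smooth_pos m.
Proof.
apply: smooth_posM; first exact: smooth_pos_rho.
by have /smooth_posP su := uu_smooth hs; apply/smooth_posP => n; exact: CkX.
Qed.
Let contN y : 0 < y -> {for y, continuous N}.
Proof. exact: PR_continuous. Qed.
Let contm y : 0 < y -> {for y, continuous m}.
Proof. by move=> y0; exact: isd_cont (smooth_pos_isd sm y0). Qed.
Let contNm y : 0 < y -> {for y, continuous (fun y => N y / m y)}.
Proof.
move=> y0; apply: continuousM; first exact: contN.
apply: continuousV; [exact: mne|exact: contm].
Qed.

Section Test.
Variables (Phi : R -> R) (k : R -> R) (a b : R).
Hypothesis dPhi : forall y, 0 < y -> is_derive y 1 Phi (N y / m y).
Hypotheses (a0 : 0 < a) (ab : a < b) (sk : smooth_pos k).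
Hypothesis k0 : forall y, y <= a \/ b <= y -> k y = 0.
Hypothesis Ik0 : \int[mu]_(y in D) k y = 0.

Let contk y : 0 < y -> {for y, continuous k}.
Proof. by move=> y0; exact: isd_cont (smooth_pos_isd sk y0). Qed.
Let Ik : Dint k.
Proof. by apply: (Dint_support a0 ab contk) => y _; exact: k0. Qed.

Let xi := PR k.
Let dxi y : 0 < y -> is_derive y 1 xi (k y).
Proof. by move=> y0; apply: PR_isd => //; exact: contk. Qed.
Let xi0 y : 0 < y -> y <= a \/ b <= y -> xi y = 0.
Proof.
move=> y0 [ya|yb].
  by apply: PR_eq0 => z _ zy; rewrite k0//; left; exact: le_trans ya.
rewrite /xi (PR_full Ik (ltW y0)) ?Ik0// => z yz.
by rewrite k0//; right; rewrite (le_trans yb)// ltW.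
Qed.
Let sxi : smooth_pos xi. Proof. exact: (smooth_posI dxi). Qed.

Let kap y : R := xi y / m y.
Let skap : smooth_pos kap.
Proof. by apply: (smooth_posM sxi); apply: (smooth_posV _ sm) => y y0; exact: mne. Qed.
Let contkap y : 0 < y -> {for y, continuous kap}.
Proof. by move=> y0; exact: isd_cont (smooth_pos_isd skap y0). Qed.
Let kap0 y : 0 < y -> y <= a \/ b <= y -> kap y = 0.
Proof. by move=> y0 H; rewrite /kap xi0// mul0r. Qed.
Let Ikap : Dint kap. Proof. exact: (Dint_support a0 ab contkap). Qed.

(** The constant is chosen so that [eta] vanishes beyond b. To the left of a, [eta] equals -K, in
    general nonzero, so that [eta] times u enters the graph through [graph_closure] and not as a
    test function. *)
Let K := \int[mu]_(y in D) kap y.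
Let eta y : R := PR kap y - K.
Let deta y : 0 < y -> is_derive y 1 eta (kap y).
Proof.
move=> y0; apply: (is_derive_eq (isdB (PR_isd Ikap y0 (contkap y0)) (isd_cst K y))).
exact: subr0.
Qed.
Let seta : smooth_pos eta. Proof. exact: (smooth_posI deta). Qed.
Let eta_bound : exists2 M, 0 <= M & forall y, 0 < y -> `|eta y| <= M.
Proof.
have [M M0 HM] : exists2 M, 0 <= M & forall y, a <= y <= b -> `|eta y| <= M.
  apply: continuous_bounded; first exact: ltW.
  by move=> z /andP[az _]; apply: isd_cont (deta _); exact: lt_le_trans az.
exists (M + `|K|); first by rewrite addr_ge0.
move=> y y0; have [ya|ya] := leP y a.
  rewrite /eta PR_eq0 ?sub0r ?normrN ?lerDr// => z z0 zy.
  by rewrite kap0//; left; exact: le_trans ya.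
have [yb|yb] := leP b y.
  rewrite /eta (PR_full Ikap (ltW y0)) ?subrr ?normr0 ?addr_ge0// => z yz.
  by rewrite kap0 ?(lt_trans y0)//; right; rewrite (le_trans yb)// ltW.
by apply: (@le_trans _ _ M); [apply: HM; rewrite !ltW|rewrite lerDl].
Qed.

(* The factorisation through the ground state: [A0 f0 w] has no term in [eta']. *)
Let w y : R := eta y * u y.
Let sw : smooth_pos w. Proof. exact: (smooth_posM seta (uu_smooth hs)). Qed.
Let dw y : 0 < y -> is_derive y 1 w (kap y * u y + eta y * u1 y).
Proof. by move=> y0; exact: isdM (deta y0) (du y0). Qed.

Let A0w y : 0 < y -> A0 f0 w y = - (k y / (rho y * u y)) - eta y * u y.
Proof.
move=> y0; rewrite /A0.
have d1 z : 0 < z -> is_derive z 1 (fun z => xi z / u z + eta z * (rho z * u1 z))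
   ((k z * (u z)^-1 + xi z * (- u1 z / u z ^+ 2)) + (kap z * (rho z * u1 z) + eta z * ((q z * rho
     z) * u1 z + rho z * u2 z))).
  move=> z0; apply: isdD; first exact: isdM (dxi z0) (isdV (une z0) (du z0)).
  exact: isdM (deta z0) (isdM (rho_isd z0) (du1 z0)).
have d2 : is_derive y 1 (fun z => rho z * derive1 w z)
   ((k y * (u y)^-1 + xi y * (- u1 y / u y ^+ 2)) + (kap y * (rho y * u1 y) + eta y * ((q y * rho
     y) * u1 y + rho y * u2 y))).
  apply: isd_pos y0 (d1 y y0) => z z0; rewrite (isdE (dw z0)) /kap /m.
  have := une z0; have := rne z0; move: (u z) (rho z) => U r rn un; field.
  by rewrite rn un.
rewrite (isdE d2) -/(pot f0 y) (u2E y0) /kap /m /w.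
have := une y0; have := rne y0.
move: (u y) (rho y) (u1 y) (pot f0 y) (q y) (xi y) (eta y) (k y) => U r U1 p Q X E kk rn un; field.
by rewrite rn un.
Qed.

(** [eta] is bounded, so the terms containing it inherit the growth of u; those containing [kap] or
    k are compactly supported, hence bounded, and are absorbed by 1 <= [dom]. *)
Let tame_w : exists K, tame f0 K w.
Proof.
have [M M0 HM] := eta_bound.
have [C tC] := uu_tame hs hm ode f00 hL.
have C0 : 0 <= C by have [b0 _ _] := tC 1 ltr01; rewrite mulr1 in b0; exact: le_trans b0.
have bounded h : (forall y, 0 < y -> {for y, continuous h}) ->
   (forall y, 0 < y -> y <= a \/ b <= y -> h y = 0) -> exists2 M, 0 <= M & forall y, 0 < y ->
     `|h y| <= M.
  by move=> ch h0; exact: (support_bounded a0 ab ch h0).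
have [M1 M10 HM1] : exists2 M, 0 <= M & forall y, 0 < y -> `|kap y * u y| <= M.
  apply: bounded => y y0; last by move=> H; rewrite kap0// mul0r.
  by apply: continuousM; [exact: contkap|exact: isd_cont (du y0)].
have [M2 M20 HM2] : exists2 M, 0 <= M & forall y, 0 < y -> `|k y / (rho y * u y)| <= M.
  apply: bounded => y y0; last by move=> H; rewrite k0// mul0r.
  apply: continuousM; first exact: contk.
  apply: continuousV; first by rewrite mulf_neq0 ?rne ?une.
  by apply: continuousM; [exact: isd_cont (rho_isd y0)|exact: isd_cont (du y0)].
exists (M * C + M1 + M2) => y y0; have [b0 b1 b2] := tC y y0.
have e0 := HM y y0; have e1 := HM1 y y0; have e2 := HM2 y y0.
have y2 : 0 <= y ^+ 2 by rewrite sqr_ge0.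
have d1 : 1 <= dom y.
  by rewrite /dom ler_pdivlMr// mul1r; have := sqr_ge0 (y - 1); rewrite sqrrB1;
    set t := y ^+ 2 in y2 *; nra.
have d0 : 0 <= dom y by lra.
have hw : `|w y| <= M * C * y.
  by rewrite /w normrM -mulrA; apply: ler_pM.
split.
- apply: le_trans hw _; apply: ler_wpM2r; [exact: ltW|lra].
- rewrite (isdE (dw y0)); apply: le_trans (ler_normD _ _) _.
  have : `|eta y * u1 y| <= M * (C * (1 + y ^+ 2)).
    by rewrite normrM; apply: ler_pM => //; rewrite -(isdE (du y0)).
  have := mulr_ge0 M0 C0; set MC := M * C => h1 h2.
  have : (M1 + M2) * 1 <= (M1 + M2) * (1 + y ^+ 2) by rewrite ler_wpM2l ?addr_ge0//; lra.
  rewrite mulrA -/MC in h2; rewrite mulr1 => h3.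
  have -> : (MC + M1 + M2) * (1 + y ^+ 2) = MC * (1 + y ^+ 2) + (M1 + M2) * (1 + y ^+ 2) by ring.
  lra.
- rewrite A0w//; apply: le_trans (ler_normB _ _) _; rewrite normrN -/(w y).
  have h1 : `|w y| <= M * (C * dom y).
    rewrite /w normrM; apply: ler_pM => //.
    by rewrite -[`|u y|]normrN -(A0_uu hs ode y0).
  have : (M1 + M2) * 1 <= (M1 + M2) * dom y by rewrite ler_wpM2l ?addr_ge0.
  rewrite mulrA in h1; rewrite mulr1 => h3.
  have -> : (M * C + M1 + M2) * dom y = M * C * dom y + (M1 + M2) * dom y by ring.
  lra.
Qed.

(** Pairing the eigenvalue equation with [eta] u gives int k v/u = -(lam + 1) int eta g. As [eta] is
    minus the tail integral of [kap], Fubini turns int eta g into - int kap N. Finally kap N = xi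
    Phi', and integrating by parts, with xi zero at both ends, gives int kap N = - int k Phi. *)
Lemma weak_test : \int[mu]_(y in D) (k y * (v y / u y + (lam + 1) * Phi y)) = 0.
Proof.
have mD := @measurable_D R.
have [C tC] := tame_w.
have Tw := graph_closure (profile_smooth hs) sT eT sw tC.
have [TL2 Tadj] := sT.
have /Tadj[_ [_ H]] := Tv.
have e := H _ _ Tw.
have [Lw LAw] := TL2 _ _ Tw.
have Ieg : Dint (fun y => eta y * g y).
  by apply: Dint_ext (L2_prod Lw Lv) => y _; rewrite /w /g; ring.
have IAv := L2_prod LAw Lv.
have kzE y : 0 < y -> k y * (v y / u y) = - (A0 f0 w y * v y * rho y) - eta y * g y.
  move=> y0; rewrite (A0w y0) /g; have := une y0; have := rne y0.
  by move: (u y) (rho y) (eta y) (k y) (v y) => U r E kk V rn un; field; rewrite rn un.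
have Ikz : Dint (fun y => k y * (v y / u y)).
  apply: (Dint_ext _ (DintB (DintZ (-1) IAv) Ieg)) => y y0; rewrite kzE//; ring.
have e1 : \int[mu]_(y in D) (A0 f0 w y * v y * rho y) = lam * \int[mu]_(y in D) (eta y * g y).
  rewrite -RintegralZl//; transitivity (ip w (fun y => lam * v y)); first exact: e.
  by rewrite /ip; congr fine; apply: eq_integral => y _; congr EFin; rewrite /w /g; ring.
have e2 : \int[mu]_(y in D) (k y * (v y / u y)) = - (lam + 1) * \int[mu]_(y in D) (eta y * g y).
  rewrite (_ : \int[mu]_(y in D) (k y * (v y / u y)) =
     \int[mu]_(y in D) (-1 * (A0 f0 w y * v y * rho y) - eta y * g y)); last first.
    by apply: eq_Rintegral => y; rewrite inE => /D_pos y0; rewrite kzE// mulN1r.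
  rewrite RintegralB//; last exact: (DintZ (-1) IAv).
  by rewrite RintegralZl// e1; ring.
have e3 : \int[mu]_(y in D) (eta y * g y) = - \int[mu]_(y in D) (kap y * N y).
  rewrite -(Dfubini Ig Ikap) -[RHS]mulN1r -RintegralZl//.
    by apply: eq_Rintegral => y _; rewrite /eta /K; ring.
  apply: (Dint_ext _ (DintZ (-1) Ieg)) => y _; rewrite /eta /K; ring.
have cPhi y : 0 < y -> {for y, continuous Phi} by move=> y0; exact: isd_cont (dPhi y0).
have ckP y : 0 < y -> {for y, continuous (fun y => k y * Phi y)}.
  by move=> y0; apply: continuousM; [exact: contk|exact: cPhi].
have ckN y : 0 < y -> {for y, continuous (fun y => kap y * N y)}.
  by move=> y0; apply: continuousM; [exact: contkap|exact: contN].
have IkP : Dint (fun y => k y * Phi y).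
  by apply: (Dint_support a0 ab ckP) => y y0 h; rewrite k0// mul0r.
have IkN : Dint (fun y => kap y * N y).
  by apply: (Dint_support a0 ab ckN) => y y0 h; rewrite kap0// mul0r.
have e4 : \int[mu]_(y in D) (k y * Phi y) + \int[mu]_(y in D) (kap y * N y) = 0.
  rewrite -RintegralD// (@Rint_support _ _ a b a0); last first.
    by move=> y y0 h; rewrite kap0// k0// !mul0r addr0.
  have b0 : 0 < b by exact: lt_trans ab.
  have d1 z : a <= z <= b -> is_derive z 1 (fun y => xi y * Phi y) (k z * Phi z + kap z * N z).
    move=> /andP[az _]; have z0 : 0 < z by exact: lt_le_trans az.
    apply: (is_derive_eq (isdM (dxi z0) (dPhi z0))); congr (_ + _).
    by rewrite /kap mulrA mulrAC.
  have c1 z : a <= z <= b -> {for z, continuous (fun y => k y * Phi y + kap y * N y)}.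
    move=> /andP[az _]; have z0 : 0 < z by exact: lt_le_trans az.
    by apply: continuousD; [exact: ckP|exact: ckN].
  by rewrite (Rint_FTC ab d1 c1) (xi0 a0 (or_introl (lexx a))) (xi0 b0 (or_intror (lexx b)))
    !mul0r subrr.
rewrite (_ : \int[mu]_(y in D) _ = \int[mu]_(y in D) (k y * (v y / u y) + (lam + 1) * (k y * Phi
  y))); last first.
  by apply: eq_Rintegral => y _; ring.
rewrite RintegralD//; last exact: DintZ.
rewrite RintegralZl// e2 e3.
by rewrite (_ : \int[mu]_(y in D) (kap y * N y) = - \int[mu]_(y in D) (k y * Phi y)); [ring|lra].
Qed.

End Test.

Let mmu := lam + 1.

(** The du Bois-Reymond lemma yields v = u (c - (lam + 1) Phi) almost everywhere, and the right-hand
    side is V. It is once differentiable because Phi is; the second derivative requires that of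
    N. *)
Lemma eigen_regular : exists V V1 : R -> R,
  [/\ forall y, 0 < y -> is_derive y 1 V (V1 y),
      forall y, 0 < y -> is_derive y 1 V1 ((pot f0 y - lam) * V y - (2 / y - y / 2) * V1 y),
      L2rho V & {ae mu, forall y, D y -> v y = V y}].
Proof.
have mD := @measurable_D R.
have [Phi dPhi] := primitive_exists contNm.
have cPhi y : 0 < y -> {for y, continuous Phi} by move=> y0; exact: isd_cont (dPhi y y0).
pose F y : R := v y / u y + mmu * Phi y.
have IF a b : 0 < a -> a < b -> mu.-integrable `[a, b] (fun y => (F y)%:E).
  move=> a0 ab.
  have mab : measurable (`[a, b]%classic : set (measurableTypeR R)) by exact: measurable_itv.
  have pos z : a <= z <= b -> 0 < z by move=> /andP[az _]; exact: lt_le_trans az.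
  have cmP z : a <= z <= b -> {for z, continuous (fun y => mmu * Phi y)}.
    by move=> zab; apply: continuousM; [exact: cst_continuous|exact/cPhi/pos].
  have I2 := itv_cont_integrable cmP.
  have [M M0 HM] : exists2 M, 0 <= M & forall z, a <= z <= b -> `|(m z)^-1| <= M.
    apply: continuous_bounded; first exact: ltW.
    by move=> z /pos z0; apply: continuousV; [exact: mne|exact: contm].
  have I1 : mu.-integrable `[a, b] (fun y => (v y / u y)%:E).
    have IgM : mu.-integrable `[a, b] (fun y => (M * g y)%:E).
      exact: Dint_itv (@subset_itv_D R a b a0) (DintZ M Ig).
    apply: le_integrable IgM => //.
      apply/measurable_EFinP; apply: measurable_funS (@subset_itv_D R a b a0) _ => //.
      apply: measurable_funM; first exact: L2_measurable.
      apply: measurable_posC => y y0; apply: continuousV; first exact: une.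
      exact: isd_cont (du y0).
    move=> z /=; rewrite in_itv /= => zab; rewrite lee_fin.
    have z0 := pos z zab.
    have -> : v z / u z = (m z)^-1 * g z.
      rewrite /m /g; have := une z0; have := rne z0; move: (u z) (rho z) (v z) => U r W rn un.
      by field; rewrite rn un.
    rewrite !normrM ler_wpM2r// (ger0_norm M0); exact: HM.
  by have := integrableD mab I1 I2; apply: eq_integrable.
have W k a b : 0 < a -> a < b -> smooth_pos k -> (forall y, y <= a \/ b <= y -> k y = 0) ->
    \int[mu]_(y in D) k y = 0 -> \int[mu]_(y in D) (k y * F y) = 0.
  by move=> a0 ab sk k0 Ik0; exact: (@weak_test Phi k a b dPhi a0 ab sk k0 Ik0).
have [c Hc] := weak_ae IF W.
pose Z y : R := c - mmu * Phi y.
pose V y : R := u y * Z y.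
pose V1 y : R := u1 y * Z y - mmu * (N y / (rho y * u y)).
have vV : {ae mu, forall y, D y -> v y = V y}.
  move: Hc; apply: filterS; first exact: (ae_filter_ringOfSetsType mu).
  move=> y Hy Dy; have y0 : 0 < y by apply/D_pos.
  have := Hy Dy; rewrite /F /V /Z => <-; rewrite addrK mulrCA mulfV ?mulr1//.
  exact: une.
have dZ y : 0 < y -> is_derive y 1 Z (- (mmu * (N y / m y))).
  move=> y0; apply: (is_derive_eq (isdB (isd_cst c y) (isdM (isd_cst mmu y) (dPhi y y0)))).
  by rewrite mul0r !add0r.
have dV y : 0 < y -> is_derive y 1 V (V1 y).
  move=> y0; apply: (is_derive_eq (isdM (du y0) (dZ y y0))).
  rewrite /V1 /m; have := une y0; have := rne y0; move: (u y) (rho y) => U r rn un.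
  by field; rewrite rn un.
have cV y : 0 < y -> {for y, continuous V} by move=> y0; exact: isd_cont (dV y y0).
have mV : measurable_fun D V by exact: measurable_posC.
have LV : L2rho V.
  have [mv Iv] := Lv; split=> //.
  rewrite (_ : (\int[mu]_(x in D) ((V x) ^+ 2 * rho x)%:E)%E
    = (\int[mu]_(x in D) ((v x) ^+ 2 * rho x)%:E)%E)//.
  apply: ae_eq_integral => //.
  - apply/measurable_EFinP; apply: measurable_funM; [exact: measurable_funX|exact: measurable_rho].
  - apply/measurable_EFinP; apply: measurable_funM; [exact: measurable_funX|exact: measurable_rho].
  - move: vV; apply: filterS; first exact: (ae_filter_ringOfSetsType mu).
    by move=> y Hy Dy; rewrite (Hy Dy).
have IgV := L2_prod Lu LV.
(* Bootstrap: N was defined with the measurable v, but the integral does not change when v is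
   replaced by the continuous V, and N becomes differentiable. *)
have NE y : 0 < y -> N y = PR (fun y => u y * V y * rho y) y.
  move=> y0; rewrite /N /PR /Rintegral; congr fine; apply: ae_eq_integral => //.
  - exact: measurable_int (Dint_itv (@sub_oc_D R y) Ig).
  - exact: measurable_int (Dint_itv (@sub_oc_D R y) IgV).
  - move: vV; apply: filterS; first exact: (ae_filter_ringOfSetsType mu).
    by move=> z Hz /(@sub_oc_D R y) Dz; rewrite /g (Hz Dz).
have dN y : 0 < y -> is_derive y 1 N (u y * V y * rho y).
  move=> y0; apply: (@isd_pos _ (PR (fun y => u y * V y * rho y))) => //.
    by move=> z z0; rewrite NE.
  apply: PR_isd => //; apply: continuousM; last exact: isd_cont (rho_isd y0).
  by apply: continuousM; [exact: isd_cont (du y0)|exact: cV].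
exists V, V1; split; [exact: dV| |exact: LV|exact: vV] => y y0.
have ru0 : rho y * u y != 0 by rewrite mulf_neq0 ?rne ?une.
have dru := @isdV _ (fun y => rho y * u y) y _ ru0 (isdM (rho_isd y0) (du y0)).
have H := isdB (isdM (du1 y0) (dZ y y0)) (isdM (isd_cst mmu y) (isdM (dN y y0) dru)).
apply: (is_derive_eq H).
rewrite (u2E y0) /V1 /V /m /mmu /q; have := une y0; have := rne y0;
  have yn : y != 0 by rewrite gt_eqF.
move: (u y) (u1 y) (rho y) (Z y) (N y) (pot f0 y) => U U1 r ZZ NN p rn un.
by field; rewrite rn un yn.
Qed.

End Regularity.

(** * Riccati comparison *)

Section Sturm.
Variable R : realType.
Implicit Types (x y z a b s t c h r w : R).
Notation mu := (@lebesgue_measure R).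
Notation D := (@halfline R).
Variables (f0 V V1 : R -> R) (lam : R).
Let q y : R := 2 / y - y / 2.
Hypothesis sf0 : smooth_pos f0.
Hypothesis dV : forall y, 0 < y -> is_derive y 1 V (V1 y).
Hypothesis dV1 : forall y, 0 < y ->
  is_derive y 1 V1 ((pot f0 y - lam) * V y - (2 / y - y / 2) * V1 y).
Hypothesis lam0 : lam <= 0.
Hypothesis LV : L2rho V.

(* The boundary term left after completing the square in the quadratic form with
   [g = h / y]; [riccati al be] is [y^2 (g' + g^2 + (2/y - y/2) g)] for
   [h = al - be * y]. *)
Definition bt h y : R := rho y * V y * (V1 y - h / y * V y).
Definition riccati (al be y : R) : R :=
  - be * y + (al - be * y) ^+ 2 + (al - be * y) - y ^+ 2 / 2 * (al - be * y).
Definition bt1 (al be y : R) : R :=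
  rho y * ((V1 y - (al - be * y) / y * V y) ^+ 2
   + (2 * cos (2 * f0 y) - lam * y ^+ 2 - riccati al be y) / y ^+ 2 * V y ^+ 2).

Lemma bt_isd al be y : 0 < y -> is_derive y 1 (fun y => bt (al - be * y) y) (bt1 al be y).
Proof.
move=> y0; have yn : y != 0 by rewrite gt_eqF.
have dh := isdB (isd_cst al y) (isdM (isd_cst be y) (isd_id y)).
have dg := isdM dh (@isdV _ (fun y => y) y _ yn (isd_id y)).
have dW := isdB (dV1 y0) (isdM dg (dV y0)).
apply: (is_derive_eq (isdM (isdM (rho_isd y0) (dV y0)) dW)).
rewrite /bt1 /riccati /pot.
move: (rho y) (V y) (V1 y) (cos _) => r W W1 cc.
by field.
Qed.

Lemma cont_V y : 0 < y -> {for y, continuous V}.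
Proof. by move=> y0; exact: isd_cont (dV y0). Qed.

Lemma bt1_ge al be y : 0 < y -> riccati al be y < 2 * cos (2 * f0 y) -> 0 <= bt1 al be y.
Proof.
move=> y0 H; rewrite /bt1 mulr_ge0 ?rho_ge0// addr_ge0 ?sqr_ge0// mulr_ge0 ?sqr_ge0//.
rewrite divr_ge0 ?sqr_ge0// subr_ge0; have := mulr_le0_ge0 lam0 (sqr_ge0 y); lra.
Qed.

Lemma bt1_gt al be y : 0 < y -> riccati al be y < 2 * cos (2 * f0 y) -> V y != 0 ->
  0 < bt1 al be y.
Proof.
move=> y0 H Vn; rewrite /bt1 mulr_gt0 ?rho_gt0// ltr_wpDl ?sqr_ge0// mulr_gt0//; last first.
  by rewrite exprn_even_gt0.
rewrite divr_gt0 ?exprn_gt0// subr_gt0; have := mulr_le0_ge0 lam0 (sqr_ge0 y); lra.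
Qed.

Section Piece.
Variables (al be a b : R).
Hypothesis a0 : 0 < a.
Hypothesis ric : forall y, a <= y <= b -> riccati al be y < 2 * cos (2 * f0 y).
Let B y := bt (al - be * y) y.

Lemma piece_mono s t : a <= s -> s <= t -> t <= b -> B s <= B t.
Proof.
move=> as_ st tb; apply: (@isd_nondecr _ B (bt1 al be) s t st).
  by move=> z /andP[sz _]; apply: bt_isd; rewrite (lt_le_trans a0)// (le_trans as_).
move=> z /andP[/ltW sz /ltW zt]; apply: bt1_ge; first by rewrite (lt_le_trans a0)// (le_trans as_).
by apply: ric; rewrite (le_trans as_)// (le_trans zt).
Qed.

(** V has no zero in a neighbourhood of s and r is placed inside it, so the mean value point between
    r and s has a positive derivative of B. *)
Lemma piece_strict_left s : a < s -> s <= b -> V s != 0 ->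
  exists r, [/\ a < r, r < s & B r < B s].
Proof.
move=> as_ sb Vs; have s0 : 0 < s := lt_trans a0 as_.
have nz : \forall z \near s, V z != 0 by apply: (cvgr_neq0 _ (cont_V s0)).
have [d /= d0 Hd] := nz.
pose r := Num.max ((a + s) / 2) (s - d / 2).
have r1 : (a + s) / 2 <= r by rewrite le_max lexx.
have r2 : s - d / 2 <= r by rewrite le_max lexx orbT.
have rs : r < s by rewrite gt_max; apply/andP; split; lra.
have ar : a < r by lra.
exists r; split=> //.
have r0 : 0 < r := lt_trans a0 ar.
have [c [/andP[rc cs] e]] := @MVTc _ B (bt1 al be) r s rs
  (fun z zrs => bt_isd al be (lt_le_trans r0 (proj1 (andP zrs)))).
rewrite -subr_gt0 e mulr_gt0 ?subr_gt0//.
apply: bt1_gt; [exact: lt_trans rc|apply: ric; apply/andP; split; lra|].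
by apply: Hd; rewrite /ball_ /= ger0_norm; lra.
Qed.

Lemma piece_strict_right s : a <= s -> s < b -> V s != 0 ->
  exists r, [/\ s < r, r < b & B s < B r].
Proof.
move=> as_ sb Vs; have s0 : 0 < s := lt_le_trans a0 as_.
have nz : \forall z \near s, V z != 0 by apply: (cvgr_neq0 _ (cont_V s0)).
have [d /= d0 Hd] := nz.
pose r := Num.min ((b + s) / 2) (s + d / 2).
have r1 : r <= (b + s) / 2 by rewrite ge_min lexx.
have r2 : r <= s + d / 2 by rewrite ge_min lexx orbT.
have rs : s < r by rewrite lt_min; apply/andP; split; lra.
have ar : r < b by lra.
exists r; split=> //.
have [c [/andP[rc cs] e]] := @MVTc _ B (bt1 al be) s r rs
  (fun z zrs => bt_isd al be (lt_le_trans s0 (proj1 (andP zrs)))).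
rewrite -subr_gt0 e mulr_gt0 ?subr_gt0//.
apply: bt1_gt; [exact: lt_trans rc|apply: ric; apply/andP; split; lra|].
by apply: Hd; rewrite /ball_ /= ler0_norm; lra.
Qed.

End Piece.

(** If V b is not 0, the premise says V'/V <= h/b at b: thus h/b is a barrier for the logarithmic
    derivative. At a zero of V the boundary term is 0, and the premises of both definitions hold. *)
Definition left_adm b h := bt h b <= 0 -> forall y, 0 < y -> y <= b -> V y = 0.
Definition right_adm a h := 0 <= bt h a -> forall y, a <= y -> V y = 0.

Lemma bt_V0 h y : V y = 0 -> bt h y = 0.
Proof. by move=> Vy; rewrite /bt Vy mulr0 mul0r. Qed.

(** B is nondecreasing on [a, b], so B t <= 0 descends to a, where admissibility gives V = 0 on (0,
    a] and hence B a = 0. Then B is squeezed to 0 on [a, t], whereas it increases strictly near any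
    point with V nonzero. *)
Lemma left_step al be a b t : 0 < a -> (forall y, a <= y <= b ->
  riccati al be y < 2 * cos (2 * f0 y)) ->
  left_adm a (al - be * a) -> a <= t <= b -> left_adm t (al - be * t).
Proof.
move=> a0 ric La /andP[at_ tb] Bt.
have Va : forall y, 0 < y -> y <= a -> V y = 0.
  by apply: La; apply: le_trans Bt; exact: (piece_mono a0 ric).
have Ba : bt (al - be * a) a = 0 by apply: bt_V0; exact: Va.
move=> y y0 yt; have [ya|ay] := leP y a; first exact: Va.
apply/eqP/negPn/negP => Vy.
have [r [ar ry Br]] := piece_strict_left a0 ric ay (le_trans yt tb) Vy.
have h1 := piece_mono a0 ric (lexx a) (ltW ar) (ltW (lt_le_trans ry (le_trans yt tb))).
have h2 := piece_mono a0 ric (ltW ay) yt tb.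
lra.
Qed.

Lemma right_step al be a b t : 0 < a -> (forall y, a <= y <= b ->
  riccati al be y < 2 * cos (2 * f0 y)) ->
  right_adm b (al - be * b) -> a <= t <= b -> right_adm t (al - be * t).
Proof.
move=> a0 ric Lb /andP[at_ tb] Bt.
have Vb : forall y, b <= y -> V y = 0.
  by apply: Lb; apply: (le_trans Bt); exact: (piece_mono a0 ric).
have Bb : bt (al - be * b) b = 0 by apply: bt_V0; exact: Vb.
move=> y ty; have [yb|yb] := leP b y; first exact: Vb.
apply/eqP/negPn/negP => Vy.
have [r [ar ry Br]] := piece_strict_right a0 ric (le_trans at_ ty) yb Vy.
have h1 := piece_mono a0 ric (ltW (le_lt_trans (le_trans at_ ty) ar)) (ltW ry) (lexx b).
have h2 := piece_mono a0 ric at_ ty (ltW yb).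
lra.
Qed.

Let IV : mu.-integrable D (fun y => (V y ^+ 2 * rho y)%:E).
Proof. by have /L2rhoP[] := LV. Qed.
Let V2ge y : 0 < y -> 0 <= V y ^+ 2 * rho y.
Proof. by move=> _; rewrite mulr_ge0 ?sqr_ge0 ?rho_ge0. Qed.

(* With [F = V^2 rho] and [B] the boundary term, [B' >= B^2 / F], hence
   [F >= 2 - 1 / F >= (2 y + 1 / B)'], which contradicts the integrability of [F]. *)
Lemma right_end a t : 0 < a -> (forall y, a <= y -> 0 < 2 * cos (2 * f0 y)) -> a <= t ->
  right_adm t 0.
Proof.
move=> a0 ric at_ Bt y ty; apply/eqP/negPn/negP => Vy.
have ric' b z : a <= z <= b -> riccati 0 0 z < 2 * cos (2 * f0 z).
  move=> /andP[az _]; have -> : riccati 0 0 z = 0 by rewrite /riccati; ring.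
  exact: ric.
have E z : bt (0 - 0 * z) z = bt 0 z by rewrite mul0r subr0.
have y1 : y < y + 1 by lra.
have [r [yr _ Br]] := piece_strict_right a0 (ric' (y + 1)) (le_trans at_ ty) y1 Vy.
have ar : a <= r by lra.
have r0 : 0 < r := lt_le_trans a0 ar.
have Bpos z : r <= z -> 0 < bt 0 z.
  move=> rz; have h1 := piece_mono a0 (ric' z) at_ ty (ltW (lt_le_trans yr rz)).
  have h2 := piece_mono a0 (ric' z) ar rz (lexx z).
  by rewrite !E in h1 h2 Br; lra.
pose I := \int[mu]_(y in D) (V y ^+ 2 * rho y).
pose G z : R := 2 * z + (bt 0 z)^-1.
pose g z : R := 2 - bt1 0 0 z / bt 0 z ^+ 2.
have dB z : 0 < z -> is_derive z 1 (bt 0) (bt1 0 0 z).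
  by move=> z0; apply: isd_pos z0 (bt_isd 0 0 z0) => w _; rewrite E.
(* Large enough that 2 (Y - r) - 1 / B r exceeds the full integral I. *)
pose Y := r + I + (bt 0 r)^-1 + 1.
have I0 : 0 <= I by apply: Rintegral_ge0 => z /D_pos; exact: V2ge.
have iB : 0 < (bt 0 r)^-1 by rewrite invr_gt0 Bpos.
have rY : r < Y by rewrite /Y; lra.
have H : G Y - G r <= I.
  apply: (@int_ge_primitive _ _ G g r Y IV V2ge r0 rY).
  - move=> z /andP[rz _]; have z0 := lt_le_trans r0 rz.
    have Bn : bt 0 z != 0 by rewrite gt_eqF ?Bpos.
    apply: (is_derive_eq (isdD (isdM (isd_cst 2 z) (isd_id z)) (isdV Bn (dB z z0)))).
    by rewrite /g; field.
  - move=> z /andP[rz _]; have z0 := lt_le_trans r0 rz.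
    have Bn : bt 0 z != 0 by rewrite gt_eqF ?Bpos.
    have cB := isd_cont (dB z z0).
    have crho := isd_cont (rho_isd z0); have cV := cont_V z0; have cV1 := isd_cont (dV1 z0).
    have cp := continuous_pot sf0 z0.
    apply: continuousB; first exact: cst_continuous.
    apply: continuousM; last first.
      apply: continuousV; first by rewrite expf_neq0.
      by apply: continuousM.
    have e : \forall x \near z, rho x * (V1 x * V1 x + (pot f0 x - lam) * (V x * V x)) = bt1 0 0 x.
      have : \forall x \near z, 0 < x by apply: lt_nbhsr.
      apply: filterS => x x0; rewrite /bt1 /riccati /pot; field; rewrite gt_eqF//.
    rewrite /prop_for /continuous_at -(nbhs_singleton e).
    apply: cvg_trans; first exact: near_eq_cvg e.
    apply: cvgM; first exact: crho.
    apply: cvgD; first exact: cvgM.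
    by apply: cvgM; [apply: cvgB => //; exact: cvg_cst|exact: cvgM].
  - move=> z /andP[rz _]; have z0 := lt_le_trans r0 rz; rewrite /g.
    have Bz := Bpos z rz.
    have Vz : V z != 0 by apply/eqP => /(bt_V0 0) e; rewrite e ltxx in Bz.
    have rp := rho_gt0 z0.
    set F := V z ^+ 2 * rho z.
    have F0 : 0 < F by rewrite mulr_gt0// exprn_even_gt0.
    have h1 : (bt 0 z) ^+ 2 / F <= bt1 0 0 z.
      have : bt1 0 0 z - (bt 0 z) ^+ 2 / F = (2 * cos (2 * f0 z) - lam * z ^+ 2) / z ^+ 2 * F.
        rewrite /bt1 /bt /F /riccati; field.
        by rewrite Vz !gt_eqF.
      have : 0 <= (2 * cos (2 * f0 z) - lam * z ^+ 2) / z ^+ 2 * F.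
        rewrite mulr_ge0 ?(ltW F0)// divr_ge0 ?sqr_ge0// subr_ge0.
        have := ric z (le_trans ar rz); have := mulr_le0_ge0 lam0 (sqr_ge0 z); lra.
      lra.
    have h2 : F^-1 <= bt1 0 0 z / bt 0 z ^+ 2.
      by rewrite ler_pdivlMr ?exprn_gt0// mulrC.
    have h3 : 2 <= F + F^-1.
      have : F + F^-1 - 2 = (F - 1) ^+ 2 / F by field; rewrite gt_eqF.
      have : 0 <= (F - 1) ^+ 2 / F by rewrite divr_ge0 ?sqr_ge0// ltW.
      lra.
    lra.
have BY : 0 < (bt 0 Y)^-1 by rewrite invr_gt0 Bpos// ltW.
move: H; rewrite /G; rewrite /Y in BY *; lra.
Qed.

(* If the boundary term were negative somewhere, it would be at most [- kap / y^2]
   near 0; then [V^2 / y] grows like [y^-4] and [V^2 rho] like [1 / y], which is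
   not integrable. *)
Lemma left_start e b t : 0 < e -> (forall y, 0 < y -> y <= e -> 7 / 4 <= 2 * cos (2 * f0 y)) ->
  (forall y, 0 < y -> y <= b -> 3 / 4 < 2 * cos (2 * f0 y)) -> 0 < t -> t <= b ->
  left_adm t (1 / 2).
Proof.
move=> e0 Ce Cb t0 tb Bt y y0 yt; apply/eqP/negPn/negP => Vy.
(* At the origin the comparison with the limit value 2 reads h^2 + h < 2, with equality for the
   exponent h = 1 of the regular solution. The choice h = 1/2 gives 3/4 and leaves ample room. *)
have ricE z : riccati (1 / 2) 0 z = 3 / 4 - z ^+ 2 / 4 by rewrite /riccati; field.
have ric a : 0 < a -> forall z, a <= z <= b -> riccati (1 / 2) 0 z < 2 * cos (2 * f0 z).
  move=> a0 z /andP[az zb]; have := Cb z (lt_le_trans a0 az) zb.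
  by rewrite ricE; have := sqr_ge0 z; lra.
have E z : bt (1 / 2 - 0 * z) z = bt (1 / 2) z by rewrite mul0r subr0.
have y20 : 0 < y / 2 by rewrite divr_gt0.
have y2y : y / 2 < y by lra.
have [r [r1 r2 Br]] := piece_strict_left y20 (ric _ y20) y2y (le_trans yt tb) Vy.
have r0 : 0 < r by lra.
have Brn : bt (1 / 2) r < 0.
  have := piece_mono y0 (ric _ y0) (lexx y) yt tb; rewrite !E in Br *; lra.
(* Below r the boundary term is negative, below e the stronger bound 7/4 holds, and below 1 one has
   rho z >= z^2 / 2. *)
pose s := Num.min (Num.min r e) 1.
have s0 : 0 < s by rewrite !lt_min r0 e0 ltr01.
have sr : s <= r by rewrite !ge_min lexx.
have se : s <= e by rewrite !ge_min lexx orbT.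
have s1 : s <= 1 by rewrite ge_min lexx orbT.
have Bneg z : 0 < z -> z <= s -> bt (1 / 2) z < 0.
  move=> z0 zs; have := piece_mono z0 (ric _ z0) (lexx z) (le_trans zs sr) (ltW (lt_le_trans r2
    (le_trans yt tb))).
  by rewrite !E; lra.
pose kap := - (s ^+ 2 * bt (1 / 2) s).
have kap0 : 0 < kap by rewrite oppr_gt0 pmulr_rlt0 ?exprn_gt0// Bneg.
have dB z : 0 < z -> is_derive z 1 (bt (1 / 2)) (bt1 (1 / 2) 0 z).
  by move=> z0; apply: isd_pos z0 (bt_isd (1 / 2) 0 z0) => w _; rewrite E.
have Bk z : 0 < z -> z <= s -> bt (1 / 2) z <= - (kap / z ^+ 2).
  move=> z0 zs.
  (* The product z^2 B is still nondecreasing: differentiating z^2 costs V^2 once the square is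
     completed, and the margin 7/4 - 3/4 = 1 pays for it. *)
  have H : z ^+ 2 * bt (1 / 2) z <= s ^+ 2 * bt (1 / 2) s.
    have d2 w : 0 < w -> is_derive w 1 (fun z => z ^+ 2 * bt (1 / 2) z)
        (2%:R * w ^+ 1 * 1 * bt (1 / 2) w + w ^+ 2 * bt1 (1 / 2) 0 w).
      by move=> w0; exact: isdM (isdX 2 (isd_id w)) (dB w w0).
    have := @isd_nondecr _ _ _ z s zs (fun w zws => d2 w (lt_le_trans z0 (proj1 (andP zws)))).
    apply=> w /andP[/ltW zw /ltW ws] /=; have w0 : 0 < w := lt_le_trans z0 zw.
    have Cw := Ce w w0 (le_trans ws se).
    pose W := V1 w - 1 / 2 / w * V w.
    have -> : 2%:R * w ^+ 1 * 1 * bt (1 / 2) w + w ^+ 2 * bt1 (1 / 2) 0 w =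
       rho w * ((w * W + V w) ^+ 2 + (2 * cos (2 * f0 w) - lam * w ^+ 2 - riccati (1 / 2) 0 w -
         1) * V w ^+ 2).
      by rewrite /bt /bt1 -/W mul0r subr0 -/W; field; rewrite gt_eqF.
    rewrite mulr_ge0 ?rho_ge0// addr_ge0 ?sqr_ge0// mulr_ge0 ?sqr_ge0// ricE.
    by have := mulr_le0_ge0 lam0 (sqr_ge0 w); have := sqr_ge0 w; lra.
  by rewrite -mulNr ler_pdivlMr ?exprn_gt0// mulrC /kap opprK.
have rho_le z : 0 < z -> rho z <= z ^+ 2.
  move=> z0; rewrite /rho ler_piMr ?sqr_ge0// -expR0 ler_expR oppr_le0 divr_ge0 ?sqr_ge0//.
(* The derivative of V^2 / z is exactly 2 B / (z rho), because h = 1/2. With B <= -kap / z^2 and rho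
   <= z^2 it is at most -2 kap / z^5, which is integrated from z to s. *)
have V2 z : 0 < z -> z <= s -> kap / 2 * (z ^- 3 - z * s ^- 4) <= V z ^+ 2.
  move=> z0 zs.
  have dz4 w : 0 < w -> is_derive w 1 (fun z => (z ^+ 4)^-1) (- (4%:R * w ^+ 3 * 1) / (w ^+ 4) ^+
    2).
    by move=> w0; apply: (@isdV _ (fun z => z ^+ 4));
      [rewrite expf_neq0 ?gt_eqF|exact: isdX 4 (isd_id w)].
  have dG w : 0 < w -> is_derive w 1 (fun z => kap / 2 * (z ^+ 4)^-1 - V z ^+ 2 * z^-1)
     (0 * (w ^+ 4)^-1 + kap / 2 * (- (4%:R * w ^+ 3 * 1) / (w ^+ 4) ^+ 2)
      - (2%:R * V w ^+ 1 * V1 w * w^-1 + V w ^+ 2 * (- 1 / w ^+ 2))).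
    move=> w0; have wn : w != 0 by rewrite gt_eqF.
    exact: isdB (isdM (isd_cst (kap / 2) w) (dz4 w w0)) (isdM (isdX 2 (dV w0)) (@isdV _ (fun y =>
      y) w _ wn (isd_id w))).
  have := @isd_nondecr _ _ _ z s zs (fun w zws => dG w (lt_le_trans z0 (proj1 (andP zws)))).
  move=> H; have {}H : kap / 2 * (z ^+ 4)^-1 - V z ^+ 2 * z^-1 <= kap / 2 * (s ^+ 4)^-1 - V s ^+
    2 * s^-1.
    apply: H => w /andP[/ltW zw /ltW ws]; have w0 : 0 < w := lt_le_trans z0 zw.
    have bk := Bk w w0 ws; have rw := rho_le w w0; have rp := rho_gt0 w0.
    have -> : 0 * (w ^+ 4)^-1 + kap / 2 * (- (4%:R * w ^+ 3 * 1) / (w ^+ 4) ^+ 2)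
      - (2%:R * V w ^+ 1 * V1 w * w^-1 + V w ^+ 2 * (- 1 / w ^+ 2)) =
      2 / w * (- (bt (1 / 2) w) / rho w - kap / w ^+ 4).
      by rewrite /bt; field; rewrite !gt_eqF.
    rewrite mulr_ge0 ?divr_ge0 ?(ltW w0)// subr_ge0.
    rewrite ler_pdivlMr//; apply: (@le_trans _ _ (kap / w ^+ 2)); last lra.
    rewrite -mulrA ler_wpM2l ?(ltW kap0)//.
    rewrite mulrC ler_pdivrMr ?exprn_gt0//.
    by rewrite (_ : w ^- 2 * w ^+ 4 = w ^+ 2)//; field; rewrite gt_eqF.
  have s2 : 0 <= V s ^+ 2 * s^-1 by rewrite mulr_ge0 ?sqr_ge0// invr_ge0 ltW.
  have H2 : (kap / 2 * (z ^+ 4)^-1 - kap / 2 * (s ^+ 4)^-1) * z <= (V z ^+ 2 * z^-1) * z.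
    by rewrite ler_wpM2r ?(ltW z0)//; lra.
  rewrite mulfVK ?gt_eqF// in H2; apply: le_trans H2.
  rewrite le_eqVlt; apply/orP; left; apply/eqP.
  by field; rewrite !gt_eqF.
have rho_ge z : 0 < z -> z <= s -> z ^+ 2 / 2 <= rho z.
  move=> z0 zs; rewrite /rho ler_wpM2l ?sqr_ge0//.
  have := expR_ge1Dx (- (z ^+ 2 / 4)); have z1 : z ^+ 2 <= 1 by rewrite exprn_ile1 ?(ltW z0)//; lra.
  lra.
pose I := \int[mu]_(y in D) (V y ^+ 2 * rho y).
have I0 : 0 <= I by apply: Rintegral_ge0 => z /D_pos; exact: V2ge.
(* X is the logarithmic length ln s - ln a of the interval. The lower bound then becomes kap/4 (X -
   1/4) = I + 3 kap / 16, larger than I. *)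
pose X := 4 * I / kap + 1.
pose a := s * expR (- X).
have X0 : 0 < X by rewrite /X ltr_pwDr// divr_ge0 ?mulr_ge0// ltW.
have a0 : 0 < a by rewrite mulr_gt0 ?expR_gt0.
have as_ : a < s by rewrite /a gtr_pMr// -expR0 ltr_expR oppr_lt0.
pose G z : R := kap / 4 * (ln z - z ^+ 4 / (4 * s ^+ 4)).
pose g z : R := kap / 4 * (z^-1 - z ^+ 3 / s ^+ 4).
have H : G s - G a <= I.
  apply: (@int_ge_primitive _ _ G g a s IV V2ge a0 as_).
  - move=> z /andP[az _]; have z0 := lt_le_trans a0 az.
    apply: (is_derive_eq (isdM (isd_cst (kap / 4) z) (isdB (is_derive1_ln z0)
       (isdM (isdX 4 (isd_id z)) (isd_cst (4 * s ^+ 4)^-1 z))))).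
    by rewrite /g /=; field; rewrite !gt_eqF.
  - move=> z /andP[az _]; have z0 := lt_le_trans a0 az; have zn : z != 0 by rewrite gt_eqF.
    exact: isd_cont (isdM (isd_cst (kap / 4) z) (isdB (@isdV _ (fun y => y) z _ zn (isd_id z))
       (isdM (isdX 3 (isd_id z)) (isd_cst (s ^+ 4)^-1 z)))).
  - move=> z /andP[az zs]; have z0 := lt_le_trans a0 az.
    have h := V2 z z0 zs; have h2 := rho_ge z z0 zs.
    have p0 : 0 <= kap / 2 * (z ^- 3 - z * s ^- 4).
      rewrite mulr_ge0 ?divr_ge0 ?(ltW kap0)// subr_ge0 mulrC ler_pdivrMl ?exprn_gt0//.
      rewrite ler_pdivlMr ?exprn_gt0// -exprS lerXn2r ?nnegrE ?(ltW z0) ?(ltW s0)//.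
    apply: (@le_trans _ _ (kap / 2 * (z ^- 3 - z * s ^- 4) * (z ^+ 2 / 2))); last first.
      by apply: ler_pM => //; rewrite divr_ge0 ?sqr_ge0.
    rewrite le_eqVlt; apply/orP; left; apply/eqP; rewrite /g.
    by field; rewrite !gt_eqF.
have lnE : ln s - ln a = X.
  by rewrite /a lnM ?posrE ?expR_gt0// expRK; ring.
have : kap / 4 * (X - 1 / 4) <= G s - G a.
  rewrite (_ : G s - G a = kap / 4 * (X - 1 / 4 + a ^+ 4 / (4 * s ^+ 4))).
    rewrite ler_wpM2l ?divr_ge0 ?(ltW kap0)// lerDl divr_ge0 ?exprn_ge0 ?(ltW a0)//.
    by rewrite mulr_ge0// exprn_ge0// ltW.
  by rewrite -lnE /G; field; rewrite gt_eqF.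
have : kap / 4 * (X - 1 / 4) = I + 3 / 16 * kap by rewrite /X; field; rewrite gt_eqF.
lra.
Qed.

End Sturm.

(** * Numerical bounds on the potential *)

Section Numerics.
Variable R : realType.
Implicit Types (x y z a b s t c h k p : R).

Lemma cheb_pair_cos n t : cheb_pair n (cos t) = (cos (n%:R * t), cos (n.+1%:R * t)).
Proof.
elim: n => [|n IH] /=; first by rewrite mul0r cos0 mul1r.
rewrite IH /=; congr pair.
have -> : cos (n.+2%:R * t) = cos (n.+1%:R * t + t) by congr cos; rewrite -[n.+2%:R]natr1; ring.
have -> : cos (n%:R * t) = cos (n.+1%:R * t - t) by congr cos; rewrite -[n.+1%:R]natr1; ring.
by rewrite [cos (_ - t)]cosB cosD; ring.
Qed.

Lemma chebT_bound n x : -1 <= x <= 1 -> -1 <= chebT n x <= 1.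
Proof.
move=> x1; have <- : cos (acos x) = x by rewrite acosK// in_itv.
by rewrite /chebT cheb_pair_cos /= cos_geN1 cos_le1.
Qed.

Definition Ssum x : R := \sum_(n < 15) nth 0 (f0_coef R) n * chebT (2 * n + 1) x.
Definition S3 x : R := 268245%:R / 72878%:R * x - 3174%:R / 105551%:R * (4 * x ^+ 3 - 3 * x)
  + 1897%:R / 97022%:R * (16 * x ^+ 5 - 20 * x ^+ 3 + 5 * x).

Lemma chebT1 x : chebT 1 x = x. Proof. by []. Qed.
Lemma chebT3 x : chebT 3 x = 4 * x ^+ 3 - 3 * x.
Proof. by rewrite /chebT /=; ring. Qed.
Lemma chebT5 x : chebT 5 x = 16 * x ^+ 5 - 20 * x ^+ 3 + 5 * x.
Proof. by rewrite /chebT /=; ring. Qed.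

Lemma Ssum_expand x : Ssum x = S3 x + (14%:R / 72731%:R * chebT 7 x + (79%:R / 119383%:R * chebT 9 x
  + (4%:R / 66337%:R * chebT 11 x + (5%:R / 109368%:R * chebT 13 x + (1 / 109045%:R * chebT 15 x
  + (1 / 204079%:R * chebT 17 x + (1 / 675805%:R * chebT 19 x + (1 / 1400761%:R * chebT 21 x
  + (1 / 3586839%:R * chebT 23 x + (1 / 7289041%:R * chebT 25 x + (1 / 16940631%:R * chebT 27 x
  + 1 / 59286294%:R * chebT 29 x))))))))))).
Proof.
rewrite /Ssum !big_ord_recl big_ord0 /= addr0 /S3.
rewrite -[in RHS](chebT1 x) -(chebT3 (chebT 1 x)) -(chebT5 (chebT 1 x)) chebT1.
rewrite mulNr -!addrA; congr (_ + (_ + (_ + _))).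
Qed.

(* The coefficients omitted in [S3] add up to less than 1/1000, and [|T_m| <= 1]. *)
Lemma Ssum_approx x : 0 <= x <= 1 -> S3 x - 1 / 1000 <= Ssum x <= S3 x + 1 / 1000.
Proof.
move=> /andP[x0 x1]; rewrite Ssum_expand.
have xx : -1 <= x <= 1 by rewrite x1 andbT; lra.
have B n := chebT_bound n xx.
have /andP[a1 b1] := B 7%N; have /andP[a2 b2] := B 9%N; have /andP[a3 b3] := B 11%N.
have /andP[a4 b4] := B 13%N; have /andP[a5 b5] := B 15%N; have /andP[a6 b6] := B 17%N.
have /andP[a7 b7] := B 19%N; have /andP[a8 b8] := B 21%N; have /andP[a9 b9] := B 23%N.
have /andP[a10 b10] := B 25%N; have /andP[a11 b11] := B 27%N; have /andP[a12 b12] := B 29%N.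
move: (S3 x) (chebT 7 x) (chebT 9 x) (chebT 11 x) (chebT 13 x) (chebT 15 x) (chebT 17 x) (chebT
  19 x) (chebT 21 x) (chebT 23 x) (chebT 25 x) (chebT 27 x) (chebT 29 x) a1 b1 a2 b2 a3 b3 a4 b4
    a5 b5 a6 b6 a7 b7 a8 b8 a9 b9 a10 b10 a11 b11 a12 b12.
move=> T0 T1 T2 T3 T4 T5 T6 T7 T8 T9 T10 T11 T12 *.
by apply/andP; split; lra.
Qed.

Lemma cos_2atan s : cos (2 * atan s) = (1 - s ^+ 2) / (1 + s ^+ 2).
Proof.
have p : 0 < 1 + s ^+ 2 by have := sqr_ge0 s; lra.
rewrite mulr_natl cos_mulr2n cos_atan exprVn sqr_sqrtr ?(ltW p)// -[X in X - 1]mulr_natl.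
by field; rewrite gt_eqF.
Qed.

Lemma cosf_mono s t : s ^+ 2 <= t ^+ 2 -> (1 - t ^+ 2) / (1 + t ^+ 2) <= (1 - s ^+ 2) / (1 + s ^+
  2).
Proof.
have := sqr_ge0 s; have := sqr_ge0 t; set A := s ^+ 2; set B := t ^+ 2 => B0 A0 AB.
by rewrite ler_pdivrMr ?ler_pdivlMr; [rewrite mulrAC ler_pdivlMr|]; nra.
Qed.

(** Inverse of the compactification x = y / sqrt (2 + y^2), through which the profile is evaluated
    at rational x. *)
Definition yx x : R := Num.sqrt (2 * x ^+ 2 / (1 - x ^+ 2)).

Lemma yx_prop x : 0 < x -> x < 1 -> 0 < yx x /\ yx x / Num.sqrt (2 + yx x ^+ 2) = x.
Proof.
move=> x0 x1; have d0 : 0 < 1 - x ^+ 2 by rewrite subr_gt0 expr_lt1// ltW.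
have w0 : 0 < 2 * x ^+ 2 / (1 - x ^+ 2) by rewrite divr_gt0// mulr_gt0// exprn_gt0.
split; first by rewrite sqrtr_gt0.
rewrite sqr_sqrtr ?(ltW w0)// -sqrtrV; last by rewrite addr_ge0// ltW.
rewrite /yx -sqrtrM ?(ltW w0)// (_ : _ / _ = x ^+ 2) ?sqrtr_sqr ?gtr0_norm//.
by field; apply/andP; split; apply: lt0r_neq0; lra.
Qed.

Lemma yx_half : 0 < yx (1 / 2) /\ yx (1 / 2) / Num.sqrt (2 + yx (1 / 2) ^+ 2) = 1 / 2.
Proof. by apply: yx_prop; lra. Qed.

Section WithProfile.
Variable f0 : R -> R.
Hypothesis hn : norm_le (fun y => f0 y - f0_tilde y) (5 / 10000).

(* [p1 >= 1 / sqrt 2] and [sqrt 2 * 5 / 10000 < 1 / 1400]. *)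
Lemma f0_close y : 0 < y -> `|f0 y - f0_tilde y| <= 1 / 1400.
Proof.
move=> y0; have [M1 [M2 [M12 [H1 H2]]]] := hn.
have M20 : 0 <= M2 by apply: le_trans (H2 1 ltr01).
have := H1 y y0; rewrite normrM.
have s2 : 0 < Num.sqrt (2 : R) by rewrite sqrtr_gt0.
have s22 : Num.sqrt (2 : R) ^+ 2 = 2 by rewrite sqr_sqrtr.
have s2u : Num.sqrt (2 : R) <= 142 / 100 by nra.
have sy : y <= Num.sqrt (2 + y ^+ 2).
  rewrite -{1}(gtr0_norm y0) -sqrtr_sqr ler_wsqrtr//; lra.
have pp : 1 <= Num.sqrt 2 * p1 y.
  rewrite /p1 (_ : _ * _ = Num.sqrt (2 + y ^+ 2) / y); last by field; rewrite !gt_eqF.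
  by rewrite ler_pdivlMr// mul1r.
have p10 : 0 < p1 y by rewrite /p1 divr_gt0 ?mulr_gt0// (lt_le_trans y0).
rewrite (gtr0_norm p10); set d := `|_ - _| => H; have d0 : 0 <= d by rewrite normr_ge0.
have h1 : d <= Num.sqrt 2 * (p1 y * d) by rewrite mulrA ler_peMl.
have h2 : Num.sqrt 2 * (p1 y * d) <= 142 / 100 * (5 / 10000).
  have pd : p1 y * d <= 5 / 10000 by apply: (le_trans H); lra.
  by apply: ler_pM => //; rewrite mulr_ge0// ltW.
apply: le_trans h1 _; apply: le_trans h2 _; lra.
Qed.

Lemma f0_tildeE y : f0_tilde y = 2 * atan (Ssum (y / Num.sqrt (2 + y ^+ 2))).
Proof. by []. Qed.

Lemma x_range y : 0 < y -> 0 <= y / Num.sqrt (2 + y ^+ 2) <= 1.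
Proof.
move=> y0.
have sy : y <= Num.sqrt (2 + y ^+ 2).
  rewrite -{1}(gtr0_norm y0) -sqrtr_sqr ler_wsqrtr//; lra.
have s0 := lt_le_trans y0 sy.
by rewrite divr_ge0 ?(ltW y0) ?(ltW s0)//= ler_pdivrMr// mul1r.
Qed.

Lemma Ssum_le4 x : 0 <= x <= 1 -> -4 <= Ssum x <= 4.
Proof.
move=> x01; have /andP[h1 h2] := Ssum_approx x01; move: x01 => /andP[x0 x1].
have x31 : x ^+ 3 <= 1 by rewrite exprn_ile1.
have x51 : x ^+ 5 <= 1 by rewrite exprn_ile1.
have x30 : 0 <= x ^+ 3 by rewrite exprn_ge0.
have x50 : 0 <= x ^+ 5 by rewrite exprn_ge0.
move: h1 h2; rewrite /S3.
have xx : -1 <= x <= 1 by rewrite x1 andbT; lra.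
move: (chebT_bound 3 xx) (chebT_bound 5 xx); rewrite chebT3 chebT5 => /andP[a3 b3] /andP[a5 b5]
  h1 h2.
by move: (4 * x ^+ 3 - 3 * x) (16 * x ^+ 5 - 20 * x ^+ 3 + 5 * x) a3 b3 a5 b5 h1 h2 => A B *;
  apply/andP; split; lra.
Qed.

Lemma cos_f0_ge y : 0 < y -> cos (2 * atan (Ssum (y / Num.sqrt (2 + y ^+ 2)))) - 1 / 1400 <= cos
  (f0 y)
  <= cos (2 * atan (Ssum (y / Num.sqrt (2 + y ^+ 2)))) + 1 / 1400.
Proof.
move=> y0; have := le_trans (cos_lip (f0 y) (f0_tilde y)) (f0_close y0).
by rewrite f0_tildeE ler_norml => /andP[h1 h2]; apply/andP; split; lra.
Qed.

(** The approximate profile stays below pi, so a larger value of f0 would lie within 1/1400 of pi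
    and have cosine close to -1. But |Ssum| <= 4 keeps the cosine of the approximate profile above
    -15/17. *)
Lemma f0_lt_pi y : 0 < y -> f0 y <= pi.
Proof.
move=> y0; rewrite leNgt; apply/negP => fpi.
have := f0_close y0; rewrite f0_tildeE ler_norml => /andP[_ h].
set S := Ssum _ in h.
have ha := atan_ltpi2 S.
have e : `|f0 y - pi| <= 1 / 1400 by rewrite ger0_norm; lra.
have := cos_lip (f0 y - pi) 0; rewrite subr0 cos0 cosB cospi sinpi mulr0 addr0 mulrN1.
move=> /le_trans /(_ e); rewrite ler_norml => /andP[e1 _].
have /andP[c1 _] := cos_f0_ge y0; rewrite -/S cos_2atan in c1.
have /andP[s1 s2] := Ssum_le4 (x_range y0); rewrite -/S in s1 s2.
have S4 : S ^+ 2 <= 4 ^+ 2 by nra.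
have m4 := cosf_mono S4; set Q := (1 - S ^+ 2) / (1 + S ^+ 2) in c1 m4.
have m5 : - (15 / 17) <= Q.
  by rewrite (_ : - (15 / 17) = (1 - 4 ^+ 2) / (1 + 4 ^+ 2))//; field.
lra.
Qed.

Hypothesis hm : forall x y, 0 <= x -> x <= y -> f0 x <= f0 y.
Hypothesis f00 : f0 0 = 0.

Lemma cos_f0_decr y z : 0 < y -> y <= z -> cos (f0 z) <= cos (f0 y).
Proof.
move=> y0 yz; have z0 := lt_le_trans y0 yz.
have fy : 0 <= f0 y by rewrite -f00; apply: hm => //; exact: ltW.
have fyz := hm (ltW y0) yz.
have fz := f0_lt_pi z0.
move: fyz; rewrite le_eqVlt => /predU1P[->//|fyz].
by apply: ltW; rewrite ltr_cos// ?in_itv /=; lra.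
Qed.

(** By monotonicity of cos f0 the single point [yx x] decides; the condition on p places it to the
    right of p. There s dominates |Ssum x|, and k is lowered by the error 1/1400. *)
Lemma cos_lower p x s k : 0 < x -> x < 1 -> p ^+ 2 * (1 - x ^+ 2) <= 2 * x ^+ 2 ->
  S3 x + 1 / 1000 <= s -> - s <= S3 x - 1 / 1000 ->
  (k + 1 / 1400) * (1 + s ^+ 2) <= 1 - s ^+ 2 ->
  forall y, 0 < y -> y <= p -> k <= cos (f0 y).
Proof.
move=> x0 x1 px sx sx' ks y y0 yp.
have [yx0 yxE] := yx_prop x0 x1.
have d0 : 0 < 1 - x ^+ 2 by rewrite subr_gt0 expr_lt1// ltW.
have pyx : p <= yx x.
  have p0 : 0 <= p by rewrite (le_trans _ yp)// ltW.
  rewrite -(ger0_norm p0) -sqrtr_sqr /yx ler_wsqrtr//.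
  by rewrite ler_pdivlMr.
apply: le_trans (cos_f0_decr y0 (le_trans yp pyx)).
have /andP[h _] := cos_f0_ge yx0; apply: le_trans h.
rewrite yxE cos_2atan lerBrDr.
have s10 : 0 < 1 + s ^+ 2 by have := sqr_ge0 s; lra.
rewrite -ler_pdivlMr// in ks; apply: (le_trans ks); apply: cosf_mono.
have /andP[a1 a2] : S3 x - 1 / 1000 <= Ssum x <= S3 x + 1 / 1000 by apply: Ssum_approx;
  rewrite !ltW.
have h1 : Ssum x <= s by lra.
have h2 : - s <= Ssum x by lra.
rewrite -subr_ge0 subr_sqr mulr_ge0//; lra.
Qed.

(** The mirror image beyond the crossing of pi/2: the sample point lies to the left of p, and s
    bounds [Ssum x] from below. *)
Lemma cos_upper p x s k : 0 < x -> x < 1 -> 0 < p -> 2 * x ^+ 2 <= p ^+ 2 * (1 - x ^+ 2) ->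
  0 <= s -> s <= S3 x - 1 / 1000 ->
  1 - s ^+ 2 <= (- k - 1 / 1400) * (1 + s ^+ 2) ->
  forall y, p <= y -> cos (f0 y) <= - k.
Proof.
move=> x0 x1 p0 px s0 sx ks y yp.
have [yx0 yxE] := yx_prop x0 x1.
have d0 : 0 < 1 - x ^+ 2 by rewrite subr_gt0 expr_lt1// ltW.
have pyx : yx x <= p.
  by rewrite -(gtr0_norm p0) -sqrtr_sqr /yx ler_wsqrtr// ler_pdivrMr.
apply: (le_trans (cos_f0_decr yx0 (le_trans pyx yp))).
have /andP[_ h] := cos_f0_ge yx0; apply: (le_trans h).
rewrite yxE cos_2atan -lerBrDr.
have s10 : 0 < 1 + s ^+ 2 by have := sqr_ge0 s; lra.
rewrite -ler_pdivrMr// in ks; apply: le_trans ks; apply: cosf_mono.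
have /andP[a1 a2] : S3 x - 1 / 1000 <= Ssum x <= S3 x + 1 / 1000 by apply: Ssum_approx;
  rewrite !ltW.
have h1 : s <= Ssum x by lra.
by rewrite lerXn2r// nnegrE (le_trans s0).
Qed.

End WithProfile.

(** Fixes the sign of the profile, hence the direction of its monotonicity and its being
    nonconstant. At x = 1/2 the sum is at least 1, so cos (2 atan S) <= 0, whereas f0 <= 0 would
    force the angle 2 atan S below 1/1400 and its cosine near 1. *)
Lemma f0_half_neq0 (f0 : R -> R) : norm_le (fun y => f0 y - f0_tilde y) (5 / 10000) ->
  0 < f0 (yx (1 / 2)).
Proof.
move=> hn; rewrite ltNge; apply/negP => fn.
have [y0 yE] := yx_half.
have := f0_close hn y0; rewrite f0_tildeE yE.
have /andP[a1 _] : S3 (1 / 2) - 1 / 1000 <= Ssum (1 / 2) <= S3 (1 / 2) + 1 / 1000.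
  by apply: Ssum_approx; apply/andP; split; lra.
have S1 : 1 <= Ssum (1 / 2) by apply: le_trans a1; rewrite /S3; lra.
set S := Ssum (1 / 2) in S1 *; rewrite ler_norml => /andP[h _].
have at0 : 0 <= atan S by rewrite -(atan0 R); apply: le_atan; lra.
have e : `|2 * atan S| <= 1 / 1400 by rewrite ger0_norm; lra.
have := cos_lip (2 * atan S) 0; rewrite cos0 subr0 cos_2atan => /le_trans /(_ e).
have S0 : 1 ^+ 2 <= S ^+ 2 by nra.
have m4 := cosf_mono S0; rewrite ler_norml => /andP[h2 _].
set Q := (1 - S ^+ 2) / (1 + S ^+ 2) in h2 m4.
rewrite (_ : (1 - 1 ^+ 2) / (1 + 1 ^+ 2) = 0) in m4; last by rewrite expr1n subrr mul0r.
lra.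
Qed.

End Numerics.

(** * Bounds for the potential and the affine Riccati pieces *)

Section Potential.
Variable R : realType.
Implicit Types (x y z a b s t c h k p : R).

(* The third hypothesis on the coefficients makes [riccati al be] convex on
   [[a, b]], so that checking the endpoints suffices. *)
Lemma riccati_lt al be a b C : 0 < a -> a < b -> 0 <= be -> 0 <= be ^+ 2 - al / 2 + be * a ->
  riccati al be a < C -> riccati al be b < C ->
  forall y, a <= y <= b -> riccati al be y < C.
Proof.
move=> a0 ab be0 conv Ea Eb y /andP[ay yb].
(* Linear interpolation of a cubic with its exact remainder: the last factor is the second divided
   difference at y, a and b. *)
have E : riccati al be y * (b - a) = riccati al be a * (b - y) + riccati al be b * (y - a)
   - (b - a) * ((y - a) * (b - y)) * (be ^+ 2 - al / 2 + be / 2 * (y + a + b)).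
  by rewrite /riccati; field.
have ba : 0 < b - a by rewrite subr_gt0.
rewrite -(ltr_pM2r ba) E.
have h1 : 0 <= (b - a) * ((y - a) * (b - y)) * (be ^+ 2 - al / 2 + be / 2 * (y + a + b)).
  apply: mulr_ge0; first by rewrite !mulr_ge0 ?subr_ge0// ltW.
  have : be / 2 * (a + a) <= be / 2 * (y + a + b) by apply: ler_wpM2l; [lra|lra].
  lra.
have h2 : riccati al be a * (b - y) <= C * (b - y) by rewrite ler_wpM2r ?subr_ge0 ?(ltW Ea).
have h3 : riccati al be b * (y - a) <= C * (y - a) by rewrite ler_wpM2r ?subr_ge0 ?(ltW Eb).
have [ya|ya] := eqVneq y a.
  have h4 : riccati al be a * (b - y) < C * (b - y) by rewrite ltr_pM2r// ya.
  have : C * (b - a) = C * (b - y) + C * (y - a) by ring.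
  lra.
have h4 : riccati al be b * (y - a) < C * (y - a).
  by rewrite ltr_pM2r// subr_gt0 lt_neqAle eq_sym ya.
have : C * (b - a) = C * (b - y) + C * (y - a) by ring.
lra.
Qed.

Lemma cos_double t : 2 * cos (2 * t) = 4 * cos t ^+ 2 - 2.
Proof. by rewrite [2 * t]mulr_natl cos_mulr2n; ring. Qed.

Lemma cos_double_ge t k : 0 <= k -> k <= cos t \/ cos t <= - k -> 4 * k ^+ 2 - 2 <= 2 * cos (2 * t).
Proof.
move=> k0 H; rewrite cos_double lerD2r ler_pM2l// -[leRHS]real_normK ?num_real//.
rewrite lerXn2r ?nnegrE//; case: H => H; first by apply: le_trans H (ler_norm _).
by rewrite -normrN; apply: le_trans (ler_norm _); lra.
Qed.

Variables (f0 : R -> R).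
Hypothesis hn : norm_le (fun y => f0 y - f0_tilde y) (5 / 10000).
Hypothesis hm : forall x y, 0 <= x -> x <= y -> f0 x <= f0 y.
Hypothesis f00 : f0 0 = 0.
Notation C y := (2 * cos (2 * f0 y)).

Lemma pot_lower p x s k : 0 < x -> x < 1 -> p ^+ 2 * (1 - x ^+ 2) <= 2 * x ^+ 2 ->
  S3 x + 1 / 1000 <= s -> - s <= S3 x - 1 / 1000 ->
  (k + 1 / 1400) * (1 + s ^+ 2) <= 1 - s ^+ 2 -> 0 <= k ->
  forall y, 0 < y -> y <= p -> 4 * k ^+ 2 - 2 <= C y.
Proof.
move=> x0 x1 px sx sx' ks k0 y y0 yp; apply: cos_double_ge => //; left.
exact: (cos_lower hn hm f00 x0 x1 px sx sx' ks y0 yp).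
Qed.

Lemma pot_upper p x s k : 0 < x -> x < 1 -> 0 < p -> 2 * x ^+ 2 <= p ^+ 2 * (1 - x ^+ 2) ->
  0 <= s -> s <= S3 x - 1 / 1000 ->
  1 - s ^+ 2 <= (- k - 1 / 1400) * (1 + s ^+ 2) -> 0 <= k ->
  forall y, p <= y -> 4 * k ^+ 2 - 2 <= C y.
Proof.
move=> x0 x1 p0 px s0 sx ks k0 y yp; apply: cos_double_ge => //; right.
exact: (cos_upper hn hm f00 x0 x1 p0 px s0 sx ks yp).
Qed.

(** Serves the pieces between 6/25 and 9/20. There f0 passes through pi/2 and the value -2 is
    attained, so no better uniform constant exists. *)
Lemma pot_trivial y : - 2 <= C y.
Proof. by have := cos_geN1 (2 * f0 y); lra. Qed.

(* In the applications of [pot_lower] and [pot_upper] below, [x] rounds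
   [p / sqrt (2 + p^2)], [s] rounds [S3 x +- 1 / 1000] and [k] rounds
   [+- (1 - s^2) / (1 + s^2) - 1 / 1400], each in the safe direction. *)
Lemma pot_l4 y : 0 < y -> y <= 1%:R / 25%:R -> 4 * (9751%:R / 10000%:R) ^+ 2 - 2 <= C y.
Proof.
apply: (@pot_lower (1%:R / 25%:R) (283%:R / 10000%:R) (221%:R / 2000%:R) (9751%:R / 10000%:R));
  rewrite /S3; lra.
Qed.

Lemma pot_l10 y : 0 < y -> y <= 1%:R / 10%:R -> 4 * (2149%:R / 2500%:R) ^+ 2 - 2 <= C y.
Proof.
apply: (@pot_lower (1%:R / 10%:R) (353%:R / 5000%:R) (137%:R / 500%:R) (2149%:R / 2500%:R));
  rewrite /S3; lra.
Qed.

Lemma pot_l15 y : 0 < y -> y <= 3%:R / 20%:R -> 4 * (7131%:R / 10000%:R) ^+ 2 - 2 <= C y.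
Proof.
apply: (@pot_lower (3%:R / 20%:R) (211%:R / 2000%:R) (2043%:R / 5000%:R) (7131%:R / 10000%:R));
  rewrite /S3; lra.
Qed.

Lemma pot_l19 y : 0 < y -> y <= 19%:R / 100%:R -> 4 * (5797%:R / 10000%:R) ^+ 2 - 2 <= C y.
Proof.
apply: (@pot_lower (19%:R / 100%:R) (333%:R / 2500%:R) (322%:R / 625%:R) (5797%:R / 10000%:R));
  rewrite /S3; lra.
Qed.

Lemma pot_l24 y : 0 < y -> y <= 6%:R / 25%:R -> 4 * (41%:R / 100%:R) ^+ 2 - 2 <= C y.
Proof.
apply: (@pot_lower (6%:R / 25%:R) (837%:R / 5000%:R) (6463%:R / 10000%:R) (41%:R / 100%:R));
  rewrite /S3; lra.
Qed.

Lemma pot_u45 y : 9%:R / 20%:R <= y -> 4 * (1453%:R / 10000%:R) ^+ 2 - 2 <= C y.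
Proof.
apply: (@pot_upper (9%:R / 20%:R) (379%:R / 1250%:R) (2317%:R / 2000%:R) (1453%:R / 10000%:R));
  rewrite /S3; lra.
Qed.

Lemma pot_u51 y : 51%:R / 100%:R <= y -> 4 * (501%:R / 2000%:R) ^+ 2 - 2 <= C y.
Proof.
apply: (@pot_upper (51%:R / 100%:R) (212%:R / 625%:R) (12927%:R / 10000%:R) (501%:R / 2000%:R));
  rewrite /S3; lra.
Qed.

Lemma pot_u55 y : 11%:R / 20%:R <= y -> 4 * (3097%:R / 10000%:R) ^+ 2 - 2 <= C y.
Proof.
apply: (@pot_upper (11%:R / 20%:R) (453%:R / 1250%:R) (6893%:R / 5000%:R) (3097%:R / 10000%:R));
  rewrite /S3; lra.
Qed.

Lemma pot_u61 y : 61%:R / 100%:R <= y -> 4 * (963%:R / 2500%:R) ^+ 2 - 2 <= C y.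
Proof.
apply: (@pot_upper (61%:R / 100%:R) (99%:R / 250%:R) (15023%:R / 10000%:R) (963%:R / 2500%:R));
  rewrite /S3; lra.
Qed.

Lemma pot_u68 y : 17%:R / 25%:R <= y -> 4 * (1141%:R / 2500%:R) ^+ 2 - 2 <= C y.
Proof.
apply: (@pot_upper (17%:R / 25%:R) (4333%:R / 10000%:R) (1024%:R / 625%:R) (1141%:R / 2500%:R));
  rewrite /S3; lra.
Qed.

Lemma pot_u78 y : 39%:R / 50%:R <= y -> 4 * (2673%:R / 5000%:R) ^+ 2 - 2 <= C y.
Proof.
apply: (@pot_upper (39%:R / 50%:R) (4829%:R / 10000%:R) (9089%:R / 5000%:R) (2673%:R / 5000%:R));
  rewrite /S3; lra.
Qed.

Lemma pot_u91 y : 91%:R / 100%:R <= y -> 4 * (3037%:R / 5000%:R) ^+ 2 - 2 <= C y.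
Proof.
apply: (@pot_upper (91%:R / 100%:R) (5411%:R / 10000%:R) (10129%:R / 5000%:R) (3037%:R /
  5000%:R)); rewrite /S3; lra.
Qed.

Lemma pot_u108 y : 27%:R / 25%:R <= y -> 4 * (3357%:R / 5000%:R) ^+ 2 - 2 <= C y.
Proof.
apply: (@pot_upper (27%:R / 25%:R) (6069%:R / 10000%:R) (22583%:R / 10000%:R) (3357%:R /
  5000%:R)); rewrite /S3; lra.
Qed.

Lemma pot_u130 y : 13%:R / 10%:R <= y -> 4 * (7239%:R / 10000%:R) ^+ 2 - 2 <= C y.
Proof.
apply: (@pot_upper (13%:R / 10%:R) (6767%:R / 10000%:R) (25029%:R / 10000%:R) (7239%:R /
  10000%:R)); rewrite /S3; lra.
Qed.

(* The pieces were found greedily from the value 1/2 at 1/10 rightwards and from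
   0 at 13/10 leftwards; [h] is continuous across the nodes. *)
Lemma riccati_l10 y : 1%:R / 10%:R <= y <= 3%:R / 20%:R ->
  riccati (152%:R / 125%:R) (179%:R / 25%:R) y < C y.
Proof.
move=> /andP[ay yb]; apply: (@lt_le_trans _ _ (4 * (7131%:R / 10000%:R) ^+ 2 - 2));
  last by apply: pot_l15; lra.
apply: (@riccati_lt (152%:R / 125%:R) (179%:R / 25%:R) (1%:R / 10%:R) (3%:R / 20%:R));
  last by rewrite ay yb.
all: rewrite ?/riccati; lra.
Qed.

Lemma riccati_l15 y : 3%:R / 20%:R <= y <= 19%:R / 100%:R ->
  riccati (3853%:R / 4000%:R) (219%:R / 40%:R) y < C y.
Proof.
move=> /andP[ay yb]; apply: (@lt_le_trans _ _ (4 * (5797%:R / 10000%:R) ^+ 2 - 2));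
  last by apply: pot_l19; lra.
apply: (@riccati_lt (3853%:R / 4000%:R) (219%:R / 40%:R) (3%:R / 20%:R) (19%:R / 100%:R));
  last by rewrite ay yb.
all: rewrite ?/riccati; lra.
Qed.

Lemma riccati_l19 y : 19%:R / 100%:R <= y <= 6%:R / 25%:R ->
  riccati (5923%:R / 5000%:R) (166%:R / 25%:R) y < C y.
Proof.
move=> /andP[ay yb]; apply: (@lt_le_trans _ _ (4 * (41%:R / 100%:R) ^+ 2 - 2));
  last by apply: pot_l24; lra.
apply: (@riccati_lt (5923%:R / 5000%:R) (166%:R / 25%:R) (19%:R / 100%:R) (6%:R / 25%:R));
  last by rewrite ay yb.
all: rewrite ?/riccati; lra.
Qed.

Lemma riccati_l24 y : 6%:R / 25%:R <= y <= 19%:R / 50%:R ->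
  riccati (1909%:R / 1400%:R) (517%:R / 70%:R) y < C y.
Proof.
move=> /andP[ay yb]; apply: (@lt_le_trans _ _ (- 2)); last by exact: pot_trivial.
apply: (@riccati_lt (1909%:R / 1400%:R) (517%:R / 70%:R) (6%:R / 25%:R) (19%:R / 50%:R));
  last by rewrite ay yb.
all: rewrite ?/riccati; lra.
Qed.

Lemma riccati_l38 y : 19%:R / 50%:R <= y <= 9%:R / 20%:R ->
  riccati (3733%:R / 1400%:R) (757%:R / 70%:R) y < C y.
Proof.
move=> /andP[ay yb]; apply: (@lt_le_trans _ _ (- 2)); last by exact: pot_trivial.
apply: (@riccati_lt (3733%:R / 1400%:R) (757%:R / 70%:R) (19%:R / 50%:R) (9%:R / 20%:R));
  last by rewrite ay yb.
all: rewrite ?/riccati; lra.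
Qed.

Lemma riccati_l45 y : 9%:R / 20%:R <= y <= 51%:R / 100%:R ->
  riccati (779%:R / 100%:R) (111%:R / 5%:R) y < C y.
Proof.
move=> /andP[ay yb]; apply: (@lt_le_trans _ _ (4 * (1453%:R / 10000%:R) ^+ 2 - 2));
  last by exact: pot_u45.
apply: (@riccati_lt (779%:R / 100%:R) (111%:R / 5%:R) (9%:R / 20%:R) (51%:R / 100%:R));
  last by rewrite ay yb.
all: rewrite ?/riccati; lra.
Qed.

Lemma riccati_r108 y : 27%:R / 25%:R <= y <= 13%:R / 10%:R ->
  riccati (117%:R / 440%:R) (9%:R / 44%:R) y < C y.
Proof.
move=> /andP[ay yb]; apply: (@lt_le_trans _ _ (4 * (3357%:R / 5000%:R) ^+ 2 - 2));
  last by exact: pot_u108.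
apply: (@riccati_lt (117%:R / 440%:R) (9%:R / 44%:R) (27%:R / 25%:R) (13%:R / 10%:R));
  last by rewrite ay yb.
all: rewrite ?/riccati; lra.
Qed.

Lemma riccati_r91 y : 91%:R / 100%:R <= y <= 27%:R / 25%:R ->
  riccati (13941%:R / 17000%:R) (61%:R / 85%:R) y < C y.
Proof.
move=> /andP[ay yb]; apply: (@lt_le_trans _ _ (4 * (3037%:R / 5000%:R) ^+ 2 - 2));
  last by exact: pot_u91.
apply: (@riccati_lt (13941%:R / 17000%:R) (61%:R / 85%:R) (91%:R / 100%:R) (27%:R / 25%:R));
  last by rewrite ay yb.
all: rewrite ?/riccati; lra.
Qed.

Lemma riccati_r78 y : 39%:R / 50%:R <= y <= 91%:R / 100%:R ->
  riccati (411%:R / 250%:R) (211%:R / 130%:R) y < C y.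
Proof.
move=> /andP[ay yb]; apply: (@lt_le_trans _ _ (4 * (2673%:R / 5000%:R) ^+ 2 - 2));
  last by exact: pot_u78.
apply: (@riccati_lt (411%:R / 250%:R) (211%:R / 130%:R) (39%:R / 50%:R) (91%:R / 100%:R));
  last by rewrite ay yb.
all: rewrite ?/riccati; lra.
Qed.

Lemma riccati_r68 y : 17%:R / 25%:R <= y <= 39%:R / 50%:R ->
  riccati (7263%:R / 2500%:R) (81%:R / 25%:R) y < C y.
Proof.
move=> /andP[ay yb]; apply: (@lt_le_trans _ _ (4 * (1141%:R / 2500%:R) ^+ 2 - 2));
  last by exact: pot_u68.
apply: (@riccati_lt (7263%:R / 2500%:R) (81%:R / 25%:R) (17%:R / 25%:R) (39%:R / 50%:R));
  last by rewrite ay yb.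
all: rewrite ?/riccati; lra.
Qed.

Lemma riccati_r61 y : 61%:R / 100%:R <= y <= 17%:R / 25%:R ->
  riccati (3259%:R / 700%:R) (407%:R / 70%:R) y < C y.
Proof.
move=> /andP[ay yb]; apply: (@lt_le_trans _ _ (4 * (963%:R / 2500%:R) ^+ 2 - 2));
  last by exact: pot_u61.
apply: (@riccati_lt (3259%:R / 700%:R) (407%:R / 70%:R) (61%:R / 100%:R) (17%:R / 25%:R));
  last by rewrite ay yb.
all: rewrite ?/riccati; lra.
Qed.

Lemma riccati_r55 y : 11%:R / 20%:R <= y <= 61%:R / 100%:R ->
  riccati (49537%:R / 6000%:R) (703%:R / 60%:R) y < C y.
Proof.
move=> /andP[ay yb]; apply: (@lt_le_trans _ _ (4 * (3097%:R / 10000%:R) ^+ 2 - 2));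
  last by exact: pot_u55.
apply: (@riccati_lt (49537%:R / 6000%:R) (703%:R / 60%:R) (11%:R / 20%:R) (61%:R / 100%:R));
  last by rewrite ay yb.
all: rewrite ?/riccati; lra.
Qed.

Lemma riccati_r51 y : 51%:R / 100%:R <= y <= 11%:R / 20%:R ->
  riccati (56693%:R / 4000%:R) (899%:R / 40%:R) y < C y.
Proof.
move=> /andP[ay yb]; apply: (@lt_le_trans _ _ (4 * (501%:R / 2000%:R) ^+ 2 - 2));
  last by exact: pot_u51.
apply: (@riccati_lt (56693%:R / 4000%:R) (899%:R / 40%:R) (51%:R / 100%:R) (11%:R / 20%:R));
  last by rewrite ay yb.
all: rewrite ?/riccati; lra.
Qed.

End Potential.

(** * Propagation of admissibility from the two ends towards 51/100 *)

Section Chain.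
Variable R : realType.
Implicit Types (x y z a b s t c h k p : R).
Variables (f0 : R -> R).
Hypothesis hn : norm_le (fun y => f0 y - f0_tilde y) (5 / 10000).
Hypothesis hm : forall x y, 0 <= x -> x <= y -> f0 x <= f0 y.
Hypothesis f00 : f0 0 = 0.
Variables (V V1 : R -> R) (lam : R).
Hypothesis sf0 : smooth_pos f0.
Hypothesis dV : forall y, 0 < y -> is_derive y 1 V (V1 y).
Hypothesis dV1 : forall y, 0 < y ->
  is_derive y 1 V1 ((pot f0 y - lam) * V y - (2 / y - y / 2) * V1 y).
Hypothesis lam0 : lam <= 0.
Hypothesis LV : L2rho V.
Notation left_adm := (left_adm V V1).
Notation right_adm := (right_adm V V1).

Lemma left_small t : 0 < t -> t <= 1%:R / 10%:R -> left_adm t (1 / 2).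
Proof.
have e0 : 0 < 1%:R / 25%:R :> R by lra.
move=> t0 tb; apply: (left_start dV dV1 lam0 LV e0 _ _ t0 tb) => y y0 yp.
  by have := pot_l4 hn hm f00 y0 yp; lra.
by have := pot_l10 hn hm f00 y0 yp; lra.
Qed.

Lemma left_node10 : left_adm (1%:R / 10%:R) (152%:R / 125%:R - 179%:R / 25%:R * (1%:R / 10%:R)).
Proof.
rewrite (_ : _ - _ = 1 / 2); last by field.
by apply: left_small; lra.
Qed.

Lemma left_piece10 s : 1%:R / 10%:R <= s <= 3%:R / 20%:R ->
  left_adm s (152%:R / 125%:R - 179%:R / 25%:R * s).
Proof.
have p : 0 < 1%:R / 10%:R :> R by lra.
exact: (left_step dV dV1 lam0 p (riccati_l10 hn hm f00) left_node10).
Qed.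

Lemma left_node15 : left_adm (3%:R / 20%:R) (3853%:R / 4000%:R - 219%:R / 40%:R * (3%:R / 20%:R)).
Proof.
rewrite (_ : _ - _ = 152%:R / 125%:R - 179%:R / 25%:R * (3%:R / 20%:R)); last by field.
by apply: left_piece10; apply/andP; split; lra.
Qed.

Lemma left_piece15 s : 3%:R / 20%:R <= s <= 19%:R / 100%:R ->
  left_adm s (3853%:R / 4000%:R - 219%:R / 40%:R * s).
Proof.
have p : 0 < 3%:R / 20%:R :> R by lra.
exact: (left_step dV dV1 lam0 p (riccati_l15 hn hm f00) left_node15).
Qed.

Lemma left_node19 : left_adm (19%:R / 100%:R) (5923%:R / 5000%:R - 166%:R / 25%:R * (19%:R /
  100%:R)).
Proof.
rewrite (_ : _ - _ = 3853%:R / 4000%:R - 219%:R / 40%:R * (19%:R / 100%:R)); last by field.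
by apply: left_piece15; apply/andP; split; lra.
Qed.

Lemma left_piece19 s : 19%:R / 100%:R <= s <= 6%:R / 25%:R ->
  left_adm s (5923%:R / 5000%:R - 166%:R / 25%:R * s).
Proof.
have p : 0 < 19%:R / 100%:R :> R by lra.
exact: (left_step dV dV1 lam0 p (riccati_l19 hn hm f00) left_node19).
Qed.

Lemma left_node24 : left_adm (6%:R / 25%:R) (1909%:R / 1400%:R - 517%:R / 70%:R * (6%:R / 25%:R)).
Proof.
rewrite (_ : _ - _ = 5923%:R / 5000%:R - 166%:R / 25%:R * (6%:R / 25%:R)); last by field.
by apply: left_piece19; apply/andP; split; lra.
Qed.

Lemma left_piece24 s : 6%:R / 25%:R <= s <= 19%:R / 50%:R ->
  left_adm s (1909%:R / 1400%:R - 517%:R / 70%:R * s).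
Proof.
have p : 0 < 6%:R / 25%:R :> R by lra.
exact: (left_step dV dV1 lam0 p (riccati_l24 f0) left_node24).
Qed.

Lemma left_node38 : left_adm (19%:R / 50%:R) (3733%:R / 1400%:R - 757%:R / 70%:R * (19%:R / 50%:R)).
Proof.
rewrite (_ : _ - _ = 1909%:R / 1400%:R - 517%:R / 70%:R * (19%:R / 50%:R)); last by field.
by apply: left_piece24; apply/andP; split; lra.
Qed.

Lemma left_piece38 s : 19%:R / 50%:R <= s <= 9%:R / 20%:R ->
  left_adm s (3733%:R / 1400%:R - 757%:R / 70%:R * s).
Proof.
have p : 0 < 19%:R / 50%:R :> R by lra.
exact: (left_step dV dV1 lam0 p (riccati_l38 f0) left_node38).
Qed.

Lemma left_node45 : left_adm (9%:R / 20%:R) (779%:R / 100%:R - 111%:R / 5%:R * (9%:R / 20%:R)).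
Proof.
rewrite (_ : _ - _ = 3733%:R / 1400%:R - 757%:R / 70%:R * (9%:R / 20%:R)); last by field.
by apply: left_piece38; apply/andP; split; lra.
Qed.

Lemma left_piece45 s : 9%:R / 20%:R <= s <= 51%:R / 100%:R ->
  left_adm s (779%:R / 100%:R - 111%:R / 5%:R * s).
Proof.
have p : 0 < 9%:R / 20%:R :> R by lra.
exact: (left_step dV dV1 lam0 p (riccati_l45 hn hm f00) left_node45).
Qed.

(** The value h can remain existential: the result is applied at a zero of V, where the boundary
    term is 0 for every h. *)
Lemma left_all t : 0 < t -> t <= 51%:R / 100%:R -> exists h, left_adm t h.
Proof.
move=> t0 tb.
have [t1|/ltW t1] := leP t (1%:R / 10%:R); first by exists (1 / 2); exact: left_small.
have [t2|/ltW {}t1] := leP t (3%:R / 20%:R); first by exists (152%:R / 125%:R - 179%:R / 25%:R *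
  t); apply: left_piece10; rewrite t1.
have [t2|/ltW {}t1] := leP t (19%:R / 100%:R); first by exists (3853%:R / 4000%:R - 219%:R /
  40%:R * t); apply: left_piece15; rewrite t1.
have [t2|/ltW {}t1] := leP t (6%:R / 25%:R); first by exists (5923%:R / 5000%:R - 166%:R / 25%:R
  * t); apply: left_piece19; rewrite t1.
have [t2|/ltW {}t1] := leP t (19%:R / 50%:R); first by exists (1909%:R / 1400%:R - 517%:R / 70%:R
  * t); apply: left_piece24; rewrite t1.
have [t2|/ltW {}t1] := leP t (9%:R / 20%:R); first by exists (3733%:R / 1400%:R - 757%:R / 70%:R
  * t); apply: left_piece38; rewrite t1.
by exists (779%:R / 100%:R - 111%:R / 5%:R * t); apply: left_piece45; rewrite t1.
Qed.

Lemma right_large t : 13%:R / 10%:R <= t -> right_adm t 0.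
Proof.
have e0 : 0 < 13%:R / 10%:R :> R by lra.
move=> t1; apply: (right_end sf0 dV dV1 lam0 LV e0 _ t1) => y yp.
by have := pot_u130 hn hm f00 yp; lra.
Qed.

Lemma right_node130 : right_adm (13%:R / 10%:R) (117%:R / 440%:R - 9%:R / 44%:R * (13%:R / 10%:R)).
Proof.
rewrite (_ : _ - _ = 0); last by field.
by apply: right_large; lra.
Qed.

Lemma right_piece130 s : 27%:R / 25%:R <= s <= 13%:R / 10%:R ->
  right_adm s (117%:R / 440%:R - 9%:R / 44%:R * s).
Proof.
have p : 0 < 27%:R / 25%:R :> R by lra.
exact: (right_step dV dV1 lam0 p (riccati_r108 hn hm f00) right_node130).
Qed.

Lemma right_node108 : right_adm (27%:R / 25%:R) (13941%:R / 17000%:R - 61%:R / 85%:R * (27%:R /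
  25%:R)).
Proof.
rewrite (_ : _ - _ = 117%:R / 440%:R - 9%:R / 44%:R * (27%:R / 25%:R)); last by field.
by apply: right_piece130; apply/andP; split; lra.
Qed.

Lemma right_piece108 s : 91%:R / 100%:R <= s <= 27%:R / 25%:R ->
  right_adm s (13941%:R / 17000%:R - 61%:R / 85%:R * s).
Proof.
have p : 0 < 91%:R / 100%:R :> R by lra.
exact: (right_step dV dV1 lam0 p (riccati_r91 hn hm f00) right_node108).
Qed.

Lemma right_node91 : right_adm (91%:R / 100%:R) (411%:R / 250%:R - 211%:R / 130%:R * (91%:R /
  100%:R)).
Proof.
rewrite (_ : _ - _ = 13941%:R / 17000%:R - 61%:R / 85%:R * (91%:R / 100%:R)); last by field.
by apply: right_piece108; apply/andP; split; lra.
Qed.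

Lemma right_piece91 s : 39%:R / 50%:R <= s <= 91%:R / 100%:R ->
  right_adm s (411%:R / 250%:R - 211%:R / 130%:R * s).
Proof.
have p : 0 < 39%:R / 50%:R :> R by lra.
exact: (right_step dV dV1 lam0 p (riccati_r78 hn hm f00) right_node91).
Qed.

Lemma right_node78 : right_adm (39%:R / 50%:R) (7263%:R / 2500%:R - 81%:R / 25%:R * (39%:R /
  50%:R)).
Proof.
rewrite (_ : _ - _ = 411%:R / 250%:R - 211%:R / 130%:R * (39%:R / 50%:R)); last by field.
by apply: right_piece91; apply/andP; split; lra.
Qed.

Lemma right_piece78 s : 17%:R / 25%:R <= s <= 39%:R / 50%:R ->
  right_adm s (7263%:R / 2500%:R - 81%:R / 25%:R * s).
Proof.
have p : 0 < 17%:R / 25%:R :> R by lra.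
exact: (right_step dV dV1 lam0 p (riccati_r68 hn hm f00) right_node78).
Qed.

Lemma right_node68 : right_adm (17%:R / 25%:R) (3259%:R / 700%:R - 407%:R / 70%:R * (17%:R /
  25%:R)).
Proof.
rewrite (_ : _ - _ = 7263%:R / 2500%:R - 81%:R / 25%:R * (17%:R / 25%:R)); last by field.
by apply: right_piece78; apply/andP; split; lra.
Qed.

Lemma right_piece68 s : 61%:R / 100%:R <= s <= 17%:R / 25%:R ->
  right_adm s (3259%:R / 700%:R - 407%:R / 70%:R * s).
Proof.
have p : 0 < 61%:R / 100%:R :> R by lra.
exact: (right_step dV dV1 lam0 p (riccati_r61 hn hm f00) right_node68).
Qed.

Lemma right_node61 : right_adm (61%:R / 100%:R) (49537%:R / 6000%:R - 703%:R / 60%:R * (61%:R /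
  100%:R)).
Proof.
rewrite (_ : _ - _ = 3259%:R / 700%:R - 407%:R / 70%:R * (61%:R / 100%:R)); last by field.
by apply: right_piece68; apply/andP; split; lra.
Qed.

Lemma right_piece61 s : 11%:R / 20%:R <= s <= 61%:R / 100%:R ->
  right_adm s (49537%:R / 6000%:R - 703%:R / 60%:R * s).
Proof.
have p : 0 < 11%:R / 20%:R :> R by lra.
exact: (right_step dV dV1 lam0 p (riccati_r55 hn hm f00) right_node61).
Qed.

Lemma right_node55 : right_adm (11%:R / 20%:R) (56693%:R / 4000%:R - 899%:R / 40%:R * (11%:R /
  20%:R)).
Proof.
rewrite (_ : _ - _ = 49537%:R / 6000%:R - 703%:R / 60%:R * (11%:R / 20%:R)); last by field.
by apply: right_piece61; apply/andP; split; lra.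
Qed.

Lemma right_piece55 s : 51%:R / 100%:R <= s <= 11%:R / 20%:R ->
  right_adm s (56693%:R / 4000%:R - 899%:R / 40%:R * s).
Proof.
have p : 0 < 51%:R / 100%:R :> R by lra.
exact: (right_step dV dV1 lam0 p (riccati_r51 hn hm f00) right_node55).
Qed.

Lemma right_all t : 51%:R / 100%:R <= t -> exists h, right_adm t h.
Proof.
move=> tb.
have [t0|/ltW t1] := leP (13%:R / 10%:R) t; first by exists 0; exact: right_large.
have [t2|/ltW t2] := leP (27%:R / 25%:R) t; first by exists (117%:R / 440%:R - 9%:R / 44%:R * t);
  apply: right_piece130; rewrite t2.
move: t2 => {}t1.
have [t2|/ltW t2] := leP (91%:R / 100%:R) t; first by exists (13941%:R / 17000%:R - 61%:R / 85%:R
  * t); apply: right_piece108; rewrite t2.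
move: t2 => {}t1.
have [t2|/ltW t2] := leP (39%:R / 50%:R) t; first by exists (411%:R / 250%:R - 211%:R / 130%:R *
  t); apply: right_piece91; rewrite t2.
move: t2 => {}t1.
have [t2|/ltW t2] := leP (17%:R / 25%:R) t; first by exists (7263%:R / 2500%:R - 81%:R / 25%:R *
  t); apply: right_piece78; rewrite t2.
move: t2 => {}t1.
have [t2|/ltW t2] := leP (61%:R / 100%:R) t; first by exists (3259%:R / 700%:R - 407%:R / 70%:R *
  t); apply: right_piece68; rewrite t2.
move: t2 => {}t1.
have [t2|/ltW t2] := leP (11%:R / 20%:R) t; first by exists (49537%:R / 6000%:R - 703%:R / 60%:R
  * t); apply: right_piece61; rewrite t2.
move: t2 => {}t1.
by exists (56693%:R / 4000%:R - 899%:R / 40%:R * t); apply: right_piece55; rewrite tb.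
Qed.

End Chain.

(** * The eigenvalue -1 *)

Section Sign.
Variable R : realType.
Implicit Types (x y z : R) (u v V : R -> R).
Notation mu := (@lebesgue_measure R).
Notation D := (@halfline R).

Lemma not_orthogonal_pos u V : (forall y, 0 < y -> 0 < u y) -> (forall y, 0 < y -> 0 <= V y) ->
  (forall y, 0 < y -> {for y, continuous u}) -> (forall y, 0 < y -> {for y, continuous V}) ->
  L2rho u -> L2rho V -> ip u V = 0 -> forall y, 0 < y -> V y = 0.
Proof.
move=> u0 V0 cu cV Lu LV uV y y0; apply/eqP/negPn/negP => Vy.
suff : 0 < ip u V by rewrite uV ltxx.
apply: (@int_gt0 _ _ y (L2_prod Lu LV)) => //.
- by move=> z z0; rewrite mulr_ge0 ?rho_ge0// mulr_ge0 ?V0// ltW ?u0.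
- by rewrite mulr_gt0 ?rho_gt0// mulr_gt0 ?u0// lt_neqAle eq_sym Vy V0.
- by apply: continuousM; [apply: continuousM; [exact: cu|exact: cV]|exact: isd_cont (rho_isd y0)].
Qed.

Lemma ip_ae u v V : {ae mu, forall y, D y -> v y = V y} -> L2rho u -> L2rho v -> L2rho V ->
  ip u v = ip u V.
Proof.
move=> vV Lu Lv LV; rewrite /ip; congr fine.
apply: ae_eq_integral => //; first exact: measurable_D.
- exact: measurable_int (L2_prod Lu Lv).
- exact: measurable_int (L2_prod Lu LV).
- have vV' := vV; apply: filterS vV'; first exact: (ae_filter_ringOfSetsType mu). by move=> y E
  Dy; rewrite E.
Qed.

Lemma ipZ c u V : L2rho u -> L2rho V -> ip u (fun y => c * V y) = c * ip u V.
Proof.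
move=> Lu LV; rewrite /ip.
have := RintegralZl c (@measurable_D R) (L2_prod Lu LV).
rewrite /Rintegral => <-; congr fine; apply: eq_integral => y _.
by congr EFin; ring.
Qed.

Lemma ipN u V : L2rho u -> L2rho V -> ip u (fun y => - V y) = - ip u V.
Proof.
move=> Lu LV; rewrite -mulN1r -ipZ//; congr ip.
by apply/funext => y; rewrite mulN1r.
Qed.

Lemma sign_change_zero V x y : (forall z, 0 < z -> {for z, continuous V}) -> 0 < x -> 0 < y ->
  V x < 0 -> 0 < V y -> exists c, [/\ 0 < c, V c = 0 & Num.min x y <= c <= Num.max x y].
Proof.
move=> cV x0 y0 Vx Vy.
have m0 : 0 < Num.min x y by rewrite lt_min x0.
have mM : Num.min x y <= Num.max x y by rewrite ge_min le_max lexx.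
have [||c] := @IVT R V (Num.min x y) (Num.max x y) 0 mM.
- apply: continuous_in_subspaceT => z; rewrite inE /= in_itv /= => /andP[mz _].
  exact: cV (lt_le_trans m0 mz).
- have Vxy : V x <= V y by rewrite ltW// (lt_trans Vx).
  have [xy|yx] := leP x y; last rewrite minC maxC.
    by rewrite (min_idPl Vxy) (max_idPr Vxy) !ltW.
  by rewrite (min_idPl Vxy) (max_idPr Vxy) !ltW.
by rewrite in_itv /= => cI Vc; exists c; split=> //; case/andP: cI => mc _; exact: lt_le_trans mc.
Qed.

End Sign.

(** * Exclusion of the other nonpositive eigenvalues *)

Section NoOther.
Variable R : realType.
Implicit Types (x y z : R).
Variable f0 : R -> R.
Hypothesis hs : smooth_closed_halfline f0.
Hypothesis hm : forall x y, 0 <= x -> x <= y -> f0 x <= f0 y.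
Hypothesis ode : profile_ode f0.
Hypothesis f00 : f0 0 = 0.
Hypothesis hL : exists L : R, f0 x @[x --> +oo] --> L.
Hypothesis hn : norm_le (fun y => f0 y - f0_tilde y) (5 / 10000).
Variable T : (R -> R) -> (R -> R) -> Prop.
Hypothesis sT : self_adjoint T.
Hypothesis eT : extends_A0 f0 T.

Lemma profile_neq0 : exists2 y, 0 < y & f0 y != 0.
Proof.
exists (yx (1 / 2)); last by rewrite gt_eqF// f0_half_neq0.
by have [] := yx_half R.
Qed.
Let hnz := profile_neq0.

(** Vanishing on (0, c] or on [c, oo) includes the smaller or the larger of x and y, at both of
    which V is nonzero. *)
Lemma no_zero (V V1 : R -> R) lam x y c :
  (forall y, 0 < y -> is_derive y 1 V (V1 y)) ->
  (forall y, 0 < y -> is_derive y 1 V1 ((pot f0 y - lam) * V y - (2 / y - y / 2) * V1 y)) ->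
  lam <= 0 -> L2rho V -> 0 < x -> 0 < y -> V x != 0 -> V y != 0 ->
  0 < c -> V c = 0 -> ~ (Num.min x y <= c <= Num.max x y).
Proof.
move=> dV dV1 lam0 LV x0 y0 Vx Vy c0 Vc /andP[mc cM].
have [cs|/ltW cs] := leP c (51%:R / 100%:R).
  have [h /(_ _)] := left_all hn hm f00 dV dV1 lam0 LV c0 cs.
  rewrite (bt_V0 V1 h Vc) lexx => /(_ isT) H.
  by move: mc; rewrite ge_min => /orP[] /H /eqP; rewrite ?(negPf Vx) ?(negPf Vy); auto.
have [h /(_ _)] := right_all hn hm f00 (profile_smooth hs) dV dV1 lam0 LV cs.
rewrite (bt_V0 V1 h Vc) lexx => /(_ isT) H.
by move: cM; rewrite le_max => /orP[] /H /eqP; rewrite ?(negPf Vx) ?(negPf Vy).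
Qed.

Lemma eigenvalue_m1 lam : lam <= 0 -> is_eigenvalue T lam -> lam = -1.
Proof.
move=> lam0 [v [Tv vv]]; apply/eqP/negPn/negP => lam1.
have [V [V1 [dV dV1 LV vV]]] := eigen_regular hs hm ode f00 hL hnz sT eT Tv.
have [TL2 Tadj] := sT.
have Tu := uu_graph hs hm ode f00 hL sT eT.
have [Lu _] := TL2 _ _ Tu; have [Lv _] := TL2 _ _ Tv.
have uv : ip (uu f0) v = 0.
  have /Tadj[_ [_ H]] := Tv; have := H _ _ Tu.
  rewrite ipC !ipZ// (ipC v) => E.
  (* Orthogonality of eigenfunctions for distinct eigenvalues, from the symmetry of the graph. *)
  have : (lam - -1) * ip (uu f0) v = 0 by rewrite mulrBl -E subrr.
  by move=> /eqP; rewrite mulf_eq0 subr_eq0 (negPf lam1) => /eqP.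
have uV : ip (uu f0) V = 0 by rewrite -(ip_ae vV Lu Lv LV).
have VV : ip V V = ip v v.
  by rewrite -(ip_ae vV LV Lv LV) ipC -(ip_ae vV Lv Lv LV).
have V_neq0 : ~ (forall y, 0 < y -> V y = 0).
  move=> V0; move: vv; rewrite -VV (@ip_ext _ _ (fun y => 0 * V y)); last by move=> y /V0 ->;
    rewrite mul0r.
  by rewrite ipC ipZ// mul0r ltxx.
have cV : forall y, 0 < y -> {for y, continuous V} by move=> y y0; exact: isd_cont (dV y y0).
have cu : forall y, 0 < y -> {for y, continuous (uu f0)} by move=> y y0;
  exact: isd_cont (uu_isd hs ode y0).
have u0 := uu_gt0 hs hm ode f00 hnz.
have [x x0 Vx] : exists2 x, 0 < x & V x < 0.
  apply: contrapT => H; apply: V_neq0; apply: (not_orthogonal_pos u0 _ cu cV Lu LV uV) => y y0.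
  by rewrite leNgt; apply/negP => Vy; apply: H; exists y.
have [y y0 Vy] : exists2 y, 0 < y & 0 < V y.
  apply: contrapT => H; apply: V_neq0.
  have LN : L2rho (fun y => - V y).
    move: LV => /L2rhoP[mV IV]; apply/L2rhoP; split; first exact: measurableT_comp.
    by apply: Dint_ext IV => y _; rewrite sqrrN.
  have N0 y : 0 < y -> - V y = 0.
    move=> y0; apply: (not_orthogonal_pos u0 _ cu _ Lu LN _ y0) => [z z0|z z0|].
    - by rewrite oppr_ge0 leNgt; apply/negP => Vz; apply: H; exists z.
    - by apply: continuousN; exact: cV.
    - by rewrite ipN// uV oppr0.
  by move=> y /N0/eqP; rewrite oppr_eq0 => /eqP.
have [c [c0 Vc cI]] := sign_change_zero cV x0 y0 Vx Vy.
by apply: (no_zero dV dV1 lam0 LV x0 y0 _ _ c0 Vc cI); [rewrite lt_eqF|rewrite gt_eqF].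
Qed.

End NoOther.

Theorem theorem2 (R : realType) (f0 : R -> R) :
  smooth_closed_halfline f0 ->
  monotone_halfline f0 ->
  profile_ode f0 ->
  f0 0 = 0 ->
  (exists L : R, f0 x @[x --> +oo] --> L) ->
  norm_le (fun y => f0 y - f0_tilde y) (5 / 10000) ->
  forall Aop : (R -> R) -> (R -> R) -> Prop,
    self_adjoint Aop -> extends_A0 f0 Aop ->
    forall lam : R, lam <= 0 -> (is_eigenvalue Aop lam <-> lam = -1).
Proof.
move=> hs hmon ode f00 hL hn Aop sT eT lam lam0.
have hnz := profile_neq0 hn.
have hm : forall x y, 0 <= x -> x <= y -> f0 x <= f0 y.
  (* A nonincreasing profile starting at 0 would be nonpositive, against its positive value at
     [yx (1 / 2)]. *)
  case: hmon => // hd.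
  have [y0 _] := yx_half R.
  by have := hd _ _ (lexx 0) (ltW y0); rewrite f00 leNgt f0_half_neq0.
split; first exact: (eigenvalue_m1 hs hm ode f00 hL hn sT eT lam0).
by move=> ->; exact: (eigen_m1 hs hm ode f00 hL hnz sT eT).
Qed.
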